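(* Let $p$ be a prime with $p\neq 2,11$. If $\left(\frac{p}{11}\right)=-1$, then $$\sum_{k=0}^{p-1}\frac{\binom{2k}{k}\binom{3k}{k}\binom{6k}{3k}}{(-32)^{3k}}\equiv 0\pmod{p^2}.$$ If $\left(\frac{p}{11}\right)=1$ and so $4p=x^2+11y^2$ with $x,y\in\mathbb{Z}$, then $$\sum_{k=0}^{p-1}\frac{\binom{2k}{k}\binom{3k}{k}\binom{6k}{3k}}{(-32)^{3k}}\equiv \left(\frac{-2}{p}\right)x^2\pmod p.$$
   Context: $\left(\frac{a}{q}\right)$ denotes the Legendre symbol. Congruences modulo $p$ and $p^2$ are in the ring of rational numbers whose denominator is coprime to $p$. *)

(* Defs.v *)
From mathcomp Require Import all_boot all_order all_algebra.
Set Implicit Arguments. Unset Strict Implicit. Unset Printing Implicit Defensive.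
Import Order.TTheory GRing.Theory Num.Theory.
Local Open Scope ring_scope.

(* Legendre symbol (a / q); meaningful for q an odd prime. *)
Definition legendre (a : int) (q : nat) : int :=
  if (q%:Z %| a)%Z then 0
  else if [exists x : 'I_q, ((x%:Z ^+ 2)%R == a %[mod q%:Z])%Z] then 1
  else -1.

Definition p_integral (p : nat) (a : rat) : bool := coprime p `|denq a|%N.

(* Congruence modulo the ideal generated by m in the ring of p-integral
   rationals; both sides are required to lie in that ring. *)
Definition eqmod_pint (p m : nat) (a b : rat) : Prop :=
  [/\ p_integral p a, p_integral p b
    & exists2 c : rat, p_integral p c & a - b = m%:R * c].

Definition sum_binom236 (p : nat) : rat :=
  \sum_(0 <= k < p)
    ('C(2 * k, k) * 'C(3 * k, k) * 'C(6 * k, 3 * k))%N%:R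
      / (- 32%:R) ^+ (3 * k).

(* Main.v *)
From HB Require Import structures.
Require Import Defs.
From mathcomp Require Import all_boot all_order all_algebra all_field.
From mathcomp Require Import ring zify.
Set Implicit Arguments. Unset Strict Implicit. Unset Printing Implicit Defensive.
Import Order.TTheory GRing.Theory Num.Theory.
Local Open Scope ring_scope.

(** Write [h = (p - 1) / 2], [lam = x^3 - 264 x + 1694], and let [H] be the
    coefficient of [x^(p-1)] in [lam^h], that is, the Hasse invariant of
    [y^2 = lam]. This elliptic curve has complex multiplication by [Z[t]] with
    [t^2 = t - 3], the ring of integers of [Q(sqrt(-11))]. The proof expresses
    the sum through [H], and then computes [H].

    From the sum to [H]. Clausen's identity ([clausen]) says that the square
    of [sum_k C(n,k) C(n+k,k) (-X)^k] is
    [sum_k C(n,k) C(n+k,k) C(2k,k) (-1)^k (X - X^2)^k]. Replace [n] by an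
    indeterminate [a] and keep only the terms [k < p]: the identity still holds
    at [a = n] and, by the symmetry [a -> -1-a], at [a = n - p], so its defect
    is a multiple of [(a - n) (a - n + p)] and vanishes modulo [p^2] for every
    integer [a] congruent to [n] modulo [p] ([defect_dvd]). For [a = -1/6] and
    [X - X^2 = 432 / (-32)^3] one side is the sum of the theorem. Modulo [p]
    the sum is thus the square of [S = sum_k C(3k,k) C(6k,3k) (X/432)^k]
    ([scaled_sum_sqr]), and it is zero modulo [p^2] as soon as [S] vanishes
    modulo [p] at both roots [X] ([wsqr_dvd]). On the other hand an affine
    substitution in [lam] shows that [S] equals [H] up to an explicit factor
    ([hasse_sextic]). Altogether the sum times [22^h] is [H^2] modulo [p]
    ([scaled_sum_hasse]), and [H = 0] forces divisibility by [p^2]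
    ([supersingular_dvd]).

    Computing [H]. Let [K] be an algebraically closed field of characteristic
    [p]. Minus a Gauss period of an 11-th root of unity is a root [t] of
    [t^2 = t - 3] in [K], and its Frobenius orbit is governed by the Legendre
    symbol of [p] modulo 11 ([root_frobenius]). Multiplication by [t] is an
    explicit rational map ([isogeny]). Raising that identity to the power [h]
    and comparing one coefficient gives [H = H t^(p-1)] ([inert_hasse]): if
    [t] is not in the prime field, [H = 0].

    If [t] is in the prime field, then [4 p = x^2 + 11 y^2], because there is
    only one class of forms of discriminant -11 ([class_number_one]); put
    [x = 2 m + n] and [y = n], so that [m + n t] has norm [p] and, after
    exchanging [t] and [1 - t] if needed, is zero in [K]. Maps of the curve to
    itself are encoded as points of [lam Y^2 = X^3 - 264 X + 1694] over
    [K(x)]: the point [Q = (x, 1)] is the identity, and [U] is multiplication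
    by [t]. The degree of a point satisfies the parallelogram law
    ([degree_parallelogram]), so [m Q + n U] has degree
    [m^2 + m n + 3 n^2 = p]; its effect on the invariant differential is
    additive ([has_multiplierD]), hence zero. Such a point is the Frobenius
    map up to sign ([inseparable_point]). Adding [Q] to it gives a point whose
    degree is [p + 1 + 2 m + n] by the quadratic form, and [1 + H] or [1 - H]
    in [K] by counting common roots of a numerator and a denominator, as in
    Manin's proof of Hasse's theorem ([degree_frobenius_add]). So
    [H^2 = x^2] ([cm_hasse_sqr]). Since [22 = (-2) (-11)] and [-11] is the
    square of [2 t - 1], the factor [22^h] is the Legendre symbol of [-2].

    The primes 3 and 7 are treated by direct evaluation: [-1/6] does not exist
    modulo 3, and the two roots [X] coincide modulo 7. *)

(** * The chord and tangent law on a twisted cubic *)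

Section TwistedCurve.
Variables (L : fieldType) (a b d : L).
Hypotheses (two_neq0 : (2%:R : L) != 0) (d_neq0 : d != 0).
Hypothesis disc_neq0 : 4%:R * a ^+ 3 + 27%:R * b ^+ 2 != 0.

Definition cubic (x : L) := x ^+ 3 + a * x + b.

(** [None] stands for the point at infinity. *)
Definition on_curve (P : option (L * L)) :=
  if P is Some (x, y) then d * y ^+ 2 == cubic x else true.

Definition pt_opp (P : option (L * L)) :=
  if P is Some (x, y) then Some (x, - y) else None.

Definition slope (x1 y1 x2 y2 : L) :=
  if x1 == x2 then (3%:R * x1 ^+ 2 + a) / (2%:R * d * y1)
  else (y1 - y2) / (x1 - x2).

(** The line of slope [l] through the first point meets the cubic in a third
    point, whose reflection this is. *)
Definition third (l x1 y1 x2 : L) :=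
  let x3 := d * l ^+ 2 - x1 - x2 in (x3, - (y1 + l * (x3 - x1))).

Definition pt_add (P R : option (L * L)) :=
  match P, R with
  | None, _ => R
  | _, None => P
  | Some (x1, y1), Some (x2, y2) =>
      if (x1 == x2) && (y1 == - y2) then None
      else Some (third (slope x1 y1 x2 y2) x1 y1 x2)
  end.

(** The line through the first point with slope [l] meets the cubic exactly at
    [x1], [x2] and [d * l ^+ 2 - x1 - x2]: the second equation is the coefficient
    of degree one of that factorization. Stating it without division treats
    chords and tangents alike. *)
Definition chord (l x1 y1 x2 y2 : L) :=
  y2 = y1 + l * (x2 - x1) /\
  a - 2%:R * d * l * (y1 - l * x1) =
    x1 * x2 + (x1 + x2) * (d * l ^+ 2 - x1 - x2).

Lemma chord_sym l x1 y1 x2 y2 : chord l x1 y1 x2 y2 -> chord l x2 y2 x1 y1.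
Proof.
case=> -> h; split; first by ring.
have -> : y1 + l * (x2 - x1) - l * x2 = y1 - l * x1 by ring.
by rewrite h; ring.
Qed.

Lemma chord_slope x1 y1 x2 y2 :
  d * y1 ^+ 2 = cubic x1 -> d * y2 ^+ 2 = cubic x2 ->
  ~~ ((x1 == x2) && (y1 == - y2)) ->
  chord (slope x1 y1 x2 y2) x1 y1 x2 y2.
Proof.
rewrite /slope /cubic => h1 h2; have [e|nx] /= := eqVneq x1 x2.
  subst x2; move=> ny.
  have e : y2 = y1.
    have /eqP : d * (y1 - y2) * (y1 + y2) = 0 by rewrite -[RHS](subrr (d * y1 ^+ 2)) {2}h1 -h2; ring.
    rewrite !mulf_eq0 (negPf d_neq0) /= subr_eq0 addr_eq0 (negPf ny) orbF.
    by move/eqP.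
  subst y2; split; first by ring.
  have y0 : y1 != 0.
    by apply: contra ny => /eqP ->; rewrite oppr0.
  by field; rewrite two_neq0 d_neq0 y0.
move=> _; have nx' : x1 - x2 != 0 by rewrite subr_eq0.
split; first by field.
set l := _ / _.
have hl : l * (x1 - x2) = y1 - y2 by rewrite /l divfK.
apply: (mulfI nx'); apply/eqP; rewrite -subr_eq0; apply/eqP.
have -> : a = (a * x1 + b - (a * x2 + b)) / (x1 - x2) by field.
have -> : a * x1 + b = d * y1 ^+ 2 - x1 ^+ 3 by rewrite h1; ring.
have -> : a * x2 + b = d * y2 ^+ 2 - x2 ^+ 3 by rewrite h2; ring.
rewrite /l; by field.
Qed.

Lemma chord_eval l x1 y1 x2 y2 z :
  d * y1 ^+ 2 = cubic x1 -> chord l x1 y1 x2 y2 ->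
  cubic z - d * (y1 + l * (z - x1)) ^+ 2 =
    (z - x1) * (z - x2) * (z - (d * l ^+ 2 - x1 - x2)).
Proof.
rewrite /cubic => h1 [_ h].
have -> : b = d * y1 ^+ 2 - x1 ^+ 3 - a * x1 by rewrite h1; ring.
have -> : a = 2%:R * d * l * (y1 - l * x1) + x1 * x2 + (x1 + x2) * (d * l ^+ 2 - x1 - x2).
  by rewrite -addrA -h; ring.
ring.
Qed.

Lemma on_curve_third l x1 y1 x2 y2 :
  d * y1 ^+ 2 = cubic x1 -> chord l x1 y1 x2 y2 ->
  on_curve (Some (third l x1 y1 x2)).
Proof.
move=> h1 hc; rewrite /third /on_curve; set x3 := _ - x2.
have := chord_eval x3 h1 hc; rewrite -/x3 subrr mulr0 => /eqP.
by rewrite subr_eq0 sqrrN => /eqP ->.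
Qed.

Lemma on_curve_add P R : on_curve P -> on_curve R -> on_curve (pt_add P R).
Proof.
case: P => [[x1 y1]|] //; case: R => [[x2 y2]|] // /eqP h1 /eqP h2.
rewrite /pt_add; case: ifPn => // n.
exact: (on_curve_third h1 (chord_slope h1 h2 n)).
Qed.

Lemma on_curve_opp P : on_curve P -> on_curve (pt_opp P).
Proof. by case: P => [[x y]|] //=; rewrite sqrrN. Qed.

Lemma chord_uniq l x1 y1 x2 y2 :
  d * y1 ^+ 2 = cubic x1 -> chord l x1 y1 x2 y2 ->
  ~~ ((x1 == x2) && (y1 == - y2)) -> l = slope x1 y1 x2 y2.
Proof.
move=> h1 hc n; rewrite /slope; have [e|nx] := eqVneq x1 x2.
  subst x2; case: hc => hy hc.
  have e : y2 = y1 by rewrite hy subrr mulr0 addr0.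
  rewrite e in n *; have y0 : y1 != 0.
    by move: n; rewrite eqxx /=; apply: contra => /eqP ->; rewrite oppr0.
  have -> : 3%:R * x1 ^+ 2 + a = l * (2%:R * d * y1).
    have -> : a = (a - 2%:R * d * l * (y1 - l * x1)) + 2%:R * d * l * (y1 - l * x1) by ring.
    by rewrite hc; ring.
  by rewrite mulfK // !mulf_neq0.
case: hc => -> _.
have nx' : x1 - x2 != 0 by rewrite subr_eq0.
by field.
Qed.

Lemma add_chord l x1 y1 x2 y2 :
  d * y1 ^+ 2 = cubic x1 -> chord l x1 y1 x2 y2 ->
  ~~ ((x1 == x2) && (y1 == - y2)) ->
  pt_add (Some (x1, y1)) (Some (x2, y2)) = Some (third l x1 y1 x2).
Proof.
by move=> h1 hc n; rewrite /pt_add (negPf n) -(chord_uniq h1 hc n).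
Qed.

Lemma pt_addC P R : on_curve P -> on_curve R -> pt_add P R = pt_add R P.
Proof.
case: P => [[x1 y1]|]; case: R => [[x2 y2]|] // /eqP h1 /eqP h2.
have [/andP[/eqP ex /eqP ey]|n] := boolP ((x1 == x2) && (y1 == - y2)).
  by subst; rewrite /pt_add !eqxx opprK eqxx.
have n' : ~~ ((x2 == x1) && (y2 == - y1)).
  by apply: contra n => /andP[/eqP -> /eqP ->]; rewrite opprK !eqxx.
have hc := chord_slope h1 h2 n.
rewrite (add_chord h1 hc n) (add_chord h2 (chord_sym hc) n') /third.
have [e _] := hc; set l := slope _ _ _ _ in e *.
congr (Some (_, _)); first by ring.
by rewrite e; ring.
Qed.

Lemma pt_addP0 P : pt_add P None = P. Proof. by case: P => [[]|]. Qed.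

Lemma pt_addN P : pt_add P (pt_opp P) = None.
Proof. by case: P => [[x y]|] //=; rewrite opprK !eqxx. Qed.

Lemma pt_addNl P : on_curve P -> pt_add (pt_opp P) P = None.
Proof. by move=> oP; rewrite pt_addC ?on_curve_opp // pt_addN. Qed.

Lemma pt_oppK P : pt_opp (pt_opp P) = P.
Proof. by case: P => [[x y]|] //=; rewrite opprK. Qed.

(** The line through [P + R] and [- R] is the reflection of the one that defined
    the sum. The law could only take its other branch if the curve were singular at [R]. *)
Lemma pt_addK P R : on_curve P -> on_curve R ->
  pt_add (pt_add P R) (pt_opp R) = P.
Proof.
case: P => [[x1 y1]|]; last by move=> _ _; exact: pt_addN.
case: R => [[x2 y2]|]; last by [].
move=> /[dup] /eqP h1 o1 /[dup] /eqP h2 o2.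
have [/andP[/eqP ex /eqP ey]|n] := boolP ((x1 == x2) && (y1 == - y2)).
  by subst; rewrite /= !eqxx.
have hc := chord_slope h1 h2 n; set l := slope _ _ _ _ in hc.
rewrite (add_chord h1 hc n) /third; set x3 := d * l ^+ 2 - x1 - x2.
set y3 := - _; have /eqP h3 : on_curve (Some (x3, y3)).
  exact: (on_curve_third h1 hc).
have [hy ha] := hc.
have hc' : chord (- l) x3 y3 x2 (- y2).
  rewrite /chord; split; first by rewrite hy /y3; ring.
  have -> : y3 - - l * x3 = - (y1 - l * x1) by rewrite /y3; ring.
  by transitivity (a - 2%:R * d * l * (y1 - l * x1)); [ring|rewrite ha /x3; ring].
rewrite /pt_opp (add_chord h3 hc') /third.
  by congr (Some (_, _)); rewrite ?/y3 /x3; ring.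
apply/negP; rewrite opprK => /andP[/eqP ex /eqP ey].
have y20 : y2 = 0.
  have : 2%:R * y2 = 0 by rewrite mulr_natl mulr2n -{1}ey /y3 ex -hy addNr.
  by move/eqP; rewrite mulf_eq0 (negPf two_neq0) => /eqP.
have el : y1 - l * x1 = - l * x2.
  by transitivity (y2 - l * x2); [rewrite hy|rewrite y20]; ring.
have dl : d * l ^+ 2 = x1 + 2%:R * x2.
  by transitivity (x3 + x1 + x2); [rewrite /x3|rewrite ex]; ring.
(* [R] would be a double root of the cubic, of abscissa [x2]. *)
have ea : a = - (3%:R * x2 ^+ 2).
  move: ha; rewrite el -/x3 ex => ha.
  have : a + 2%:R * (d * l ^+ 2) * x2 = x1 * x2 + (x1 + x2) * x2 by rewrite -ha; ring.
  by rewrite dl => /(canRL (addrK _)) ->; ring.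
have eb : b = 2%:R * x2 ^+ 3.
  move: h2; rewrite y20 /cubic ea expr0n /= mulr0 => /esym/(canRL (addKr _)) ->.
  ring.
by case/negP: disc_neq0; apply/eqP; rewrite ea eb; ring.
Qed.

(** The reason for associativity. Let [l], [l'] be the slopes joining a point to
    two others and [k] the slope joining the first sum to the remaining point.
    The parabola through the three points has leading coefficient
    [(l' - l) / (x2 - x1)], and [k + l] is the inverse of [d] times it: this is
    symmetric in the last two points. *)
Lemma slope_sum x0 y0 x1 y1 x2 y2 l l' k (s := d * l ^+ 2 - x0 - x1)
    (ys := - (y0 + l * (s - x0))) :
  chord l x0 y0 x1 y1 -> chord l' x0 y0 x2 y2 -> chord k s ys x2 y2 ->
  ~~ ((x0 == x2) && (y0 == - y2)) -> ~~ ((s == x2) && (ys == - y2)) ->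
  d * ys ^+ 2 = cubic s -> d * y2 ^+ 2 = cubic x2 ->
  d * (l' - l) * (k + l) = x2 - x1.
Proof.
case=> e1 c1 [e2 c2] [e3 c3] n1 n2 h1 h2.
pose e := y2 + y0 + l * (x2 - x0).
have ke : (k + l) * (x2 - s) = e.
  by rewrite /e e3 /ys; ring.
have [es|ns] := eqVneq s x2; last first.
  have ns' : x2 - s != 0 by rewrite subr_eq0 eq_sym.
  apply: (mulIf ns').
  transitivity (d * (l' - l) * ((k + l) * (x2 - s))); first by ring.
  rewrite ke /e e2.
  apply/eqP; rewrite -subr_eq0; apply/eqP.
  transitivity ((a - 2%:R * d * l * (y0 - l * x0) - (x0 * x1 + (x0 + x1) * s)) -
     (a - 2%:R * d * l' * (y0 - l' * x0) - (x0 * x2 + (x0 + x2) * (d * l' ^+ 2 - x0 - x2)))).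
    by rewrite /s; ring.
  by rewrite c1 c2 -/s !subrr.
have ey : ys = y2.
  by apply/eqP; rewrite e3 es; apply/eqP; ring.
have e0 : e = 0 by rewrite -ke es subrr mulr0.
have n02 : x2 - x0 != 0.
  rewrite subr_eq0; apply: contra n1 => /eqP ex; rewrite ex eqxx /=.
  by move: e0; rewrite /e ex subrr mulr0 addr0 => /eqP; rewrite addrC addr_eq0.
have ly : (l' - l) * (x2 - x0) = 2%:R * y2.
  transitivity (2%:R * y2 - e); last by rewrite e0 subr0.
  by rewrite /e e2; ring.
apply: (mulIf n02).
transitivity (2%:R * d * y2 * (k + l)).
  by transitivity (d * ((l' - l) * (x2 - x0)) * (k + l)); [ring|rewrite ly; ring].
have dl : d * l ^+ 2 = x2 + x0 + x1 by rewrite -es /s; ring.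
move: c3; rewrite es ey => c3.
have el : y0 - l * x0 = - y2 - l * x2.
  by rewrite -ey /ys es; ring.
have {}c1 : a + 2%:R * d * l * y2 + 2%:R * (d * l ^+ 2) * x2 = x0 * x1 + (x0 + x1) * x2.
  by rewrite -es -c1 el -es; ring.
have {}c3 : 2%:R * d * k * y2 = a + 3%:R * x2 ^+ 2.
  transitivity (a - (a - 2%:R * d * k * (y2 - k * x2)) + 2%:R * d * k ^+ 2 * x2); first by ring.
  by rewrite c3; ring.
transitivity (2%:R * d * k * y2 + 2%:R * d * l * y2); first by ring.
rewrite c3; have -> : 2%:R * d * l * y2 = x0 * x1 + (x0 + x1) * x2 - a - 2%:R * (d * l ^+ 2) * x2.
  by rewrite -c1; ring.
by rewrite dl; ring.
Qed.

(** In general position both sides are given by [slope_sum]; each degenerate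
    configuration reduces to the cancellation law [pt_addK]. *)
Lemma pt_add_swap A V U : on_curve A -> on_curve V -> on_curve U ->
  pt_add (pt_add A V) U = pt_add (pt_add A U) V.
Proof.
move=> oA oV oU.
case: V oV => [[x1 y1]|] oV; last by rewrite !pt_addP0.
case: U oU => [[x2 y2]|] oU; last by rewrite !pt_addP0.
case: A oA => [[x0 y0]|] oA; last by rewrite [LHS]pt_addC.
have oppE x y : Some (x, - y) = pt_opp (Some (x, y)) by [].
have o1' := on_curve_opp oV; have o2' := on_curve_opp oU.
have [/andP[/eqP ex /eqP ey]|n1] := boolP ((x0 == x1) && (y0 == - y1)).
  subst; rewrite oppE pt_addNl //.
  rewrite [pt_add (pt_opp _) _]pt_addC // -{2}[Some (x1, y1)]pt_oppK.
  by rewrite pt_addK.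
have [/andP[/eqP ex /eqP ey]|n2] := boolP ((x0 == x2) && (y0 == - y2)).
  subst; rewrite oppE [pt_add (pt_opp _) (Some (x2, y2))]pt_addNl //.
  rewrite [pt_add (pt_opp _) _]pt_addC // -{2}[Some (x2, y2)]pt_oppK.
  by rewrite pt_addK.
have h0 := eqP oA; have h1 := eqP oV; have h2 := eqP oU.
have [ex|nx] := eqVneq x2 x1.
  subst; have : (y1 - y2) * (y1 + y2) = 0.
    by apply: (mulfI d_neq0); transitivity (d * y1 ^+ 2 - d * y2 ^+ 2);
      [ring | rewrite h1 h2 subrr mulr0].
  move/eqP; rewrite mulf_eq0 subr_eq0 addr_eq0 => /orP[]/eqP ->; first by [].
  rewrite oppE pt_addK // -{2}[Some (x1, y2)]pt_oppK pt_addK //.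
set SA := pt_add (Some (x0, y0)) (Some (x1, y1)).
set SB := pt_add (Some (x0, y0)) (Some (x2, y2)).
have oSA : on_curve SA by exact: on_curve_add.
have oSB : on_curve SB by exact: on_curve_add.
have c1 := chord_slope h0 h1 n1; set l := slope _ _ _ _ in c1.
have c2 := chord_slope h0 h2 n2; set l' := slope _ _ _ _ in c2.
have eSA := add_chord h0 c1 n1; have eSB := add_chord h0 c2 n2.
have aux V U (oV' : on_curve V) (oU' : on_curve U) :
    pt_add (Some (x0, y0)) V = pt_opp U -> pt_add (Some (x0, y0)) U = pt_opp V.
  move=> e; have := pt_addK oA oV'; rewrite e => <-.
  rewrite [pt_add (pt_opp U) _]pt_addC ?on_curve_opp //.
  by rewrite -{2}[U]pt_oppK pt_addK ?on_curve_opp.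
have [e|nSA] := eqVneq SA (pt_opp (Some (x2, y2))).
  rewrite e /SB (aux _ _ oV oU e) [LHS]pt_addC // [RHS]pt_addC //.
  by rewrite !pt_addN.
have [e|nSB] := eqVneq SB (pt_opp (Some (x1, y1))).
  by case/negP: nSA; rewrite /SA (aux _ _ oU oV e) eqxx.
rewrite -/SA -/SB in eSA eSB; rewrite eSA eSB in oSA oSB nSA nSB *.
rewrite /third in oSA oSB nSA nSB *.
set s := d * l ^+ 2 - x0 - x1 in oSA nSA *; set ys := - _ in oSA nSA *.
set t := d * l' ^+ 2 - x0 - x2 in oSB nSB *; set yt := - _ in oSB nSB *.
have m1 : ~~ ((s == x2) && (ys == - y2)).
  by apply: contra nSA => /andP[/eqP -> /eqP ->].
have m2 : ~~ ((t == x1) && (yt == - y1)).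
  by apply: contra nSB => /andP[/eqP -> /eqP ->].
have hs := eqP oSA; have ht := eqP oSB.
have c3 := chord_slope hs h2 m1; set k := slope _ _ _ _ in c3.
have c4 := chord_slope ht h1 m2; set k' := slope _ _ _ _ in c4.
(* The two instances differ by exchanging [V] and [U]. *)
have k1 := slope_sum c1 c2 c3 n2 m1 hs h2.
have k2 := slope_sum c2 c1 c4 n1 m2 ht h1.
rewrite (add_chord hs c3 m1) (add_chord ht c4 m2).
have nx' : x2 - x1 != 0 by rewrite subr_eq0.
have dl0 : d * (l' - l) != 0.
  by apply: contraNneq nx' => e; rewrite -k1 e mul0r.
have ek : k' = k + l - l'.
  suff -> : k + l = k' + l' by ring.
  apply: (mulfI dl0); rewrite k1.
  by transitivity (- (d * (l - l') * (k' + l'))); [rewrite k2|]; ring.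
have x12 : x2 = x1 + d * (l' - l) * (k + l) by rewrite k1; ring.
rewrite /third ek; congr (Some (_, _)).
  by rewrite /s /t x12; ring.
by rewrite /ys /yt /s /t x12; ring.
Qed.

Lemma pt_addA P Q R : on_curve P -> on_curve Q -> on_curve R ->
  pt_add P (pt_add Q R) = pt_add (pt_add P Q) R.
Proof.
move=> oP oQ oR; rewrite [LHS]pt_addC ?on_curve_add //.
by rewrite pt_add_swap // [pt_add Q P]pt_addC.
Qed.

End TwistedCurve.

(** * Abscissae of sums, and the group of points *)

Section Coordinates.
Variables (L : fieldType) (a b d : L).
Hypotheses (two_neq0 : (2%:R : L) != 0) (d_neq0 : d != 0).
Hypothesis disc_neq0 : 4%:R * a ^+ 3 + 27%:R * b ^+ 2 != 0.

Local Notation cubic := (cubic a b).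
Local Notation pt_add := (pt_add a d).

(** The three abscissae are the roots of [cubic z - d (y1 + l (z - x1))^2]; this
    is what remains of their symmetric functions after elimination of the two
    coefficients of the line. It is free of ordinates. *)
Lemma add_collinear x1 y1 x2 y2 x3 y3 :
  d * y1 ^+ 2 = cubic x1 -> d * y2 ^+ 2 = cubic x2 ->
  pt_add (Some (x1, y1)) (Some (x2, y2)) = Some (x3, y3) ->
  (x1 * x2 + x1 * x3 + x2 * x3 - a) ^+ 2 =
    4%:R * (x1 * x2 * x3 + b) * (x1 + x2 + x3).
Proof.
move=> h1 h2; rewrite /pt_add; case: ifPn => // n [<- _] {x3 y3}.
have hc := chord_slope two_neq0 d_neq0 h1 h2 n; set l := slope _ _ _ _ _ _ in hc *.
have e0 := chord_eval 0 h1 hc; have [_ ha] := hc.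
set x4 := d * l ^+ 2 - x1 - x2 in ha e0 *.
have hs : x1 + x2 + x4 = d * l ^+ 2 by rewrite /x4; ring.
have {}hb : x1 * x2 * x4 + b = d * (y1 - l * x1) ^+ 2.
  have -> : x1 * x2 * x4 = - ((0 - x1) * (0 - x2) * (0 - x4)) by ring.
  by rewrite -e0 /cubic; ring.
have {}ha : x1 * x2 + x1 * x4 + x2 * x4 - a = - (2%:R * d * l * (y1 - l * x1)).
  by transitivity (x1 * x2 + (x1 + x2) * x4 - a); [|rewrite -ha]; ring.
by rewrite ha hb hs; ring.
Qed.

(** Passing from [P + R] to [P - R] changes the sign of [y2], so the symmetric
    functions of the two abscissae involve only [x1] and [x2]. *)
Lemma add_sub_coord x1 y1 x2 y2 x3 y3 x4 y4 :
  d * y1 ^+ 2 = cubic x1 -> d * y2 ^+ 2 = cubic x2 -> x1 != x2 ->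
  pt_add (Some (x1, y1)) (Some (x2, y2)) = Some (x3, y3) ->
  pt_add (Some (x1, y1)) (Some (x2, - y2)) = Some (x4, y4) ->
  [/\ (x3 + x4) * (x1 - x2) ^+ 2 =
         2%:R * ((x1 * x2 + a) * (x1 + x2) + 2%:R * b),
      x3 * x4 * (x1 - x2) ^+ 2 =
         (x1 * x2 - a) ^+ 2 - 4%:R * b * (x1 + x2)
    & (x4 - x3) * (x1 - x2) ^+ 2 = 4%:R * d * y1 * y2].
Proof.
move=> h1 h2 nx; rewrite /pt_add (negPf nx) /= /third /slope (negPf nx).
have nx' : x1 - x2 != 0 by rewrite subr_eq0.
case=> <- _ [<- _].
have ea : a = ((d * y1 ^+ 2 - x1 ^+ 3) - (d * y2 ^+ 2 - x2 ^+ 3)) / (x1 - x2).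
  by rewrite h1 h2 /cubic; field.
have eb : b = d * y1 ^+ 2 - x1 ^+ 3 - a * x1 by rewrite h1 /cubic; ring.
by split; rewrite ?eb ?ea; field.
Qed.

Lemma double_coord x y x3 y3 :
  d * y ^+ 2 = cubic x -> y != 0 ->
  pt_add (Some (x, y)) (Some (x, y)) = Some (x3, y3) ->
  x3 * (4%:R * cubic x) =
    x ^+ 4 - 2%:R * a * x ^+ 2 - 8%:R * b * x + a ^+ 2.
Proof.
move=> h y0; rewrite /pt_add eqxx /=; case: ifP => // n [<- _].
rewrite /slope eqxx -h.
have -> : b = d * y ^+ 2 - x ^+ 3 - a * x by rewrite h /cubic; ring.
by field; rewrite two_neq0 d_neq0 y0.
Qed.

End Coordinates.

(** The side conditions are bundled with the coefficients so that the group
    structure on points can be inferred from the curve alone. *)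
Record twist (L : fieldType) := Twist {
  tw_a : L; tw_b : L; tw_d : L;
  tw_two : (2%:R : L) != 0;
  tw_d0 : tw_d != 0;
  tw_disc : 4%:R * tw_a ^+ 3 + 27%:R * tw_b ^+ 2 != 0 }.

Section Group.
Variables (L : fieldType) (C : twist L).

Record point := Point {
  coords :> option (L * L);
  coordsP : on_curve (tw_a C) (tw_b C) (tw_d C) coords }.

HB.instance Definition _ := [isSub for coords].
HB.instance Definition _ := [Choice of point by <:].

Definition point_add (P Q : point) :=
  Point (on_curve_add (tw_two C) (tw_d0 C) (coordsP P) (coordsP Q)).
Definition point_opp (P : point) := Point (on_curve_opp (coordsP P)).
Definition point_zero := @Point None isT.

Fact point_addA : associative point_add.
Proof.
move=> P Q R; apply: val_inj => /=.
exact: (pt_addA (tw_two C) (tw_d0 C) (tw_disc C) (coordsP P) (coordsP Q) (coordsP R)).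
Qed.
Fact point_addC : commutative point_add.
Proof.
move=> P Q; apply: val_inj => /=.
exact: (pt_addC (tw_two C) (tw_d0 C) (coordsP P) (coordsP Q)).
Qed.
Fact point_add0 : left_id point_zero point_add.
Proof. by move=> P; apply: val_inj. Qed.
Fact point_addN : left_inverse point_zero point_opp point_add.
Proof. by move=> P; apply: val_inj; exact: (pt_addNl (tw_two C) (tw_d0 C) (coordsP P)). Qed.

HB.instance Definition _ := GRing.isZmodule.Build point
  point_addA point_addC point_add0 point_addN.

Lemma coordsD (P Q : point) : coords (P + Q) = pt_add (tw_a C) (tw_d C) P Q.
Proof. by []. Qed.
Lemma coordsN (P : point) : coords (- P) = pt_opp P.
Proof. by []. Qed.
Lemma coords_eq0 (P : point) : (P == 0) = (coords P == None).
Proof. by []. Qed.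

End Group.

(** * Poles and heights of fractions of polynomials *)

Ltac size_lia :=
  clear; repeat match goal with |- context [@size _ (@polyseq _ ?p)] =>
    let n := fresh "n" in move: (size p) => n end; lia.

Section FunctionField.
Variables (k L : fieldType) (f : {rmorphism {poly k} -> L}).
Hypothesis f_inj : injective f.
Hypothesis f_frac : forall x : L,
  exists AB : {poly k} * {poly k}, (AB.2 != 0) && (x == f AB.1 / f AB.2).

Lemma f_eq0 p : (f p == 0) = (p == 0).
Proof. by rewrite -(inj_eq f_inj) rmorph0. Qed.

Lemma frac_reduced x : exists AB : {poly k} * {poly k},
  [&& AB.2 != 0, x == f AB.1 / f AB.2 & coprimep AB.1 AB.2].
Proof.
have [[A B] /= /andP[B0 /eqP ->]] := f_frac x.
have g0 : gcdp A B != 0 by rewrite gcdp_eq0 negb_and B0 orbT.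
have cAB : coprimep (A %/ gcdp A B) (B %/ gcdp A B).
  by apply: coprimep_div_gcd; rewrite B0 orbT.
have eA : A = A %/ gcdp A B * gcdp A B by rewrite divpK ?dvdp_gcdl.
have eB : B = B %/ gcdp A B * gcdp A B by rewrite divpK ?dvdp_gcdr.
exists (A %/ gcdp A B, B %/ gcdp A B).
move: cAB eA eB g0; move: (gcdp A B) => g; move: (A %/ g) (B %/ g) => A1 B1.
move=> c eA eB g0; rewrite {}eA {A}; rewrite {}eB {B} in B0 *.
move: B0; rewrite mulf_eq0 negb_or => /andP[B0 _]; apply/and3P; split => //=.
by rewrite !rmorphM /= -mulf_div divff ?mulr1 // f_eq0.
Qed.

(** [L] is a field of fractions of [{poly k}] through [f]. The reduced numerator
    and denominator are arbitrary representatives; only their sizes matter, and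
    these do not depend on the choice ([num_den_eqp]). *)
Definition num x : {poly k} := (xchoose (frac_reduced x)).1.
Definition den x : {poly k} := (xchoose (frac_reduced x)).2.

Lemma den_neq0 x : den x != 0.
Proof. by have /and3P[] := xchooseP (frac_reduced x). Qed.
Lemma fden_neq0 x : f (den x) != 0.
Proof. by rewrite f_eq0 den_neq0. Qed.
Lemma num_den x : x = f (num x) / f (den x).
Proof. by have /and3P[_ /eqP] := xchooseP (frac_reduced x). Qed.
Lemma num_den_coprimep x : coprimep (num x) (den x).
Proof. by have /and3P[] := xchooseP (frac_reduced x). Qed.

Lemma num_den_eqp x A B : B != 0 -> coprimep A B -> x = f A / f B ->
  (num x %= A) * (den x %= B).
Proof.
move=> B0 cAB e.
have fB0 : f B != 0 by rewrite f_eq0.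
have E : num x * B = A * den x.
  apply: f_inj; rewrite !rmorphM.
  have := e; rewrite {1}(num_den x) => /eqP.
  by rewrite eqr_div ?fden_neq0 // => /eqP.
have c' : coprimep B A by rewrite coprimep_sym.
have cx := num_den_coprimep x; have cx' : coprimep (den x) (num x) by rewrite coprimep_sym.
split; rewrite /eqp.
  rewrite -(Gauss_dvdpl _ cx) -E dvdp_mulr //=.
  by rewrite -(Gauss_dvdpl _ cAB) E dvdp_mulr.
rewrite -(Gauss_dvdpr _ cx') E dvdp_mull //=.
by rewrite -(Gauss_dvdpr _ c') -E dvdp_mull.
Qed.

(** Poles are at infinity. In the presence of such a pole the degree of [x], seen
    as a map of the projective line, is that of its numerator. *)
Definition pole x := (size (den x) < size (num x))%N.
Definition height x := (size (num x)).-1.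

Lemma size_num x A B : B != 0 -> coprimep A B -> x = f A / f B ->
  size (num x) = size A.
Proof. by move=> B0 c e; have [h _] := num_den_eqp B0 c e; exact: eqp_size. Qed.
Lemma size_den x A B : B != 0 -> coprimep A B -> x = f A / f B ->
  size (den x) = size B.
Proof. by move=> B0 c e; have [_ h] := num_den_eqp B0 c e; exact: eqp_size. Qed.

Lemma poleE x A B : B != 0 -> coprimep A B -> x = f A / f B ->
  pole x = (size B < size A)%N.
Proof. by move=> *; rewrite /pole (@size_num x A B) // (@size_den x A B). Qed.
Lemma heightE x A B : B != 0 -> coprimep A B -> x = f A / f B ->
  height x = (size A).-1.
Proof. by move=> *; rewrite /height (@size_num x A B). Qed.

Lemma num_neq0 x : pole x -> num x != 0.
Proof. by rewrite -size_poly_gt0; apply: leq_trans. Qed.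

(** Gauss's lemma for the product of the primitive polynomials [A1 z + B1] and
    [A2 z + B2] in an auxiliary variable [z]. *)
Lemma coprimep_mul3 (A1 B1 A2 B2 g : {poly k}) :
  coprimep A1 B1 -> coprimep A2 B2 ->
  g %| B1 * B2 -> g %| A1 * A2 -> g %| A1 * B2 + A2 * B1 -> g %= 1.
Proof.
move=> c1 c2 gB gA gS.
have aux (C1 D1 C2 D2 : {poly k}) : coprimep C1 D1 -> coprimep C2 D2 ->
   g %| C1 * C2 -> g %| C1 * D2 + C2 * D1 -> coprimep g D1.
  move=> h1 h2 gC gT; rewrite /coprimep.
  set e := gcdp g D1.
  have eg : e %| g by apply: dvdp_gcdl.
  have eD : e %| D1 by apply: dvdp_gcdr.
  have ceC : coprimep e C1.
    by rewrite coprimep_sym; apply: coprimep_dvdl eD h1.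
  have e2 : e %| C2 by rewrite -(Gauss_dvdpr _ ceC); apply: dvdp_trans eg gC.
  have e3 : e %| D2.
    rewrite -(Gauss_dvdpr _ ceC).
    by rewrite -(dvdp_addl _ (dvdp_mulr D1 e2)); apply: dvdp_trans eg gT.
  have e4 : e %| gcdp C2 D2 by rewrite dvdp_gcd e2.
  by move: e4; rewrite (eqp_dvdr e (_ : _ %= 1)) ?dvdp1 // gcdp_eqp1.
have g1 : coprimep g B1 by exact: aux c1 c2 gA gS.
have g2 : coprimep g B2 by apply: (aux A2 B2 A1 B1) => //; [rewrite mulrC|rewrite addrC].
have : coprimep g g by apply: (coprimep_dvdl gB); rewrite coprimepMr g1.
by rewrite coprimepp size_poly_eq1.
Qed.

Lemma size_num_gt1 x : pole x -> (1 < size (num x))%N.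
Proof.
by move=> px; apply: leq_trans px; rewrite ltnS size_poly_gt0 den_neq0.
Qed.

Variables (a b : k).
Hypothesis disc_neq0 : 4%:R * a ^+ 3 + 27%:R * b ^+ 2 != 0.
Hypothesis two_neq0 : (2%:R : k) != 0.
Let fa := f a%:P.
Let fb := f b%:P.

(** Clear denominators: the coefficients [B3 B4], [A3 B4 + A4 B3], [A3 A4] of
    [(A3 z + B3) (A4 z + B4)] are coprime by [coprimep_mul3] and proportional to
    polynomials in the numerators and denominators of [x1] and [x2], so their
    degrees are bounded by the degrees of the latter. *)
Lemma height_sum_le x1 x2 x3 x4 : pole x1 -> pole x2 -> pole x3 -> pole x4 ->
  x1 != x2 ->
  (x3 + x4) * (x1 - x2) ^+ 2 =
    2%:R * ((x1 * x2 + fa) * (x1 + x2) + 2%:R * fb) ->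
  x3 * x4 * (x1 - x2) ^+ 2 =
    (x1 * x2 - fa) ^+ 2 - 4%:R * fb * (x1 + x2) ->
  (height x3 + height x4 <= 2 * (height x1 + height x2))%N.
Proof.
move=> p1 p2 p3 p4.
have s1 := size_num_gt1 p1; have s2 := size_num_gt1 p2.
have s3 := size_num_gt1 p3; have s4 := size_num_gt1 p4.
have n3 := num_neq0 p3; have n4 := num_neq0 p4.
have e1 := num_den x1; have e2 := num_den x2.
have e3 := num_den x3; have e4 := num_den x4.
have f1 := fden_neq0 x1; have f2 := fden_neq0 x2.
have f3 := fden_neq0 x3; have f4 := fden_neq0 x4.
have d3 := den_neq0 x3; have d4 := den_neq0 x4.
have c3 := num_den_coprimep x3; have c4 := num_den_coprimep x4.
move: p1 p2; rewrite /pole /height.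
move: (num x1) (den x1) e1 f1 s1 => A1 B1 e1 f1 s1 p1.
move: (num x2) (den x2) e2 f2 s2 => A2 B2 e2 f2 s2 p2.
move: (num x3) (den x3) e3 f3 s3 n3 d3 c3 => A3 B3 e3 f3 s3 n3 d3 c3.
move: (num x4) (den x4) e4 f4 s4 n4 d4 c4 => A4 B4 e4 f4 s4 n4 d4 c4.
rewrite {}e1 {}e2 {}e3 {}e4 {p3 p4} => nx E1 E2.
pose T0 : {poly k} := (A1 * B2 - A2 * B1) ^+ 2.
pose M : {poly k} := A1 * B2 + A2 * B1.
pose T1 : {poly k} := 2%:R * ((A1 * A2 + a%:P * (B1 * B2)) * M + 2%:R * b%:P * (B1 * B2) ^+ 2).
pose T2 : {poly k} := (A1 * A2 - a%:P * (B1 * B2)) ^+ 2 - 4%:R * b%:P * (B1 * B2) * M.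
have T00 : T0 != 0.
  rewrite expf_eq0 /= subr_eq0; apply: contra nx => /eqP e.
  by rewrite eqr_div // -!rmorphM e.
have F1 : T0 * (A3 * B4 + A4 * B3) = T1 * (B3 * B4).
  apply: f_inj; rewrite !(rmorphM, rmorphB, rmorphD, rmorphXn, rmorph_nat) /=.
  transitivity ((f A3 / f B3 + f A4 / f B4) * (f A1 / f B1 - f A2 / f B2) ^+ 2 *
     (f B1 * f B2) ^+ 2 * (f B3 * f B4)); first by field; rewrite f1 f2 f3 f4.
  by rewrite E1 -/fa -/fb; field; rewrite f1 f2.
have F2 : T0 * (A3 * A4) = T2 * (B3 * B4).
  apply: f_inj; rewrite !(rmorphM, rmorphB, rmorphD, rmorphXn, rmorph_nat) /=.
  transitivity (f A3 / f B3 * (f A4 / f B4) * (f A1 / f B1 - f A2 / f B2) ^+ 2 *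
     (f B1 * f B2) ^+ 2 * (f B3 * f B4)); first by field; rewrite f1 f2 f3 f4.
  by rewrite E2 -/fa -/fb; field; rewrite f1 f2.
have dv : B3 * B4 %| T0.
  set G := gcdp (B3 * B4) (gcdp (A3 * A4) (A3 * B4 + A4 * B3)).
  have G1 : G %= 1.
    have gr : G %| gcdp (A3 * A4) (A3 * B4 + A4 * B3) by apply: dvdp_gcdr.
    apply: (coprimep_mul3 c3 c4); first exact: dvdp_gcdl.
      by apply: dvdp_trans gr _; apply: dvdp_gcdl.
    by apply: dvdp_trans gr _; apply: dvdp_gcdr.
  have : B3 * B4 %| T0 * G.
    rewrite (eqp_dvdr _ (mulp_gcdr _ _ _)) dvdp_gcd dvdp_mull //=.
    by rewrite (eqp_dvdr _ (mulp_gcdr _ _ _)) dvdp_gcd F1 F2 dvdp_mull //= dvdp_mull.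
  by rewrite (eqp_dvdr _ (eqp_mull T0 G1)) mulr1.
have [h eh] : exists h : {poly k}, T0 = h * (B3 * B4) by exact/dvdpP.
have h0 : h != 0 by apply: contraNneq T00 => h0; rewrite eh h0 mul0r.
have {}F2 : h * (A3 * A4) = T2.
  have B34 : B3 * B4 != 0 by rewrite mulf_neq0.
  by apply: (mulIf B34); rewrite -F2 eh; ring.
have st : (size A3 + size A4 <= (size T2).+1)%N.
  rewrite -F2 size_mul ?mulf_neq0 // size_mul //.
  have h1 : (0 < size h)%N by rewrite size_poly_gt0.
  by move: h1 s3 s4; size_lia.
have s12 : (size (A1 * A2)%R <= (size A1 + size A2).-1)%N by apply: size_polyMleq.
have t12 : (size (B1 * B2)%R <= (size B1 + size B2).-1)%N by apply: size_polyMleq.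
have m12 : (size M <= (size A1 + size A2).-2)%N.
  apply: leq_trans (size_polyD _ _) _; rewrite geq_max.
  have u1 := size_polyMleq A1 B2; have u2 := size_polyMleq A2 B1.
  by move: u1 u2 s1 s2 p1 p2; size_lia.
have sT2 : (size T2 <= (2 * (size A1 + size A2)).-1.-2)%N.
  apply: leq_trans (size_polyD _ _) _; rewrite size_polyN geq_max; apply/andP; split.
    have : (size (A1 * A2 - a%:P * (B1 * B2))%R <= (size A1 + size A2).-1)%N.
      apply: leq_trans (size_polyD _ _) _; rewrite size_polyN geq_max s12 /=.
      rewrite mul_polyC; apply: leq_trans (size_scale_leq _ _) _.
      by apply: leq_trans t12 _; move: p1 p2; size_lia.
    rewrite expr2; move: (_ - _) => W hW.
    apply: leq_trans (size_polyMleq _ _) _.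
    by move: hW s1 s2; size_lia.
  have u1 := size_polyMleq (4%:R * b%:P * (B1 * B2)) M.
  have u2 : (size (4%:R * b%:P * (B1 * B2))%R <= size (B1 * B2)%R)%N.
    by rewrite -polyC_natr -polyCM mul_polyC; exact: size_scale_leq.
  apply: leq_trans u1 _; have := leq_trans u2 t12; move: m12.
  by move: s1 s2 p1 p2; size_lia.
by move: st sT2 s1 s2 s3 s4; size_lia.
Qed.

Lemma size_exp_poly (P : {poly k}) n : P != 0 ->
  size (P ^+ n) = ((size P).-1 * n).+1.
Proof. by move=> P0; rewrite -size_exp prednK // size_poly_gt0 expf_neq0. Qed.

Lemma size_scale_poly c (P : {poly k}) n :
  (size P <= n -> size (c%:P * P)%R <= n)%N.
Proof.
by move=> h; rewrite mul_polyC; apply: leq_trans (size_scale_leq _ _) h.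
Qed.

Lemma size_mul_exp (A B : {poly k}) n : A != 0 -> B != 0 ->
  (size (A * B ^+ n)%R <= size A + (size B).-1 * n)%N.
Proof.
by move=> A0 B0; rewrite size_mul ?expf_neq0 // size_exp_poly // addnS.
Qed.

Lemma pole_cubic_neq0 x : pole x -> x ^+ 3 + fa * x + fb != 0.
Proof.
move=> px; have sA := size_num_gt1 px.
have fB := fden_neq0 x; have B0 := den_neq0 x; have A0 := num_neq0 px.
rewrite (num_den x); move: px; rewrite /pole.
move: (num x) (den x) sA fB B0 A0 => A B sA fB B0 A0 px.
have -> : (f A / f B) ^+ 3 + fa * (f A / f B) + fb =
    f (A ^+ 3 + (a%:P * (A * B ^+ 2) + b%:P * B ^+ 3)) / f B ^+ 3.
  by rewrite !(rmorphM, rmorphD, rmorphXn) /= -/fa -/fb; field.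
rewrite mulf_neq0 ?invr_eq0 ?expf_neq0 // f_eq0.
rewrite -size_poly_gt0 size_polyDl size_exp_poly // ltnS.
apply: leq_trans (size_polyD _ _) _; rewrite geq_max; apply/andP; split.
  apply: size_scale_poly; apply: leq_trans (size_mul_exp _ _ _) _ => //.
  by move: px sA; size_lia.
by apply: size_scale_poly; rewrite size_exp_poly //; move: px sA; size_lia.
Qed.

(** If [x3] had no pole, the square on the left would have a pole of order
    strictly greater than that of the right side. *)
Lemma pole_collinear x1 x2 x3 : pole x1 -> pole x2 ->
  (x1 * x2 + x1 * x3 + x2 * x3 - fa) ^+ 2 =
    4%:R * (x1 * x2 * x3 + fb) * (x1 + x2 + x3) -> pole x3.
Proof.
move=> p1 p2 E; have n1 := num_neq0 p1; have n2 := num_neq0 p2.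
have f1 := fden_neq0 x1; have f2 := fden_neq0 x2; have f3 := fden_neq0 x3.
have d3 := den_neq0 x3.
have e1 := num_den x1; have e2 := num_den x2; have e3 := num_den x3.
move: p1 p2; rewrite /pole.
move: (num x1) (den x1) e1 f1 n1 => A1 B1 e1 f1 n1 p1.
move: (num x2) (den x2) e2 f2 n2 => A2 B2 e2 f2 n2 p2.
move: (num x3) (den x3) e3 f3 d3 => A3 B3 e3 f3 d3.
have s3 : (0 < size B3)%N by rewrite size_poly_gt0.
rewrite ltnNge; apply/negP => p3.
pose U : {poly k} := A1 * B2 + A2 * B1.
pose W : {poly k} := A3 * U - a%:P * (B1 * B2 * B3).
pose X : {poly k} := A1 * A2 * A3 + b%:P * (B1 * B2 * B3).
pose Y : {poly k} := U * B3 + A3 * (B1 * B2).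
have {E} F : (A1 * A2 * B3 + W) ^+ 2 = 4%:R%:P * (X * Y).
  apply: f_inj; rewrite polyC_natr.
  rewrite !(rmorphM, rmorphB, rmorphD, rmorphXn, rmorph_nat) /= -/fa -/fb.
  transitivity ((x1 * x2 + x1 * x3 + x2 * x3 - fa) ^+ 2 * (f B1 * f B2 * f B3) ^+ 2).
    by rewrite e1 e2 e3; field; rewrite f1 f2 f3.
  by rewrite E e1 e2 e3; field; rewrite f1 f2 f3.
have M (P Q : {poly k}) := size_polyMleq P Q.
have sU : (size U <= (size A1 + size A2).-2)%N.
  apply: leq_trans (size_polyD _ _) _; rewrite geq_max.
  by move: (M A1 B2) (M A2 B1) p1 p2; size_lia.
have sB : (size (B1 * B2)%R <= (size B1 + size B2).-1)%N by exact: M.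
have sBB : (size (B1 * B2 * B3)%R <= (size A1 + size A2 + size B3).-1.-2)%N.
  by apply: leq_trans (M _ _) _; move: sB p1 p2 s3; size_lia.
have sW : (size W <= (size A1 + size A2 + size B3).-1.-2)%N.
  apply: leq_trans (size_polyD _ _) _; rewrite size_polyN geq_max size_scale_poly //.
  by rewrite andbT; apply: leq_trans (M _ _) _; move: sU p1 p2 p3 s3; size_lia.
have sAA : size (A1 * A2) = (size A1 + size A2).-1 by rewrite size_mul.
have sAB : size (A1 * A2 * B3) = (size A1 + size A2 + size B3).-2.
  by rewrite size_mul ?mulf_neq0 // sAA; move: p1 p2 p3; size_lia.
have sX : (size X <= (size A1 + size A2 + size B3).-2)%N.
  apply: leq_trans (size_polyD _ _) _; rewrite geq_max; apply/andP; split.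
    by apply: leq_trans (M _ _) _; rewrite sAA; move: p1 p2 p3 s3; size_lia.
  by apply: size_scale_poly; apply: leq_trans sBB _; move: p1 p2 s3; size_lia.
have sY : (size Y <= (size A1 + size A2 + size B3).-1.-2)%N.
  apply: leq_trans (size_polyD _ _) _; rewrite geq_max; apply/andP; split.
    by apply: leq_trans (M _ _) _; move: sU p1 p2 p3 s3; size_lia.
  by apply: leq_trans (M _ _) _; move: sB p1 p2 p3 s3; size_lia.
have sL : size (A1 * A2 * B3 + W) = (size A1 + size A2 + size B3).-2.
  by rewrite size_polyDl sAB //; move: sW p1 p2 p3 s3; size_lia.
have : (size ((A1 * A2 * B3 + W) ^+ 2)%R <= (size X + size Y).-1)%N.
  by rewrite F; apply: size_scale_poly; exact: M.
rewrite size_exp_poly ?sL; last by rewrite -size_poly_gt0 sL; move: p1 p2 p3 s3; size_lia.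
by move: sX sY p1 p2 p3 s3; size_lia.
Qed.

(** Nonvanishing of the discriminant makes the numerator and the denominator of the
    duplication formula coprime, so that no degree is lost by cancellation. *)
Lemma height_double x y : pole x -> pole y ->
  y * (4%:R * (x ^+ 3 + fa * x + fb)) =
    x ^+ 4 - 2%:R * fa * x ^+ 2 - 8%:R * fb * x + fa ^+ 2 ->
  height y = (4 * height x)%N.
Proof.
move=> px py E; have px0 := px.
have sA := size_num_gt1 px; have cx := num_den_coprimep x.
have fB := fden_neq0 x; have ex := num_den x; have B0 := den_neq0 x.
move: px; rewrite /pole [height x]/height.
move: (num x) (den x) sA cx fB ex B0 => A B sA cx fB ex B0 px.
pose F : {poly k} := A ^+ 4 + ((- (2%:R * a))%:P * (A * B) ^+ 2 +
  ((- (8%:R * b))%:P * (A * B ^+ 3) + (a ^+ 2)%:P * B ^+ 4)).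
pose H : {poly k} := A ^+ 3 + (a%:P * (A * B ^+ 2) + b%:P * B ^+ 3).
pose G : {poly k} := 4%:R * (B * H).
have A0 : A != 0 by rewrite -size_poly_gt0 ltnW.
have sX := size_exp_poly; have sC := size_scale_poly.
have four0 : (4%:R : k) != 0 by rewrite (_ : 4 = 2 * 2)%N // natrM mulf_neq0.
have sAB n : (size (A * B ^+ n)%R <= (size A + (size B).-1 * n))%N.
  exact: size_mul_exp.
have sF : size F = (4 * (size A).-1).+1.
  rewrite /F size_polyDl sX //; first by rewrite mulnC.
  apply: leq_ltn_trans (size_polyD _ _) _; rewrite gtn_max; apply/andP; split.
    rewrite ltnS; apply: sC; rewrite sX ?mulf_neq0 // size_mul //.
    by move: px sA; size_lia.
  rewrite ltnS; apply: leq_trans (size_polyD _ _) _; rewrite geq_max.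
  apply/andP; split; apply: sC; last by rewrite sX //; move: px sA; size_lia.
  by apply: leq_trans (sAB 3%N) _; move: px sA; size_lia.
have H0 : H != 0.
  have := pole_cubic_neq0 px0; rewrite ex; apply: contraNneq => h0.
  apply/eqP; transitivity (f H / f B ^+ 3); last by rewrite h0 rmorph0 mul0r.
  by rewrite /H !(rmorphM, rmorphD, rmorphXn) /= -/fa -/fb; field.
have G0 : G != 0.
  by rewrite !mulf_neq0 // -polyC_natr polyC_eq0.
have cFB n : coprimep F (B ^+ n).
  apply: coprimep_expr; rewrite coprimep_sym /F addrC.
  have -> : forall P Q R S : {poly k}, P * (A * B) ^+ 2 + (Q * (A * B ^+ 3) + R * B ^+ 4) + S
     = (P * A ^+ 2 * B + Q * A * B ^+ 2 + R * B ^+ 3) * B + S by move=> *; ring.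
  by rewrite coprimep_addl_mul; apply: coprimep_expr; rewrite coprimep_sym.
have cFG : coprimep F G.
  apply/coprimepP => e eF eG; apply: (coprimepP _ _ (cFB 7%N)) => //.
  rewrite -(dvdpZr _ _ (_ : 4%:R * (4%:R * a ^+ 3 + 27%:R * b ^+ 2) != 0)) ?mulf_neq0 //.
  have -> : (4%:R * (4%:R * a ^+ 3 + 27%:R * b ^+ 2)) *: B ^+ 7 =
     (12%:R * A ^+ 2 * B + 16%:R * a%:P * B ^+ 3) * F
      - (3%:R * A ^+ 3 - 5%:R * a%:P * A * B ^+ 2 - 27%:R * b%:P * B ^+ 3) * G.
    rewrite -mul_polyC /F /G /H !(polyCN, polyCM, polyCD, polyC_exp, polyC_natr).
    ring.
  by rewrite dvdp_sub // dvdp_mull.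
rewrite (@heightE y F G) ?sF //.
have fG0 : f G != 0 by rewrite f_eq0.
apply: (mulIf fG0); rewrite divfK //.
move: E; rewrite ex => E; rewrite /G /F /H.
rewrite !(polyCN, polyCM, polyC_exp, polyC_natr).
rewrite !(rmorphN, rmorphM, rmorphB, rmorphD, rmorphXn, rmorph_nat) /= -/fa -/fb.
transitivity (y * (4%:R * ((f A / f B) ^+ 3 + fa * (f A / f B) + fb)) * f B ^+ 4); first by field.
by rewrite E; field.
Qed.

End FunctionField.

(** * Quadratic functions on a lattice *)

Section QuadraticFunction.
Variables (G : zmodType) (S : zmodClosed G) (q : G -> int).
Hypothesis parallelogram : {in S &, forall x y,
  q (x + y) + q (x - y) = 2 * (q x + q y)}.

Let q0 : q 0 = 0.
Proof. by have := parallelogram (rpred0 S) (rpred0 S); rewrite addr0 subr0; lia. Qed.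

Let qN x : x \in S -> q (- x) = q x.
Proof.
move=> Sx; have := parallelogram (rpred0 S) Sx.
by rewrite !add0r q0; lia.
Qed.

Let q_line_nat x y : x \in S -> y \in S -> forall n : nat,
  q (x + y *+ n) = q x + n%:Z * (q (x + y) - q x - q y) + n%:Z ^+ 2 * q y.
Proof.
move=> Sx Sy n.
suff [] : q (x + y *+ n) = q x + n%:Z * (q (x + y) - q x - q y) + n%:Z ^+ 2 * q y
   /\ q (x + y *+ n.+1) = q x + n.+1%:Z * (q (x + y) - q x - q y) + n.+1%:Z ^+ 2 * q y by [].
elim: n => [|n [IH1 IH2]].
  by rewrite mulr0n addr0 mulr1n expr0n /= expr1n; split; ring.
split=> //; have := @parallelogram (x + y *+ n.+1) y.
rewrite rpredD ?rpredMn // => /(_ isT Sy).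
rewrite -!addrA -{1}(mulrSr y) [y *+ n.+1]mulrSr addrK.
rewrite -(mulrSr y n) IH1 IH2 => e.
rewrite -[LHS](addrK (q x + n%:Z * (q (x + y) - q x - q y) + n%:Z ^+ 2 * q y)) e.
by rewrite -[n.+2]addn2 -[n.+1]addn1 !PoszD; ring.
Qed.

Let q_line x y (n : int) : x \in S -> y \in S ->
  q (x + y *~ n) = q x + n * (q (x + y) - q x - q y) + n ^+ 2 * q y.
Proof.
move=> Sx Sy; case: n => n; first exact: q_line_nat.
rewrite NegzE mulrNz -pmulrn -mulNrn q_line_nat ?rpredN // qN //.
have -> : q (x - y) = 2 * (q x + q y) - q (x + y).
  by rewrite -(parallelogram Sx Sy); ring.
ring.
Qed.

(** By induction the parallelogram law makes [q] quadratic along every line, and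
    two directions suffice. *)
Lemma quadratic_lattice x y (m n : int) : x \in S -> y \in S ->
  q (x *~ m + y *~ n) =
    m ^+ 2 * q x + n ^+ 2 * q y + m * n * (q (x + y) - q x - q y).
Proof.
move=> Sx Sy; have Sxm : x *~ m \in S by rewrite rpredMz.
rewrite q_line //.
have -> : q (x *~ m) = m ^+ 2 * q x.
  by rewrite -[x *~ m]add0r q_line ?rpred0 // add0r q0; ring.
have -> : q (x *~ m + y) = q y + m * (q (x + y) - q x - q y) + m ^+ 2 * q x.
  by rewrite addrC q_line // [y + x]addrC; ring.
ring.
Qed.

End QuadraticFunction.

(** * The derivation of the field of fractions *)

Section Derivation.
Variables (k L : fieldType) (f : {rmorphism {poly k} -> L}).
Hypothesis f_inj : injective f.
Hypothesis f_frac : forall x : L,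
  exists AB : {poly k} * {poly k}, (AB.2 != 0) && (x == f AB.1 / f AB.2).

Local Notation num := (num f_inj f_frac).
Local Notation den := (den f_inj f_frac).
Local Notation num_den := (num_den f_inj f_frac).
Local Notation fden_neq0 := (fden_neq0 f_inj f_frac).
Local Notation den_neq0 := (den_neq0 f_inj f_frac).

Definition frac_deriv x : L :=
  f ((num x)^`() * den x - num x * (den x)^`()) / f (den x) ^+ 2.

Lemma frac_deriv_div A B : B != 0 -> frac_deriv (f A / f B) = f (A^`() * B - A * B^`()) / f B ^+ 2.
Proof.
move=> B0; have fB : f B != 0 by rewrite f_eq0.
set x := f A / f B.
have E : num x * B = A * den x.
  apply: f_inj; rewrite !rmorphM.
  have /eqP := num_den x; rewrite {1}/x eqr_div ?fden_neq0 // => /eqP ->.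
  by [].
have E' := congr1 deriv E; rewrite !derivM in E'.
apply/eqP; rewrite /frac_deriv eqr_div ?expf_neq0 ?fden_neq0 // -!(rmorphXn f) -!(rmorphM f).
apply/eqP; congr (f _); move: (num x) (den x) E E' => n d E E'.
transitivity (d * B * (n^`() * B + n * B^`()) - d^`() * B * (n * B) - d * B^`() * (n * B)).
  by ring.
by rewrite E E'; ring.
Qed.

Lemma frac_deriv_poly p : frac_deriv (f p) = f p^`().
Proof.
have := @frac_deriv_div p 1 (oner_neq0 _); rewrite rmorph1 divr1 => ->.
by rewrite derivC mulr0 subr0 mulr1 expr1n divr1.
Qed.

Lemma frac_derivD x y : frac_deriv (x + y) = frac_deriv x + frac_deriv y.
Proof.
move: (num_den x) (num_den y) (fden_neq0 x) (fden_neq0 y) (den_neq0 x) (den_neq0 y).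
move: (num x) (den x) (num y) (den y) => A1 B1 A2 B2 -> -> f1 f2 B10 B20.
rewrite [frac_deriv (f A1 / _)]frac_deriv_div // [frac_deriv (f A2 / _)]frac_deriv_div //.
have -> : f A1 / f B1 + f A2 / f B2 = f (A1 * B2 + A2 * B1) / f (B1 * B2).
  by rewrite addf_div // rmorphD !rmorphM.
rewrite frac_deriv_div ?mulf_neq0 // !derivE.
by rewrite !(rmorphD, rmorphB, rmorphM, rmorphN) /=; field; rewrite f1 f2.
Qed.

Lemma frac_derivM x y : frac_deriv (x * y) = frac_deriv x * y + x * frac_deriv y.
Proof.
move: (num_den x) (num_den y) (fden_neq0 x) (fden_neq0 y) (den_neq0 x) (den_neq0 y).
move: (num x) (den x) (num y) (den y) => A1 B1 A2 B2 -> -> f1 f2 B10 B20.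
rewrite [frac_deriv (f A1 / _)]frac_deriv_div // [frac_deriv (f A2 / _)]frac_deriv_div //.
have -> : f A1 / f B1 * (f A2 / f B2) = f (A1 * A2) / f (B1 * B2).
  by rewrite mulf_div !rmorphM.
rewrite frac_deriv_div ?mulf_neq0 // !derivE.
by rewrite !(rmorphD, rmorphB, rmorphM, rmorphN) /=; field; rewrite f1 f2.
Qed.

End Derivation.

(** * Additivity of the invariant differential *)

Section Differential.
Variables (L : fieldType) (a b d : L) (D : L -> L).
Hypotheses (DD : forall x y, D (x + y) = D x + D y)
  (DM : forall x y, D (x * y) = D x * y + x * D y).
Hypotheses (Da : D a = 0) (Db : D b = 0).
Hypotheses (two_neq0 : (2%:R : L) != 0) (d_neq0 : d != 0).

Let D0 : D 0 = 0. Proof. by apply: (addrI (D 0)); rewrite -DD !addr0. Qed.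
Let DN x : D (- x) = - D x.
Proof. by apply: (addrI (D x)); rewrite -DD !subrr D0. Qed.
Let DB x y : D (x - y) = D x - D y. Proof. by rewrite DD DN. Qed.
Let DX2 x : D (x ^+ 2) = 2%:R * x * D x. Proof. by rewrite expr2 DM; ring. Qed.
Let D1 : D 1 = 0.
Proof.
by have := DM 1 1; rewrite !mulr1 mul1r => e; apply: (addrI (D 1)); rewrite -e addr0.
Qed.
Let Dn n : D n%:R = 0.
Proof. by elim: n => [|n IH]; rewrite ?D0 // mulrS DD D1 IH addr0. Qed.

Let DX3 x : D (x ^+ 3) = 3%:R * x ^+ 2 * D x.
Proof. by rewrite exprS DM DX2; ring. Qed.

Lemma D_curve x y mu : d * y ^+ 2 = cubic a b x -> y != 0 -> D x = mu * y ->
  D y = ((3%:R * x ^+ 2 + a) * mu - D d * y) / (2%:R * d).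
Proof.
move=> h y0 hx; have := congr1 D h.
rewrite /cubic !(DD, DM, Da, Db, DX2, DX3) hx => e.
have y2 : 2%:R * d * y != 0 by rewrite !mulf_neq0.
apply: (mulIf y2).
transitivity (D d * y ^+ 2 + d * (2%:R * y * D y) - D d * y ^+ 2); first by ring.
by rewrite e; field; rewrite two_neq0 d_neq0.
Qed.

(** [D X / Y] is the value of a derivation on the invariant differential of the
    curve; translation invariance is what makes it additive. *)
Lemma D_third x1 y1 x2 y2 mu1 mu2 :
  d * y1 ^+ 2 = cubic a b x1 -> d * y2 ^+ 2 = cubic a b x2 ->
  y1 != 0 -> y2 != 0 -> ~~ ((x1 == x2) && (y1 == - y2)) ->
  D x1 = mu1 * y1 -> D x2 = mu2 * y2 ->
  let P := third d (slope a d x1 y1 x2 y2) x1 y1 x2 in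
  D P.1 = (mu1 + mu2) * P.2.
Proof.
move=> h1 h2 y10 y20 n e1 e2.
have f1 := D_curve h1 y10 e1; have f2 := D_curve h2 y20 e2.
have [hc _] := chord_slope two_neq0 d_neq0 h1 h2 n.
have d2 : 2%:R * d != 0 by rewrite mulf_neq0.
rewrite /third /=; move: n hc; rewrite /slope; have [ex|nx] /= := eqVneq x1 x2.
  subst x2; rewrite subrr mulr0 addr0 => n ey; subst y2.
  have -> : mu2 = mu1 by apply: (mulIf y10); rewrite -e1 -e2.
  set l := _ / _; have hl : l * (2%:R * d * y1) = 3%:R * x1 ^+ 2 + a.
    by rewrite /l divfK // mulf_neq0.
  clearbody l.
  have Dl : D l = (6%:R * x1 * mu1 - l * D d - 2%:R * d * l ^+ 2 * mu1) / (2%:R * d).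
    have y2 : 2%:R * d * y1 != 0 by rewrite mulf_neq0.
    apply: (mulIf y2); have := congr1 D hl.
    rewrite !(DM, DD, DX2, Dn, Da) e1 f1 -hl => e.
    rewrite -[LHS](addrK (l * (((0 * d + 2%:R * D d) * y1) +
      2%:R * d * ((l * (2%:R * d * y1) * mu1 - D d * y1) / (2%:R * d))))) e.
    by field; rewrite two_neq0 d_neq0.
  by rewrite !(DB, DM, DD, DX2) Dl e1; field; rewrite two_neq0 d_neq0.
move=> _ _; set l := _ / _.
have nx' : x1 - x2 != 0 by rewrite subr_eq0.
have hl : l * (x1 - x2) = y1 - y2 by rewrite /l divfK.
have el : l = (y1 - y2) / (x1 - x2) by [].
clearbody l.
have Dl : D l = (D y1 - D y2 - l * (mu1 * y1 - mu2 * y2)) / (x1 - x2).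
  apply: (mulIf nx'); rewrite divfK // -e1 -e2 -!DB -hl DM; ring.
rewrite !(DB, DM, DD, DX2) Dl f1 f2 e1 e2.
have -> : a = ((d * y1 ^+ 2 - x1 ^+ 3) - (d * y2 ^+ 2 - x2 ^+ 3)) / (x1 - x2).
  by rewrite h1 h2 /cubic; field.
by rewrite el; field; rewrite two_neq0 d_neq0 nx'.
Qed.

End Differential.

(** * Points over a function field: degree and multiplier *)

Section FunctionFieldPoints.
Variables (k L : fieldType) (f : {rmorphism {poly k} -> L}).
Hypothesis f_inj : injective f.
Hypothesis f_frac : forall x : L,
  exists AB : {poly k} * {poly k}, (AB.2 != 0) && (x == f AB.1 / f AB.2).
Variables (a b : k) (d : {poly k}).
Hypothesis two_neq0 : (2%:R : k) != 0.
Hypothesis d_neq0 : d != 0.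
Hypothesis disc_neq0 : 4%:R * a ^+ 3 + 27%:R * b ^+ 2 != 0.

Let L_two_neq0 : (2%:R : L) != 0.
Proof. by rewrite -(rmorph_nat f) f_eq0 // -polyC_natr polyC_eq0. Qed.
Let fd_neq0 : f d != 0. Proof. by rewrite f_eq0. Qed.
Let L_disc_neq0 : 4%:R * f a%:P ^+ 3 + 27%:R * f b%:P ^+ 2 != 0.
Proof.
have -> : 4%:R * f a%:P ^+ 3 + 27%:R * f b%:P ^+ 2 =
   f (4%:R * a ^+ 3 + 27%:R * b ^+ 2)%:P.
  rewrite polyCD ![(_ * _ ^+ _)%:P]polyCM !polyC_exp !polyC_natr.
  by rewrite rmorphD ![f (_ * _ ^+ _)]rmorphM !rmorphXn !rmorph_nat.
by rewrite f_eq0 // polyC_eq0.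
Qed.

Definition fun_curve : twist L := Twist L_two_neq0 fd_neq0 L_disc_neq0.
Local Notation C := fun_curve.
Local Notation pole := (pole f_inj f_frac).
Local Notation height := (height f_inj f_frac).
Local Notation D := (frac_deriv f_inj f_frac).

(** Points that specialize to the origin of the curve at [x = oo]. *)
Definition at_infinity (P : point C) :=
  if coords P is Some (x, _) then pole x else true.

Lemma affine_curve (P : point C) x y : coords P = Some (x, y) ->
  f d * y ^+ 2 = cubic (f a%:P) (f b%:P) x.
Proof. by case: P => [[[x' y']|]] //= /eqP h [<- <-]. Qed.

Lemma at_infinityN P : at_infinity (- P) = at_infinity P.
Proof. by rewrite /at_infinity coordsN; case: (coords P) => [[]|]. Qed.

Lemma at_infinityD P R : at_infinity P -> at_infinity R -> at_infinity (P + R).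
Proof.
have hP := @affine_curve P; have hR := @affine_curve R.
rewrite /at_infinity coordsD; case eP: (coords P) hP => [[x1 y1]|] // hP.
case eR: (coords R) hR => [[x2 y2]|] // hR p1 p2.
case e: (pt_add _ _ _ _) => [[x3 y3]|] //.
apply: (pole_collinear (a := a) (b := b) p1 p2).
exact: (add_collinear L_two_neq0 fd_neq0 (hP _ _ erefl) (hR _ _ erefl) e).
Qed.

Fact at_infinity_closed : zmod_closed at_infinity.
Proof.
split=> // P R hP hR; apply: at_infinityD => //.
by rewrite -[X in is_true X]/(at_infinity (- R)) at_infinityN.
Qed.

HB.instance Definition _ :=
  GRing.isZmodClosed.Build (point C) at_infinity at_infinity_closed.

Definition degree (P : point C) : nat :=
  if coords P is Some (x, _) then height x else 0%N.

Lemma degreeN P : degree (- P) = degree P.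
Proof. by rewrite /degree coordsN; case: (coords P) => [[]|]. Qed.

Lemma affine_ord_neq0 (P : point C) x y :
  at_infinity P -> coords P = Some (x, y) -> y != 0.
Proof.
move=> hP e; have h := affine_curve e; move: hP; rewrite /at_infinity e => px.
apply: contraNneq (pole_cubic_neq0 a b px) => y0.
by move/esym: h; rewrite /cubic y0 expr0n /= mulr0 => ->.
Qed.

Lemma degree_double P : at_infinity P -> degree (P + P) = (4 * degree P)%N.
Proof.
move=> hP; have hPP := at_infinityD hP hP.
have y0 := affine_ord_neq0 hP; have hc := @affine_curve P.
move: hPP hP; rewrite /at_infinity /degree coordsD.
case eP: (coords P) y0 hc => [[x y]|] // y0 hc.
have {}y0 := y0 _ _ erefl; have {}hc := hc _ _ erefl.
case e: (pt_add _ _ _ _) => [[x3 y3]|]; last first.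
  move: e; rewrite /pt_add eqxx /=; case: ifP => // /eqP ey _.
  case/eqP: y0; apply/eqP; rewrite -(mulrI_eq0 _ (mulfI L_two_neq0)).
  by rewrite mulr_natl mulr2n {1}ey addNr.
move=> p3 p1; apply: (height_double (a := a) (b := b)) => //.
exact: (double_coord L_two_neq0 fd_neq0 hc y0 e).
Qed.

Lemma degree_add_sub_le (P R : point C) x1 y1 x2 y2 :
  at_infinity P -> at_infinity R ->
  coords P = Some (x1, y1) -> coords R = Some (x2, y2) -> x1 != x2 ->
  exists x3 y3 x4 y4,
    [/\ coords (P + R) = Some (x3, y3), coords (P - R) = Some (x4, y4),
        x3 != x4 &
        (degree (P + R)%R + degree (P - R)%R <= 2 * (degree P + degree R))%N].
Proof.
move=> hP hR eP eR nx.
have [cP cR] := (affine_curve eP, affine_curve eR).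
have yP := affine_ord_neq0 hP eP; have yR := affine_ord_neq0 hR eR.
have hS := at_infinityD hP hR.
have hT : at_infinity (P - R) by apply: at_infinityD; rewrite ?at_infinityN.
have eS : coords (P + R) = pt_add (f a%:P) (f d) (Some (x1, y1)) (Some (x2, y2)).
  by rewrite coordsD eP eR.
have eT : coords (P - R) = pt_add (f a%:P) (f d) (Some (x1, y1)) (Some (x2, - y2)).
  by rewrite coordsD coordsN eP eR.
case e3: (pt_add _ _ _ _) eS => [[x3 y3]|] eS; last first.
  by move: e3; rewrite /pt_add (negPf nx).
case e4: (pt_add _ _ _ _) eT => [[x4 y4]|] eT; last first.
  by move: e4; rewrite /pt_add (negPf nx).
have [r1 r2 r3] := add_sub_coord cP cR nx e3 e4.
exists x3, y3, x4, y4; split=> //.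
  apply: contraTneq isT => e; move: r3; rewrite e subrr mul0r => /esym/eqP.
  have four : 4%:R = 2%:R * 2%:R :> L by rewrite -natrM.
  by rewrite four !mulf_eq0 (negPf L_two_neq0) (negPf fd_neq0) (negPf yP) (negPf yR).
move: hP hR hS hT; rewrite /at_infinity /degree eP eR eS eT => p1 p2 p3 p4.
exact: (height_sum_le p1 p2 p3 p4 nx r1 r2).
Qed.

Lemma same_abscissa (P R : point C) x y1 y2 :
  coords P = Some (x, y1) -> coords R = Some (x, y2) -> (P == R) || (P == - R).
Proof.
move=> eP eR; have := affine_curve eP; rewrite -(affine_curve eR) => /(mulfI fd_neq0).
move/eqP; rewrite eqf_sqr => /orP[]/eqP ey; apply/orP; [left|right];
  by apply/eqP/val_inj; rewrite /= ?eP ?eR ey.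
Qed.

(** One inequality is [degree_add_sub_le]. Applied to [P + R] and [P - R], whose
    sum and difference are [P + P] and [R + R], it also gives the converse,
    because doubling multiplies the degree by exactly 4. *)
Lemma degree_parallelogram : {in at_infinity &, forall P R,
  (degree (P + R)%R + degree (P - R)%R = 2 * (degree P + degree R))%N}.
Proof.
move=> P R hP hR; rewrite -!topredE /= in hP hR.
have degree0 : degree 0 = 0%N by [].
case eR: (coords R) => [[x2 y2]|]; last first.
  have -> : R = 0 by apply/eqP; rewrite coords_eq0 eR.
  by rewrite addr0 subr0 degree0; lia.
case eP: (coords P) => [[x1 y1]|]; last first.
  have -> : P = 0 by apply/eqP; rewrite coords_eq0 eP.
  by rewrite add0r sub0r degreeN degree0; lia.
have [ex|nx] := eqVneq x1 x2.
  subst x2; case/orP: (same_abscissa eP eR) => /eqP e.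
    by rewrite e subrr degree0 degree_double //; lia.
  by rewrite e addNr degree0 -opprD !degreeN degree_double //; lia.
have [x3 [y3 [x4 [y4 [e3 e4 nx' le1]]]]] := degree_add_sub_le hP hR eP eR nx.
have hS := at_infinityD hP hR.
have hT : at_infinity (P - R) by apply: at_infinityD; rewrite ?at_infinityN.
have [_ [_ [_ [_ [_ _ _ le2]]]]] := degree_add_sub_le hS hT e3 e4 nx'.
have e2P : P + R + (P - R) = P + P by rewrite addrACA subrr addr0.
have e2R : P + R - (P - R) = R + R by rewrite opprB addrC addrA subrK.
by move: le2; rewrite e2P e2R !degree_double //; lia.
Qed.

(** [dX / Y = mu dx]: a point of the twist is a map of the curve to itself, and
    [mu] is the scalar by which it acts on the invariant differential. *)
Definition has_multiplier (P : point C) (mu : k) : Prop :=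
  if coords P is Some (x, y) then D x = f mu%:P * y else mu = 0.

Lemma has_multiplierN P mu : has_multiplier P mu -> has_multiplier (- P) (- mu).
Proof.
rewrite /has_multiplier coordsN; case: (coords P) => [[x y]|] /= => [->|->].
  by rewrite polyCN rmorphN mulrNN.
by rewrite oppr0.
Qed.

Let D_const c : D (f c%:P) = 0.
Proof. by rewrite frac_deriv_poly derivC rmorph0. Qed.

Lemma has_multiplierD P R mu nu : at_infinity P -> at_infinity R ->
  has_multiplier P mu -> has_multiplier R nu -> has_multiplier (P + R) (mu + nu).
Proof.
move=> hP hR; have yP := affine_ord_neq0 hP; have yR := affine_ord_neq0 hR.
have cP := @affine_curve P; have cR := @affine_curve R.
rewrite /has_multiplier coordsD.
case eP: (coords P) yP cP => [[x1 y1]|] yP cP; last by move=> ->; rewrite add0r.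
case eR: (coords R) yR cR => [[x2 y2]|] yR cR; last by move=> e ->; rewrite addr0.
have {}yP := yP _ _ erefl; have {}yR := yR _ _ erefl.
have {}cP := cP _ _ erefl; have {}cR := cR _ _ erefl.
move=> m1 m2; rewrite /pt_add; case: ifPn => [/andP[/eqP ex /eqP ey]|n].
  apply/eqP; rewrite -polyC_eq0 -(f_eq0 f_inj) polyCD rmorphD.
  apply/eqP/(mulIf yR); rewrite mul0r mulrDl -m2 -ex m1 ey; ring.
rewrite [third _ _ _ _ _]surjective_pairing polyCD rmorphD.
exact: (D_third (frac_derivD f_inj f_frac) (frac_derivM f_inj f_frac) (D_const a) (D_const b) L_two_neq0 fd_neq0 cP cR yP yR n m1 m2).
Qed.

End FunctionFieldPoints.

(** * Multiplication by a root of t^2 - t + 3 *)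

Section Isogeny.
Variable (R : comNzRingType).
Implicit Types t x : R.
(** Velu's formulas for the subgroup of order 3 whose points have abscissa
    [12 - 2 t], rescaled so that the quotient is the same curve. Multiplication
    by [t] sends [(x, y)] to
    [(iso_num t x / (t iso_ker t x)^2, y iso_dnum t x / (t iso_ker t x)^3)]. *)
Definition iso_ker t x := x - (12%:R - 2%:R * t).
Definition iso_num t x :=
  x * iso_ker t x ^+ 2 + (264%:R - 264%:R * t) * iso_ker t x
  - (616%:R + 704%:R * t).
Definition iso_dnum t x :=
  iso_ker t x ^+ 3 - (264%:R - 264%:R * t) * iso_ker t x
  + 2%:R * (616%:R + 704%:R * t).

Lemma isogeny t x : t ^+ 2 = t - 3%:R ->
  iso_num t x ^+ 3 - 264%:R * iso_num t x * (t * iso_ker t x) ^+ 4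
    + 1694%:R * (t * iso_ker t x) ^+ 6 =
  (x ^+ 3 - 264%:R * x + 1694%:R) * iso_dnum t x ^+ 2.
Proof.
move=> ht; rewrite /iso_num /iso_dnum /iso_ker.
ring: ht.
Qed.
End Isogeny.

Section IsogenyMorphism.
Variables (R S : comNzRingType) (g : {rmorphism R -> S}) (t x : R).
Let gk : g (iso_ker t x) = iso_ker (g t) (g x).
Proof.
by rewrite /iso_ker (rmorphB g x) (rmorphB g 12%:R) (rmorphM g 2%:R) !rmorph_nat.
Qed.
Let gv : g (264%:R - 264%:R * t) = 264%:R - 264%:R * g t.
Proof. by rewrite (rmorphB g 264%:R) (rmorphM g 264%:R) !rmorph_nat. Qed.
Let gw : g (616%:R + 704%:R * t) = 616%:R + 704%:R * g t.
Proof. by rewrite (rmorphD g 616%:R) (rmorphM g 704%:R) !rmorph_nat. Qed.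

Lemma rmorph_iso_ker : g (t * iso_ker t x) = g t * iso_ker (g t) (g x).
Proof. by rewrite (rmorphM g t) gk. Qed.
Lemma rmorph_iso_num : g (iso_num t x) = iso_num (g t) (g x).
Proof.
rewrite /iso_num (rmorphB g _ (616%:R + _)) gw (rmorphD g (x * _)) (rmorphM g x).
by rewrite (rmorphM g (264%:R - _)) gv (rmorphXn g) gk.
Qed.
Lemma rmorph_iso_dnum : g (iso_dnum t x) = iso_dnum (g t) (g x).
Proof.
rewrite /iso_dnum (rmorphD g _ (2%:R * _)) (rmorphM g 2%:R) gw.
rewrite (rmorphB g (iso_ker t x ^+ 3)) (rmorphM g (264%:R - _)) gv (rmorphXn g) gk.
by rewrite rmorph_nat.
Qed.
End IsogenyMorphism.

Section IsogenyMinusOne.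
Variable (L : fieldType) (t x : L).
Hypothesis ht : t ^+ 2 = t - 3%:R.
(** Multiplication by [t] minus the identity is multiplication by [-(1 - t)], and
    [1 - t] is the other root of [t^2 - t + 3]: the abscissa of the difference is
    given by the same formulas for that root. *)
Lemma isogeny_sub1 :
  iso_ker t x != 0 -> iso_ker (1 - t) x != 0 -> t != 0 -> 1 - t != 0 ->
  let xt := iso_num t x / (t * iso_ker t x) ^+ 2 in
  let yt := iso_dnum t x / (t * iso_ker t x) ^+ 3 in
  xt - x != 0 ->
  (x ^+ 3 - 264%:R * x + 1694%:R) * ((yt + 1) / (xt - x)) ^+ 2 - xt - x =
   iso_num (1 - t) x / ((1 - t) * iso_ker (1 - t) x) ^+ 2.
Proof.
move=> k1 k2 t0 t1 xt yt.
have -> : xt - x = (iso_num t x - x * (t * iso_ker t x) ^+ 2) / (t * iso_ker t x) ^+ 2.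
  by rewrite /xt; field; rewrite k1 t0.
have -> : yt + 1 = (iso_dnum t x + (t * iso_ker t x) ^+ 3) / (t * iso_ker t x) ^+ 3.
  by rewrite /yt; field; rewrite k1 t0.
rewrite /xt {xt yt}.
set N := iso_num t x - _; set M := iso_dnum t x + _ => nz.
have N0 : N != 0 by apply: contraNneq nz => ->; rewrite mul0r.
pose T := t * iso_ker t x; pose S := (1 - t) * iso_ker (1 - t) x.
have T0 : T != 0 by rewrite mulf_neq0.
have S0 : S != 0 by rewrite mulf_neq0.
suff E : (x ^+ 3 - 264%:R * x + 1694%:R) * M ^+ 2 * S ^+ 2
   - (iso_num t x + x * T ^+ 2) * N ^+ 2 * S ^+ 2 - iso_num (1 - t) x * N ^+ 2 * T ^+ 2 = 0.
  apply/eqP; rewrite -subr_eq0 -(mulIr_eq0 _ (mulIf (_ : N ^+ 2 * T ^+ 2 * S ^+ 2 != 0))) ?mulf_neq0 ?expf_neq0 //.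
  rewrite -E; apply/eqP; rewrite -/T -/S; field; by rewrite T0 S0 N0.
rewrite /N /M /T /S /iso_num /iso_dnum /iso_ker.
ring: ht.
Qed.
End IsogenyMinusOne.

(** * Fractions of polynomials and squarefree cubics *)

Lemma tofrac_inj (R : idomainType) : injective (@FracField.tofrac R).
Proof. by move=> x y /eqP; rewrite tofrac_eq => /eqP. Qed.

Lemma tofrac_frac (k : fieldType) (x : {fraction {poly k}}) :
  exists AB : {poly k} * {poly k},
    (AB.2 != 0) && (x == FracField.tofrac AB.1 / FracField.tofrac AB.2).
Proof.
exists (\n_(repr x), \d_(repr x)); rewrite /= denom_ratioP /=.
have d0 : FracField.tofrac \d_(repr x) != 0 by rewrite tofrac_eq0 denom_ratioP.
apply/eqP/(mulIf d0); rewrite divfK //.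
rewrite -{1}[x]reprK -[repr x]Ratio_numden.
move: (denom_ratioP (repr x)); move: (\n_(repr x)) (\d_(repr x)) => n e e0.
rewrite /FracField.tofrac; unlock.
rewrite !piE /FracField.mulf.
apply/eqmodP => /=; rewrite FracField.equivfE !numden_Ratio ?mulf_neq0 ?oner_eq0 //.
by rewrite !mulr1 mulrC.
Qed.

Lemma squarefree_cubic (k : fieldType) (a b : k) (w : {poly k})
    (lam : {poly k} := 'X^3 + a%:P * 'X + b%:P) :
  4%:R * a ^+ 3 + 27%:R * b ^+ 2 != 0 -> lam %| w ^+ 2 -> lam %| w.
Proof.
move=> disc dv.
have cop : coprimep lam lam^`().
  apply/Bezout_coprimepP.
  exists (- (3%:R * (6%:R * a%:P * 'X - 9%:R * b%:P)),
          4%:R * a%:P ^+ 2 + 'X * (6%:R * a%:P * 'X - 9%:R * b%:P)) => /=.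
  have -> : - (3%:R * (6%:R * a%:P * 'X - 9%:R * b%:P)) * lam +
     (4%:R * a%:P ^+ 2 + 'X * (6%:R * a%:P * 'X - 9%:R * b%:P)) * lam^`() =
     (4%:R * a ^+ 3 + 27%:R * b ^+ 2)%:P.
    rewrite polyCD ![(_ * _ ^+ _)%:P]polyCM !polyC_exp !polyC_natr /lam.
    rewrite !(derivD, derivXn, derivM, derivC, derivX) /=; ring.
  by rewrite polyC_eqp1.
have [w0|w0] := eqVneq w 0; first by rewrite w0 dvdp0.
have g0 : gcdp lam w != 0 by rewrite gcdp_eq0 negb_and w0 orbT.
set g := gcdp lam w in g0.
have [q eq] : exists q, lam = q * g by apply/dvdpP; apply: dvdp_gcdl.
have [v ev] : exists v, w = v * g by apply/dvdpP; apply: dvdp_gcdr.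
have cqv : coprimep q v.
  have -> : q = lam %/ g by rewrite eq mulpK.
  have -> : v = w %/ g by rewrite ev mulpK.
  by apply: coprimep_div_gcd; rewrite w0 orbT.
have qg : q %| g.
  move: dv; rewrite {1}eq ev (_ : (v * g) ^+ 2 = v * (v * g) * g); last by ring.
  by rewrite dvdp_mul2r // Gauss_dvdpr // Gauss_dvdpr.
have q1 : q %= 1.
  apply: (coprimepP _ _ cop); first by rewrite eq dvdp_mulr.
  case/dvdpP: qg => g' eg; rewrite eq eg !derivM.
  by apply: dvdp_add; [do 2!apply: dvdp_mull|apply: dvdp_mulr].
by rewrite eq ev dvdp_mul2r // (eqp_dvdl _ q1) dvd1p.
Qed.

(** * Points with multiplier zero *)

Lemma exprDp (R : comNzRingType) p (x y : R) : p \in [pchar R] ->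
  (x + y) ^+ p = x ^+ p + y ^+ p.
Proof. by move=> c; rewrite -!(pFrobenius_autE c) rmorphD. Qed.

Section Inseparable.
Variables (K : closedFieldType) (L : fieldType) (f : {rmorphism {poly K} -> L}).
Hypothesis f_inj : injective f.
Hypothesis f_frac : forall x : L,
  exists AB : {poly K} * {poly K}, (AB.2 != 0) && (x == f AB.1 / f AB.2).
Variables (p h : nat) (a b : K).
Hypothesis charK : p \in [pchar K].
Hypothesis p_odd : p = h.*2.+1.
Hypotheses (ap : a ^+ p = a) (bp : b ^+ p = b).
Hypotheses (a_neq0 : a != 0) (b_neq0 : b != 0).
Hypotheses (two_neq0 : (2%:R : K) != 0) (three_neq0 : (3%:R : K) != 0).
Hypothesis disc_neq0 : 4%:R * a ^+ 3 + 27%:R * b ^+ 2 != 0.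

Definition lam : {poly K} := 'X^3 + a%:P * 'X + b%:P.

Lemma size_lam : size lam = 4%N.
Proof.
rewrite /lam -addrA size_polyDl size_polyXn //.
apply: leq_ltn_trans (size_polyD _ _) _; rewrite gtn_max.
rewrite mul_polyC (leq_ltn_trans (size_scale_leq _ _)) ?size_polyX //.
by rewrite (leq_ltn_trans (size_polyC_leq1 _)).
Qed.

Lemma lam_neq0 : lam != 0.
Proof. by rewrite -size_poly_gt0 size_lam. Qed.

Lemma frac_sqr_poly W (q : {poly K}) : W ^+ 2 = f q ->
  exists2 w, W = f w & q = w ^+ 2.
Proof.
have f0 := fden_neq0 f_inj f_frac W; have B0 := den_neq0 f_inj f_frac W.
move: (num_den f_inj f_frac W) (num_den_coprimep f_inj f_frac W) f0 B0.
move: (num _ _ _) (den _ _ _) => A B eW c f0 B0 e.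
have {}e : A ^+ 2 = q * B ^+ 2.
  by apply: f_inj; rewrite (rmorphXn f) (rmorphM f) (rmorphXn f) -e eW; field.
have : B %| 1.
  rewrite -(Gauss_dvdpr 1 (_ : coprimep B (A ^+ 2))).
    by rewrite mulr1 e expr2 mulrA dvdp_mull.
  by apply: coprimep_expr; rewrite coprimep_sym.
rewrite dvdp1 => /size_poly1P[c0 c00 eB].
exists (c0^-1 *: A).
  rewrite eW eB -mul_polyC rmorphM mulrC; congr (_ * _).
  have fc : f c0%:P != 0 by rewrite f_eq0 // polyC_eq0.
  by apply: (mulIf fc); rewrite mulVf // -rmorphM -polyCM mulVf // rmorph1.
by rewrite exprZn e eB -polyC_exp mulrC mul_polyC scalerA -exprMn mulVf // expr1n scale1r.
Qed.

Lemma deriv_eq0_coef (A : {poly K}) j : A^`() = 0 -> ~~ (p %| j)%N -> A`_j = 0.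
Proof.
case: j => [|j] e; first by rewrite dvdn0.
have := coef_deriv A j; rewrite e coef0 -mulr_natr => /esym/eqP.
by rewrite mulf_eq0 -(dvdn_pcharf charK) => /orP[/eqP|->].
Qed.

(** As [p] is odd, the hypothesis makes [lam * g] a square, and [lam] is
    squarefree, so [g] is a multiple of [lam]; comparing coefficients leaves
    only [g = lam]. *)
Lemma square_frobenius_poly (u v : K) Y (g := (u%:P * 'X + v%:P) ^+ 3 +
    a%:P * (u%:P * 'X + v%:P) + b%:P) :
  u != 0 -> f lam * Y ^+ 2 = f (g ^+ p) -> u = 1 /\ v = 0.
Proof.
move=> u0 e.
have eg : g = (u ^+ 3)%:P * 'X^3 + ((3%:R * u ^+ 2 * v)%:P * 'X^2 +
    ((3%:R * u * v ^+ 2 + a * u)%:P * 'X + (v ^+ 3 + a * v + b)%:P)).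
  rewrite /g !(polyCD, polyCM, polyC_exp, polyC_natr); ring.
have g3 : g`_3 = u ^+ 3 by rewrite eg !coefE /=; ring.
have g2 : g`_2 = 3%:R * u ^+ 2 * v by rewrite eg !coefE /=; ring.
have g1 : g`_1 = 3%:R * u * v ^+ 2 + a * u by rewrite eg !coefE /=; ring.
have gg : g`_0 = v ^+ 3 + a * v + b by rewrite eg !coefE /=; ring.
have g0 : g != 0.
  by apply: contraTneq u0 => z; move: g3; rewrite z coef0 => /esym/eqP; rewrite expf_eq0 negbK.
have fg : f g != 0 by rewrite f_eq0.
have fl : f lam != 0 by rewrite f_eq0 // lam_neq0.
have : (f lam * Y / f g ^+ h) ^+ 2 = f (lam * g).
  rewrite expr_div_n (_ : (f lam * Y) ^+ 2 = f lam * (f lam * Y ^+ 2)); last by ring.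
  rewrite e (rmorphM f) (rmorphXn f) p_odd exprS -mul2n mulnC exprM.
  by field; rewrite expf_neq0.
case/frac_sqr_poly => w _ ew.
have lw : lam %| w by apply: (squarefree_cubic disc_neq0); rewrite -ew dvdp_mulr.
have [w' ew'] : exists w', w = w' * lam by apply/dvdpP.
have eg' : g = w' ^+ 2 * lam.
  by apply: (mulfI lam_neq0); rewrite ew ew'; ring.
have sg : (size g <= 4)%N.
  apply/leq_sizeP => j hj; rewrite eg !coefE.
  by case: j hj => [|[|[|[|j]]]] //= _; rewrite !mulr0 !addr0.
have w0 : w' != 0 by apply: contraNneq g0 => z; rewrite eg' z expr0n /= mul0r.
have /size_poly1P[c c0 ec] : size (w' ^+ 2) == 1%N.
  have w20 : w' ^+ 2 != 0 by rewrite expf_neq0.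
  move: sg; rewrite eg' size_mul ?lam_neq0 // size_lam.
  have : (0 < size (w' ^+ 2)%R)%N by rewrite size_poly_gt0.
  by case: (size _) => [|[|n]] //; rewrite !addnS.
have {}eg' j : g`_j = c * lam`_j by rewrite eg' ec coefCM.
have l3 : lam`_3 = 1 by rewrite /lam !coefE /=; ring.
have l2 : lam`_2 = 0 by rewrite /lam !coefE /=; ring.
have l1 : lam`_1 = a by rewrite /lam !coefE /=; ring.
have l0 : lam`_0 = b by rewrite /lam !coefE /=; ring.
have cu : c = u ^+ 3 by rewrite -g3 eg' l3 mulr1.
have v0 : v = 0.
  have := eg' 2%N; rewrite g2 l2 mulr0 => /eqP; rewrite !mulf_eq0.
  by rewrite (negPf three_neq0) !(negPf u0) => /eqP.
have := eg' 1%N; have := eg' 0%N.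
rewrite gg g1 l0 l1 v0 !expr0n /= !mulr0 !add0r => eb ea.
have c1 : c = 1 by apply: (mulIf b_neq0); rewrite -eb mul1r.
split=> //; apply: (mulfI a_neq0); by rewrite ea c1 mulr1 mul1r.
Qed.

Let charP : p \in [pchar {poly K}]. Proof. by rewrite pchar_poly. Qed.

Local Notation C := (fun_curve f_inj two_neq0 lam_neq0 disc_neq0).

(** Multiplier zero kills the derivative of the abscissa, which is therefore a
    fraction in [x^p]; having degree [p] and a pole at infinity, it is
    [(u x + v)^p], and [square_frobenius_poly] applies. *)
Lemma inseparable_point (P : point C) :
  at_infinity f_frac P -> degree f_frac P = p -> has_multiplier f_frac P 0 ->
  coords P = Some (f 'X^p, f lam ^+ h) \/ coords P = Some (f 'X^p, - f lam ^+ h).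
Proof.
have := @affine_curve _ _ _ f_inj _ _ _ two_neq0 lam_neq0 disc_neq0 P.
rewrite /at_infinity /degree /has_multiplier.
case: (coords P) => [[X Y]|] hc; last by rewrite p_odd.
have {}hc := hc _ _ erefl.
rewrite polyC0 rmorph0 mul0r => pX sX.
have : (0 < p)%N by rewrite p_odd.
have f0 := fden_neq0 f_inj f_frac X; have B0 := den_neq0 f_inj f_frac X.
have s1 := size_num_gt1 pX.
move: (num_den f_inj f_frac X) (num_den_coprimep f_inj f_frac X) f0 B0 s1 sX.
move: pX; rewrite /pole /height /frac_deriv.
move: (num _ _ X) (den _ _ X) => A B sB eX c f0 B0 s1 sA p0.
move/eqP; rewrite mulf_eq0 invr_eq0 expf_eq0 (negPf f0) /= orbF f_eq0 // subr_eq0.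
move/eqP => eAB.
have B'0 : B^`() = 0.
  apply/eqP/contraT => nz.
  have : B %| B^`() by rewrite -(Gauss_dvdpr _ (_ : coprimep B A)) ?[coprimep B A]coprimep_sym // -eAB dvdp_mull.
  by move/(dvdp_leq nz); rewrite leqNgt lt_size_deriv.
have A'0 : A^`() = 0.
  by move/eqP: eAB; rewrite B'0 mulr0 mulf_eq0 (negPf B0) orbF => /eqP.
have sA' : size A = p.+1 by rewrite -sA prednK // ltnW.
have cB : B = (B`_0)%:P.
  apply/polyP => j; rewrite coefC; case: j => [|j] //=.
  have [dj|dj] := boolP (p %| j.+1)%N; last exact: deriv_eq0_coef.
  apply: nth_default; apply: leq_trans (dvdn_leq (ltn0Sn j) dj).
  by rewrite -ltnS -sA'.
have b0 : B`_0 != 0 by rewrite -polyC_eq0 -cB.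
have cA : A = (A`_p)%:P * 'X^p + (A`_0)%:P.
  apply/polyP => j; rewrite coefD coefCM coefXn coefC.
  have [->|j0] := eqVneq j 0%N; first by rewrite eq_sym p_odd /= mulr0 add0r.
  have [->|jp] := eqVneq j p; first by rewrite mulr1 addr0.
  rewrite mulr0 addr0.
  have [dj|dj] := boolP (p %| j)%N; last exact: deriv_eq0_coef.
  apply: nth_default; rewrite sA' ltn_neqAle eq_sym jp dvdn_leq // lt0n //.
have ap0 : A`_p != 0.
  by rewrite -[p]/(p.+1.-1) -sA' -lead_coefE lead_coef_eq0 -size_poly_gt0 sA'.
have rootp (x : K) : exists y, y ^+ p = x.
  have : size ('X^p - x%:P) != 1%N by rewrite size_XnsubC // eqSS -lt0n.
  case/closed_rootP => y; rewrite /root !hornerE subr_eq0 => /eqP.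
  by exists y.
have [u eu] := rootp (A`_p / B`_0); have [v ev] := rootp (A`_0 / B`_0).
have {}eX : X = f ((u%:P * 'X + v%:P) ^+ p).
  rewrite (exprDp _ _ charP) exprMn -!polyC_exp eu ev eX.
  apply: (mulIf f0); rewrite divfK // -(rmorphM f); congr (f _).
  rewrite {1}cA {3}cB mulrDl [_ * 'X^p * _]mulrAC -!polyCM.
  by rewrite !divfK.
have u0 : u != 0.
  by apply: contraNneq ap0 => z; move/eqP: eu; rewrite z expr0n p_odd /= eq_sym mulf_eq0 invr_eq0 (negPf b0) orbF.
have hc' : f lam * Y ^+ 2 = f (((u%:P * 'X + v%:P) ^+ 3 +
    a%:P * (u%:P * 'X + v%:P) + b%:P) ^+ p).
  rewrite hc eX /cubic; move: (_ * 'X + _) => l.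
  rewrite !(exprDp _ _ charP) [(a%:P * l) ^+ p]exprMn -!polyC_exp ap bp.
  rewrite -exprM mulnC exprM !(rmorphD f) [f (a%:P * _)](rmorphM f).
  by rewrite [f ((l ^+ p) ^+ 3)](rmorphXn f).
have [u1 v0] := square_frobenius_poly u0 hc'.
move: hc' eX; rewrite u1 v0 polyC0 polyC1 mul1r addr0 -/lam => hc' eX.
have fl : f lam != 0 by rewrite f_eq0 // lam_neq0.
have : Y ^+ 2 = (f lam ^+ h) ^+ 2.
  by apply: (mulfI fl); rewrite hc' (rmorphXn f) p_odd exprS -mul2n mulnC exprM.
by move/eqP; rewrite eqf_sqr eX => /orP[]/eqP ->; [left|right].
Qed.
End Inseparable.

(** * The prime field *)

Section PrimeField.
Variables (K : fieldType) (p : nat).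
Hypothesis charK : p \in [pchar K].

Let p_prime : prime p := pcharf_prime charK.
Let p_gt0 : (0 < p)%N := prime_gt0 p_prime.

Lemma natf_eq0 n : (n%:R == 0 :> K) = (p %| n)%N.
Proof. by rewrite (dvdn_pcharf charK). Qed.

Lemma factf_neq0 n : (n < p)%N -> (n`!%:R : K) != 0.
Proof.
elim: n => [|n IH] hn; first by rewrite fact0 oner_eq0.
by rewrite factS natrM mulf_neq0 ?IH 1?ltnW // natf_eq0 gtnNdvd.
Qed.

Definition prime_field : seq K := [seq i%:R | i <- iota 0 p].

Lemma uniq_prime_field : uniq prime_field.
Proof.
rewrite map_inj_in_uniq ?iota_uniq // => i j.
rewrite !mem_iota !add0n /= => hi hj.
wlog le : i j hi hj / (i <= j)%N => [hw e|].
  by case/orP: (leq_total i j) => le; [exact: hw|apply/esym/hw].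
move=> /eqP; rewrite eq_sym -subr_eq0 -natrB // natf_eq0 => dj.
apply/eqP; rewrite eqn_leq le /= -subn_eq0; apply: contraTT dj.
by rewrite -lt0n => ?; rewrite gtnNdvd // ltn_subLR //; apply: ltn_addl.
Qed.

Lemma prime_field_frob c : c \in prime_field -> c ^+ p = c.
Proof. by case/mapP=> i _ ->; rewrite -(pFrobenius_autE charK) pFrobenius_aut_nat. Qed.

Lemma prod_prime_field : \prod_(c <- prime_field) ('X - c%:P) = 'X^p - 'X.
Proof.
have sX : size ('X^p - 'X : {poly K}) = p.+1.
  by rewrite size_polyDl ?size_polyXn // size_polyN size_polyX ltnS prime_gt1.
have m : 'X^p - 'X \is @monic K.
  rewrite monicE /lead_coef sX /= coefB coefXn coefX eqxx.
  by rewrite (gtn_eqF (prime_gt1 p_prime)) subr0.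
apply/eqP; rewrite -eqp_monic ?monic_prod_XsubC //.
rewrite -dvdp_size_eqp ?size_prod_XsubC ?sX ?size_map ?size_iota //.
apply: uniq_roots_dvdp; last by rewrite uniq_rootsE uniq_prime_field.
by apply/allP => c hc; rewrite /root !hornerE prime_field_frob // subrr.
Qed.

Lemma mem_prime_field c : (c \in prime_field) = (c ^+ p == c).
Proof.
apply/idP/eqP => [|e]; first exact: prime_field_frob.
by rewrite -root_prod_XsubC prod_prime_field /root !hornerE e subrr.
Qed.

Lemma sum_prime_field (F : K -> K) :
  \sum_(c <- prime_field) F c = \sum_(0 <= i < p) F i%:R.
Proof. by rewrite big_map /index_iota subn0. Qed.

(** For exponents below [p - 1], sum [(c + 1)^(i+1) - c^(i+1)] over the prime field,
    which telescopes to zero, and use induction on [i]. *)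
Lemma sum_prime_field_exp j : (j < (p.-1).*2)%N ->
  \sum_(c <- prime_field) c ^+ j = if j == p.-1 then -1 else 0 :> K.
Proof.
have p1 := prime_gt1 p_prime.
have small i : (i < p.-1)%N -> \sum_(c <- prime_field) c ^+ i = 0 :> K.
  elim/ltn_ind: i => i IH hi.
  have : \sum_(c <- prime_field) ((1 + c) ^+ i.+1 - c ^+ i.+1) = 0 :> K.
    rewrite sum_prime_field.
    rewrite (eq_bigr (fun n => n.+1%:R ^+ i.+1 - n%:R ^+ i.+1)); last first.
      by move=> n _; rewrite nat1r.
    by rewrite telescope_sumr // (pcharf0 charK) expr0n subrr.
  rewrite (eq_bigr (fun c => \sum_(l < i.+1) c ^+ l *+ 'C(i.+1, l))); last first.
    move=> c _; rewrite exprDn big_ord_recr /= binn mulr1n subnn expr0 mul1r addrK.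
    by apply: eq_bigr => l _; rewrite expr1n mul1r.
  rewrite exchange_big big_ord_recr /= big1 ?add0r => [|l _]; last first.
    by rewrite sumrMnl IH ?mul0rn // (ltn_trans (ltn_ord l)).
  rewrite sumrMnl binSn -mulr_natr => /eqP.
  rewrite mulf_eq0 natf_eq0 gtnNdvd ?orbF //; first by move/eqP.
  by rewrite -ltnS prednK // in hi *.
move=> hj; case: ltngtP => [lt|gt|->]; first exact: small.
  have e : j = (p + (j - p))%N by lia.
  rewrite (eq_big_seq (fun c => c ^+ (j - p).+1)); last first.
    by move=> c /prime_field_frob hc; rewrite {1}e exprD hc exprS.
  by apply: small; lia.
have p10 : p.-1 != 0%N by rewrite -lt0n -ltnS prednK.
rewrite sum_prime_field big_ltn // expr0n (negPf p10) add0r.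
rewrite (eq_big_nat _ _ (F2 := fun=> 1)) => [|i /andP[i0 ip]]; last first.
  have i1 : i%:R != 0 :> K by rewrite natf_eq0 gtnNdvd.
  apply: (mulfI i1); rewrite -exprS prednK // mulr1 prime_field_frob //.
  by rewrite map_f // mem_iota.
rewrite big_const_nat iter_addr addr0 -[p in _ *+ (p - _)]prednK // subSS subn0.
by apply/eqP; rewrite -addr_eq0 natr1 prednK // natf_eq0.
Qed.

End PrimeField.

(** * The Hasse invariant and the degree of Frobenius plus the identity *)

Section PointCount.
Variables (K : closedFieldType) (L : fieldType) (f : {rmorphism {poly K} -> L}).
Hypothesis f_inj : injective f.
Hypothesis f_frac : forall x : L,
  exists AB : {poly K} * {poly K}, (AB.2 != 0) && (x == f AB.1 / f AB.2).
Variables (p h : nat) (a b : K).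
Hypothesis charK : p \in [pchar K].
Hypothesis p_odd : p = h.*2.+1.
Hypotheses (ap : a ^+ p = a) (bp : b ^+ p = b).
Hypotheses (two_neq0 : (2%:R : K) != 0).
Hypothesis disc_neq0 : 4%:R * a ^+ 3 + 27%:R * b ^+ 2 != 0.

Local Notation lam := (lam a b).
Local Notation pf := (prime_field K p).

Definition hasse : K := (lam ^+ h)`_(p.-1).

Let h_gt0 : (0 < h)%N.
Proof. by have := prime_gt1 (pcharf_prime charK); rewrite p_odd; case: h. Qed.

Lemma size_lam_exp n : size (lam ^+ n) = (3 * n).+1.
Proof. by rewrite size_exp_poly ?lam_neq0 // size_lam. Qed.

(** Among the power sums over the prime field of exponent at most [3 h], only that
    of exponent [p - 1] is nonzero. *)
Lemma sum_lam_exp : \sum_(c <- pf) lam.[c] ^+ h = - hasse.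
Proof.
pose n := p.-1.*2.
have sn : (size (lam ^+ h) <= n)%N.
  by rewrite size_lam_exp /n p_odd /=; move: h_gt0; lia.
rewrite (eq_bigr (fun c => \sum_(j < n) (lam ^+ h)`_j * c ^+ j)) => [|c _]; last first.
  by rewrite -horner_exp (horner_coef_wide _ sn).
have pn : (p.-1 < n)%N by rewrite /n p_odd /=; move: h_gt0; lia.
rewrite exchange_big (bigD1 (Ordinal pn)) //= -mulr_sumr.
rewrite (sum_prime_field_exp charK) // eqxx big1 => [|j nj].
  by rewrite addr0 mulrN1.
rewrite -mulr_sumr (sum_prime_field_exp charK) //.
by rewrite -val_eqE /= in nj; rewrite (negPf nj) mulr0.
Qed.

Lemma lam_horner c : lam.[c] = cubic a b c.
Proof. by rewrite /lam !hornerE. Qed.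

Lemma lam_exp_cases c : c \in pf ->
  [\/ lam.[c] = 0, lam.[c] ^+ h = 1 | lam.[c] ^+ h = -1].
Proof.
move/(prime_field_frob charK) => hc.
have e : lam.[c] ^+ p = lam.[c].
  rewrite lam_horner /cubic !(exprDp _ _ charK) [(a * c) ^+ p]exprMn ap bp hc.
  by rewrite -exprM mulnC exprM hc.
have [->|nz] := eqVneq lam.[c] 0; first by constructor 1.
have /eqP : (lam.[c] ^+ h) ^+ 2 = 1 ^+ 2.
  by apply: (mulfI nz); rewrite expr1n mulr1 -exprM muln2 -exprS -p_odd.
by rewrite eqf_sqr => /orP[]/eqP; [constructor 2|constructor 3].
Qed.

Variable s : K.
Hypothesis s2 : s ^+ 2 = 1.

Let s_neq0 : s != 0.
Proof. by apply: contra_eq_neq s2 => ->; rewrite expr0n eq_sym oner_eq0. Qed.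

(** The prime field is divided according to the quadratic character of [lam]. *)
Definition same := [seq c <- pf | lam.[c] ^+ h == s].
Definition zeros := [seq c <- pf | lam.[c] == 0].
Definition opposite := [seq c <- pf | lam.[c] ^+ h == - s].
Local Notation prodX r := (\prod_(c <- r) ('X - c%:P)).

Let s_neqN : s != - s.
Proof. by rewrite -addr_eq0 -mulr2n -mulr_natl mulf_neq0. Qed.

Lemma big_trichotomy (R : Type) (idx : R) (op : Monoid.com_law idx) (F : K -> R) :
  \big[op/idx]_(c <- pf) F c =
    op (\big[op/idx]_(c <- same) F c)
       (op (\big[op/idx]_(c <- zeros) F c) (\big[op/idx]_(c <- opposite) F c)).
Proof.
have e1 : \big[op/idx]_(c <- zeros) F c =
    \big[op/idx]_(c <- pf | ~~ (lam.[c] ^+ h == s) && (lam.[c] == 0)) F c.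
  rewrite big_filter big_seq_cond [RHS]big_seq_cond; apply: eq_bigl => c.
  case: (c \in pf) => //=; apply/esym/andb_idl => /eqP ->.
  by rewrite expr0n (gtn_eqF h_gt0) /= eq_sym.
have e2 : \big[op/idx]_(c <- opposite) F c =
    \big[op/idx]_(c <- pf | ~~ (lam.[c] ^+ h == s) && (lam.[c] != 0)) F c.
  rewrite big_filter big_seq_cond [RHS]big_seq_cond; apply: eq_bigl => c.
  case hc: (c \in pf) => //=; apply/eqP/andP => [e|[n1 n2]].
    split; first by rewrite e eq_sym.
    by apply: contraNneq s_neq0 => z; move/esym/eqP: e; rewrite z expr0n (gtn_eqF h_gt0) oppr_eq0.
  have : s ^+ 2 == 1 ^+ 2 by rewrite s2 expr1n.
  rewrite eqf_sqr; case: (lam_exp_cases hc) => e; rewrite ?e ?eqxx // in n1 n2 *.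
    by case/orP=> /eqP es; rewrite es ?opprK ?eqxx // in n1 *.
  by case/orP=> /eqP es; rewrite es ?eqxx // in n1 *.
rewrite [\big[_/_]_(_ <- same) _]big_filter e1 e2.
rewrite -(bigID (fun c => lam.[c] == 0) (fun c => ~~ (lam.[c] ^+ h == s))).
exact: (bigID (fun c => lam.[c] ^+ h == s)).
Qed.

Lemma size_trichotomy : p = (size same + (size zeros + size opposite))%N.
Proof.
have := big_trichotomy addn (fun=> 1%N).
by rewrite !sum1_size size_map size_iota.
Qed.

Lemma count_hasse :
  ((2 * p).+1%:R - (2 * size same)%:R - (size zeros)%:R : K) = 1 + s * hasse.
Proof.
have e1 := size_trichotomy.
have {e1} e1 : (size same)%:R + ((size zeros)%:R + (size opposite)%:R) = 0 :> K.
  by rewrite -!natrD -e1 (pcharf0 charK).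
have const (r : seq K) (t : K) : {in r, forall c, lam.[c] ^+ h = t} ->
    \sum_(c <- r) lam.[c] ^+ h = t * (size r)%:R.
  move=> hr; rewrite (eq_big_seq (fun=> t)) // big_const_seq count_predT.
  by rewrite iter_addr addr0 mulr_natr.
have e2 : s * (size same)%:R - s * (size opposite)%:R = - hasse.
  rewrite -sum_lam_exp (big_trichotomy +%R) /= (const same s); last first.
    by move=> c; rewrite mem_filter => /andP[/eqP].
  rewrite (const zeros 0) => [|c]; last first.
    by rewrite mem_filter => /andP[/eqP -> _]; rewrite expr0n (gtn_eqF h_gt0).
  rewrite (const opposite (- s)) => [|c]; last by rewrite mem_filter => /andP[/eqP].
  by rewrite mul0r add0r mulNr.
have {e2} -> : hasse = s * ((size opposite)%:R - (size same)%:R).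
  by rewrite -[hasse]opprK -e2; ring.
rewrite mulrA -expr2 s2 mul1r mulrS !natrM (pcharf0 charK) mulr0 addr0.
have -> : (size opposite)%:R = - ((size same)%:R + (size zeros)%:R) :> K.
  by apply/eqP; rewrite -addr_eq0 addrC -addrA; apply/eqP.
by ring.
Qed.

Local Notation C := (fun_curve f_inj two_neq0 (lam_neq0 a b) disc_neq0).

(** The numerator of the abscissa of the sum of [Q] and the Frobenius point, over
    the denominator [(X^p - X)^2], before cancellation. *)
Definition manin_num : {poly K} :=
  lam * (lam ^+ h - s%:P) ^+ 2 - ('X^p + 'X) * ('X^p - 'X) ^+ 2.

Lemma size_manin_num : size manin_num = (2 * p).+2.
Proof.
have charP : p \in [pchar {poly K}] by rewrite pchar_poly.
have lp : lam ^+ h ^+ 2 * lam = 'X^p ^+ 3 + (a%:P * 'X^p + b%:P).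
  rewrite -exprM muln2 -exprSr -p_odd /lam -addrA !(exprDp _ _ charP).
  by rewrite [(a%:P * 'X) ^+ p]exprMn -!polyC_exp ap bp -!exprM mulnC.
have -> : manin_num = 'X^(2 * p + 1) + (((a%:P * 'X^p + b%:P) +
    (- (2%:R * s))%:P * lam ^+ h.+1 + lam) + ('X^(p + 2) - 'X^3)).
  have -> : manin_num = lam ^+ h ^+ 2 * lam - 2%:R * s%:P * (lam * lam ^+ h)
     + (s ^+ 2)%:P * lam - ('X^p + 'X) * ('X^p - 'X) ^+ 2.
    by rewrite /manin_num polyC_exp; ring.
  rewrite lp s2 -exprS polyCN polyCM polyC_natr polyC1.
  by rewrite (_ : 2 * p + 1 = p + p + 1)%N ?exprD ?expr1; [ring|lia].
have hp : (h.*2.+1 = p)%N by [].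
rewrite size_polyDl size_polyXn; first by move: hp; lia.
have sD (P Q : {poly K}) n : (size P <= n -> size Q <= n -> size (P + Q)%R <= n)%N.
  by move=> hP hQ; apply: leq_trans (size_polyD _ _) _; rewrite geq_max hP.
rewrite ltnS; apply: (sD); first apply: (sD); first apply: (sD); first apply: (sD).
- by apply: size_scale_poly; rewrite size_polyXn; move: hp h_gt0; lia.
- by apply: leq_trans (size_polyC_leq1 _) _; move: hp h_gt0; lia.
- by apply: size_scale_poly; rewrite size_lam_exp; move: hp h_gt0; lia.
- by rewrite size_lam; move: hp h_gt0; lia.
- by apply: sD; rewrite ?size_polyN size_polyXn; move: hp h_gt0; lia.
Qed.

(** At [c] in the prime field the fraction [manin_num / (X^p - X)^2] cancels
    doubly if [lam.[c] ^+ h = s], once if [lam.[c] = 0], and not at all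
    otherwise. The degree that remains is read in [K] by [count_hasse]. *)
Lemma degree_frobenius_add (P Q : point C) :
  coords P = Some (f 'X^p, f (s%:P * lam ^+ h)) -> coords Q = Some (f 'X, 1) ->
  (degree f_frac (P + Q))%:R = 1 + s * hasse.
Proof.
move=> eP eQ; rewrite -count_hasse.
pose S := prodX same; pose Z := prodX zeros; pose T := prodX opposite.
have uf r : uniq [seq c <- pf | r c] by rewrite filter_uniq // uniq_prime_field.
have STZ : 'X^p - 'X = S * Z * T :> {poly K}.
  by rewrite -(prod_prime_field charK) (big_trichotomy *%R) /= mulrA.
have S0 : S != 0 by rewrite monic_neq0 ?monic_prod_XsubC.
have Z0 : Z != 0 by rewrite monic_neq0 ?monic_prod_XsubC.
have T0 : T != 0 by rewrite monic_neq0 ?monic_prod_XsubC.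
have [e ee] : exists e, lam ^+ h - s%:P = e * S.
  apply/dvdpP/uniq_roots_dvdp; last by rewrite uniq_rootsE uf.
  apply/allP => c; rewrite mem_filter => /andP[/eqP hc _].
  by rewrite /root hornerD hornerN hornerC horner_exp hc subrr.
have [y ey] : exists y, lam = y * Z.
  apply/dvdpP/uniq_roots_dvdp; last by rewrite uniq_rootsE uf.
  by apply/allP => c; rewrite mem_filter => /andP[hc _].
pose A := y * e ^+ 2 - ('X^p + 'X) * (Z * T ^+ 2); pose B := Z * T ^+ 2.
have eN : manin_num = S ^+ 2 * Z * A by rewrite /manin_num ee STZ {1}ey /A; ring.
have B0 : B != 0 by rewrite mulf_neq0 ?expf_neq0.
have cAB : coprimep A B.
  rewrite coprimep_sym; apply/Pdiv.ClosedField.coprimepP => c; rewrite rootM => rc.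
  have Bc : B.[c] = 0 by apply/eqP; rewrite -/(root B c) rootM.
  have -> : A.[c] = y.[c] * e.[c] ^+ 2.
    by rewrite /A -/B hornerD hornerN [(_ * B).[c]]hornerM Bc mulr0 subr0 hornerM horner_exp.
  have he : lam.[c] ^+ h - s = e.[c] * S.[c].
    have := congr1 (horner^~ c) ee; rewrite hornerM => <-.
    by rewrite [(_ - s%:P).[c]]hornerD hornerN hornerC horner_exp.
  have hy : lam.[c] = y.[c] * Z.[c] by rewrite ey hornerM.
  case/orP: rc => rc.
    have rz : c \in zeros by rewrite -root_prod_XsubC.
    have lc : lam.[c] = 0 by move: rz; rewrite mem_filter => /andP[/eqP].
    apply: mulf_neq0.
      apply/negP => /factor_theorem[y' ey']; case/factor_theorem: rc => z' ez'.
      have : lam %| ('X - c%:P) * (y' * z').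
        apply: (squarefree_cubic disc_neq0).
        have -> : (('X - c%:P) * (y' * z')) ^+ 2 = (y' * z') * (y * Z).
          by rewrite ey' ez'; ring.
        by rewrite -ey dvdp_mull.
      have yz : y' * z' != 0.
        by apply: contraNneq (lam_neq0 a b) => e0; rewrite ey ey' ez' mulrACA e0 mul0r.
      have e3 : lam = ('X - c%:P) * (('X - c%:P) * (y' * z')).
        by rewrite ey ey' ez'; ring.
      have w0 : ('X - c%:P) * (y' * z') != 0 by rewrite mulf_eq0 negb_or polyXsubC_eq0.
      move/(dvdp_leq w0); rewrite {1}e3 size_mul ?polyXsubC_eq0 //.
      by move: (size_XsubC c); size_lia.
    rewrite expf_neq0 //; apply: contraNneq s_neq0 => z.
    by move/eqP: he; rewrite z mul0r lc expr0n (gtn_eqF h_gt0) sub0r oppr_eq0.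
  have lc : lam.[c] ^+ h = - s.
    have : c \in opposite by rewrite -root_prod_XsubC; move: rc; rewrite expr2 rootM orbb.
    by rewrite mem_filter => /andP[/eqP].
  apply: mulf_neq0.
    apply: contraNneq s_neq0 => z; move/eqP: lc.
    by rewrite hy z mul0r expr0n (gtn_eqF h_gt0) eq_sym oppr_eq0.
  rewrite expf_neq0 //; apply: contraNneq s_neqN => z.
  by move/eqP: he; rewrite z mul0r lc subr_eq0 eq_sym.
have XpX : 'X^p - 'X != 0 :> {poly K} by rewrite STZ !mulf_neq0.
have fXpX : f 'X^p - f 'X != 0 by rewrite -rmorphB f_eq0.
rewrite /degree coordsD eP eQ /pt_add.
have nX : f 'X^p != f 'X by rewrite -subr_eq0.
rewrite (negPf nX) /= /third /slope (negPf nX).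
have A0 : A != 0.
  have : manin_num != 0 by rewrite -size_poly_gt0 size_manin_num.
  by apply: contraNneq => z; rewrite eN z mulr0.
rewrite (heightE f_inj f_frac B0 cAB); last first.
  have fS : f (S ^+ 2 * Z) != 0 by rewrite f_eq0 // mulf_neq0 ?expf_neq0.
  have -> : f A / f B = f manin_num / f (('X^p - 'X) ^+ 2).
    have -> : ('X^p - 'X) ^+ 2 = S ^+ 2 * Z * B by rewrite STZ /B; ring.
    by rewrite eN (rmorphM f _ A) (rmorphM f _ B) -mulf_div divff ?mul1r.
  have s2' : f s%:P ^+ 2 = 1 by rewrite -rmorphXn -polyC_exp s2 rmorph1.
  rewrite /manin_num (rmorphB f) (rmorphM f lam) (rmorphM f ('X^p + 'X)).
  rewrite ![f (_ ^+ 2)](rmorphXn f) !(rmorphB f) (rmorphD f 'X^p) (rmorphM f s%:P).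
  have -> : f lam * (f (lam ^+ h) - f s%:P) ^+ 2 = f lam * (f s%:P * f (lam ^+ h) - 1) ^+ 2.
    by ring: s2'.
  by field.
have sS : size S = (size same).+1 by rewrite size_prod_XsubC.
have sZ : size Z = (size zeros).+1 by rewrite size_prod_XsubC.
have sA : (2 * size same + size zeros + size A = (2 * p).+2)%N.
  rewrite -size_manin_num eN size_mul ?mulf_neq0 ?expf_neq0 // size_mul ?expf_neq0 //.
  by rewrite size_exp_poly // sS sZ /= mulnC !addnS !addSn.
have Agt : (0 < size A)%N by rewrite size_poly_gt0.
have -> : ((2 * p).+1 = (2 * size same + size zeros) + (size A).-1)%N.
  by clear -sA Agt; move: (size A) sA Agt => u; lia.
by rewrite !natrD; ring.
Qed.

End PointCount.

(** * The curve with complex multiplication *)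

Section ComplexMultiplication.
Variables (K : closedFieldType) (L : fieldType) (f : {rmorphism {poly K} -> L}).
Hypothesis f_inj : injective f.
Hypothesis f_frac : forall x : L,
  exists AB : {poly K} * {poly K}, (AB.2 != 0) && (x == f AB.1 / f AB.2).
Variables (p h : nat).
Hypothesis charK : p \in [pchar K].
Hypothesis p_odd : p = h.*2.+1.
Hypotheses (p2 : p != 2%N) (p3 : p != 3%N) (p7 : p != 7%N) (p11 : p != 11%N).

Let p_prime : prime p := pcharf_prime charK.

Lemma prime_natf_neq0 q : prime q -> p != q -> (q%:R : K) != 0.
Proof. by move=> pq; apply: contra; rewrite (natf_eq0 charK) dvdn_prime2. Qed.

Let two_neq0 : (2%:R : K) != 0. Proof. exact: prime_natf_neq0. Qed.
Let three_neq0 : (3%:R : K) != 0. Proof. exact: prime_natf_neq0. Qed.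
Let seven_neq0 : (7%:R : K) != 0. Proof. exact: prime_natf_neq0. Qed.
Let eleven_neq0 : (11%:R : K) != 0. Proof. exact: prime_natf_neq0. Qed.

Definition cm_a : K := - 264%:R.
Definition cm_b : K := 1694%:R.

Lemma cm_a_neq0 : cm_a != 0.
Proof.
rewrite /cm_a (_ : - 264%:R = - (2%:R ^+ 3 * 3%:R * 11%:R)) ?oppr_eq0; last by ring.
by rewrite !mulf_neq0 ?expf_neq0.
Qed.
Lemma cm_b_neq0 : cm_b != 0.
Proof.
rewrite /cm_b (_ : 1694%:R = 2%:R * 7%:R * 11%:R ^+ 2); last by ring.
by rewrite !mulf_neq0 ?expf_neq0.
Qed.
Lemma cm_disc_neq0 : 4%:R * cm_a ^+ 3 + 27%:R * cm_b ^+ 2 != 0.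
Proof.
rewrite (_ : _ + _ = 2%:R ^+ 2 * 3%:R ^+ 6 * 11%:R ^+ 3); last by rewrite /cm_a /cm_b; ring.
by rewrite !mulf_neq0 ?expf_neq0.
Qed.

Let cm_ap : cm_a ^+ p = cm_a.
Proof. by rewrite -(pFrobenius_autE charK) /cm_a rmorphN rmorph_nat. Qed.
Let cm_bp : cm_b ^+ p = cm_b.
Proof. by rewrite -(pFrobenius_autE charK) /cm_b rmorph_nat. Qed.

Local Notation lam := (lam cm_a cm_b).
Local Notation C := (fun_curve f_inj two_neq0 (lam_neq0 cm_a cm_b) cm_disc_neq0).

Local Notation polar := (@at_infinity _ _ _ f_inj f_frac _ _ _
  two_neq0 (lam_neq0 cm_a cm_b) cm_disc_neq0).

Section Root.
Variable t : K.
Hypothesis ht : t ^+ 2 = t - 3%:R.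

Lemma cm_root_neq0 : t != 0.
Proof.
apply: contraNneq three_neq0 => t0; move/eqP: ht.
by rewrite t0 expr0n sub0r eq_sym oppr_eq0.
Qed.

(** Multiplication by [t] on the generic point is [(isoA / isoB^2, isoC / isoB^3)]
    on the twisted curve. *)
Definition isoA : {poly K} := iso_num t%:P 'X.
Definition isoB : {poly K} := t%:P * iso_ker t%:P 'X.
Definition isoC : {poly K} := iso_dnum t%:P 'X.

Let ht' : t%:P ^+ 2 = t%:P - 3%:R :> {poly K}.
Proof. by rewrite -polyC_exp ht polyCB polyC_natr. Qed.

Let r : K := 12%:R - 2%:R * t.
Let v : K := 264%:R - 264%:R * t.
Let w : K := 616%:R + 704%:R * t.

Let rE : r%:P = 12%:R - 2%:R * t%:P.
Proof. by rewrite /r polyCB polyCM !polyC_natr. Qed.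
Let vE : v%:P = 264%:R - 264%:R * t%:P.
Proof. by rewrite /v polyCB polyCM !polyC_natr. Qed.
Let wE : w%:P = 616%:R + 704%:R * t%:P.
Proof. by rewrite /w polyCD polyCM !polyC_natr. Qed.

Lemma isoBE : isoB = t *: ('X - r%:P).
Proof. by rewrite /isoB /iso_ker -rE mul_polyC. Qed.

Lemma isoAE : isoA = 'X * ('X - r%:P) ^+ 2 + v%:P * ('X - r%:P) - w%:P.
Proof. by rewrite /isoA /iso_num /iso_ker -rE -vE -wE. Qed.

Lemma isoCE : isoC = ('X - r%:P) ^+ 3 - v%:P * ('X - r%:P) + 2%:R * w%:P.
Proof. by rewrite /isoC /iso_dnum /iso_ker -rE -vE -wE. Qed.

Lemma isoB_neq0 : isoB != 0.
Proof. by rewrite isoBE scaler_eq0 negb_or cm_root_neq0 polyXsubC_eq0. Qed.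

Lemma size_isoB2 : size (isoB ^+ 2) = 3%N.
Proof.
by rewrite size_exp_poly ?isoB_neq0 // isoBE size_scale ?cm_root_neq0 // size_XsubC.
Qed.

Lemma size_isoA : size isoA = 4%N.
Proof.
have -> : isoA = 'X^3 + ((- (2%:R * r))%:P * 'X^2 + ((r ^+ 2 + v)%:P * 'X - (v * r + w)%:P)).
  rewrite isoAE polyCN (polyCM 2%:R) (polyCD (r ^+ 2)) (polyCD (v * r)) (polyCM v).
  by rewrite polyC_exp polyC_natr; ring.
rewrite size_polyDl size_polyXn //.
have sD (P Q : {poly K}) n : (size P <= n -> size Q <= n -> size (P + Q)%R <= n)%N.
  by move=> hP hQ; apply: leq_trans (size_polyD _ _) _; rewrite geq_max hP.
rewrite ltnS; apply: (sD); last apply: (sD).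
- by apply: size_scale_poly; rewrite size_polyXn.
- by apply: size_scale_poly; rewrite size_polyX.
- by rewrite size_polyN (leq_trans (size_polyC_leq1 _)).
Qed.

Lemma coprime_isoAB : coprimep isoA (isoB ^+ 2).
Proof.
apply: coprimep_expr; rewrite isoBE coprimepZr ?cm_root_neq0 //.
rewrite coprimep_XsubC /root.
rewrite isoAE; have -> : ('X * ('X - r%:P) ^+ 2 + v%:P * ('X - r%:P) - w%:P).[r] = - w.
  move: (v) (w) (r) => v' w' r'.
  by rewrite !(hornerD, hornerN, horner_exp, hornerM, hornerX, hornerC) subrr; ring.
rewrite oppr_eq0; apply/negP => /eqP; rewrite /w => e.
have : (616%:R + 704%:R * t) * (616%:R + 704%:R * (1 - t)) = 2%:R ^+ 6 * 3%:R ^+ 3 * 11%:R ^+ 3.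
  by ring: ht.
rewrite e mul0r => /esym/eqP; apply/negP.
by rewrite !mulf_neq0 ?expf_neq0.
Qed.

Definition iso_x : L := f isoA / f (isoB ^+ 2).
Definition iso_y : L := f isoC / f (isoB ^+ 3).

Lemma iso_on_curve : on_curve (f cm_a%:P) (f cm_b%:P) (f lam) (Some (iso_x, iso_y)).
Proof.
have fB : f isoB != 0 by rewrite f_eq0 ?isoB_neq0.
have e : isoA ^+ 3 - 264%:R * isoA * isoB ^+ 4 + 1694%:R * isoB ^+ 6 = lam * isoC ^+ 2.
  rewrite /isoA /isoB /isoC (isogeny _ ht') /lam /cm_a /cm_b polyCN !polyC_natr.
  by rewrite mulNr.
have {}e : f isoA ^+ 3 - 264%:R * f isoA * f isoB ^+ 4 + 1694%:R * f isoB ^+ 6 =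
    f lam * f isoC ^+ 2.
  rewrite -[f lam * _]/(f lam * f isoC ^+ 2) -(rmorphXn f 2 isoC) -(rmorphM f lam) -e.
  rewrite (rmorphD f _ (1694%:R * _)) (rmorphB f (isoA ^+ 3)) (rmorphM f 1694%:R) (rmorphM f (264%:R * isoA)).
  by rewrite (rmorphM f 264%:R) !(rmorphXn f) !rmorph_nat.
have ea : f cm_a%:P = - 264%:R by rewrite /cm_a polyCN polyC_natr rmorphN rmorph_nat.
have eb : f cm_b%:P = 1694%:R by rewrite /cm_b polyC_natr rmorph_nat.
rewrite /on_curve /cubic /iso_x /iso_y ea eb (rmorphXn f 2) (rmorphXn f 3).
move: e fB; move: (f isoA) (f isoB) (f isoC) (f lam) => A B D l e fB.
apply/eqP; transitivity (l * D ^+ 2 / B ^+ 6); first by field.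
by rewrite -e; field.
Qed.

Definition iso_pt : point C := @Point _ C _ iso_on_curve.

Lemma iso_at_infinity : at_infinity f_frac iso_pt.
Proof.
rewrite /at_infinity /= (poleE f_inj f_frac _ coprime_isoAB erefl) ?expf_neq0 ?isoB_neq0 //.
by rewrite size_isoB2 size_isoA.
Qed.

Lemma iso_degree (P : point C) y : coords P = Some (iso_x, y) -> degree f_frac P = 3%N.
Proof.
move=> e; rewrite /degree e (heightE f_inj f_frac _ coprime_isoAB erefl) ?expf_neq0 ?isoB_neq0 //.
by rewrite size_isoA.
Qed.

Lemma iso_multiplier : has_multiplier f_frac iso_pt t.
Proof.
have fB : f isoB != 0 by rewrite f_eq0 ?isoB_neq0.
rewrite /has_multiplier /= frac_deriv_div ?expf_neq0 ?isoB_neq0 //.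
have -> : isoA^`() * isoB ^+ 2 - isoA * (isoB ^+ 2)^`() = t%:P * (isoB * isoC).
  rewrite isoAE isoBE isoCE -mul_polyC; move: (v) (w) (r) => v' w' r'.
  by rewrite !(derivD, derivN, derivM, deriv_exp, derivX, derivC) /=; ring.
rewrite /iso_y (rmorphM f) (rmorphM f isoB) !(rmorphXn f).
by field.
Qed.
End Root.

Section Lattice.
Variable t : K.
Hypothesis ht : t ^+ 2 = t - 3%:R.

Let ht1 : (1 - t) ^+ 2 = (1 - t) - 3%:R. Proof. by ring: ht. Qed.

Let gen_on_curve : on_curve (f cm_a%:P) (f cm_b%:P) (f lam) (Some (f 'X, 1)).
Proof.
rewrite /= expr1n mulr1 /cubic -(rmorphXn f) -(rmorphM f) -!(rmorphD f).
exact: eqxx.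
Qed.

Definition gen_pt : point C := @Point _ C _ gen_on_curve.
Local Notation Q := gen_pt.
Local Notation U := (iso_pt ht).

Let fX : f 'X = f 'X / f 1. Proof. by rewrite rmorph1 divr1. Qed.

Lemma gen_at_infinity : at_infinity f_frac Q.
Proof.
rewrite /at_infinity /= (poleE f_inj f_frac _ _ fX) ?oner_neq0 ?coprimep1 //.
by rewrite size_polyX size_poly1.
Qed.

Lemma gen_degree : degree f_frac Q = 1%N.
Proof.
by rewrite /degree /= (heightE f_inj f_frac _ _ fX) ?oner_neq0 ?coprimep1 // size_polyX.
Qed.

Lemma gen_multiplier : has_multiplier f_frac Q 1.
Proof. by rewrite /has_multiplier /= frac_deriv_poly derivX polyC1 rmorph1 mulr1. Qed.

Lemma degree_iso_sub : degree f_frac (U - Q) = 3%N.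
Proof.
have nx : iso_x t != f 'X.
  apply/eqP => e; have := size_num f_inj f_frac _ (coprime_isoAB ht) (esym e).
  rewrite (size_num f_inj f_frac _ _ fX) ?expf_neq0 ?isoB_neq0 ?oner_neq0 ?coprimep1 //.
  by rewrite size_polyX size_isoA // => /(_ isT).
pose T := f t%:P.
have hT : T ^+ 2 = T - 3%:R.
  by rewrite /T -(rmorphXn f) -polyC_exp ht polyCB polyC_natr rmorphB rmorph_nat.
have eB s : f (isoB s) = f s%:P * iso_ker (f s%:P) (f 'X) by exact: rmorph_iso_ker.
have eA s : f (isoA s) = iso_num (f s%:P) (f 'X) by exact: rmorph_iso_num.
have eC s : f (isoC s) = iso_dnum (f s%:P) (f 'X) by exact: rmorph_iso_dnum.
have fB1 : f (isoB t) != 0 by rewrite f_eq0 ?isoB_neq0.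
have fB2 : f (isoB (1 - t)) != 0 by rewrite f_eq0 ?isoB_neq0.
have e1 : f (1 - t)%:P = 1 - T by rewrite polyCB polyC1 rmorphB rmorph1.
have ex : iso_x t = iso_num T (f 'X) / (T * iso_ker T (f 'X)) ^+ 2.
  by rewrite /iso_x (rmorphXn f) eA eB.
have ey : iso_y t = iso_dnum T (f 'X) / (T * iso_ker T (f 'X)) ^+ 3.
  by rewrite /iso_y (rmorphXn f) eC eB.
have ez : iso_x (1 - t) = iso_num (1 - T) (f 'X) / ((1 - T) * iso_ker (1 - T) (f 'X)) ^+ 2.
  by rewrite /iso_x (rmorphXn f) eA eB e1.
move: fB1 fB2; rewrite !eB e1 !mulf_eq0 !negb_or => /andP[T0 k1] /andP[T1 k2].
have := isogeny_sub1 hT k1 k2 T0 T1; cbv zeta.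
rewrite -ex -ey -ez subr_eq0 => /(_ nx) key.
have flam : f lam = f 'X ^+ 3 - 264%:R * f 'X + 1694%:R.
  rewrite /lam (rmorphD f _ cm_b%:P) (rmorphD f 'X^3) (rmorphM f cm_a%:P) (rmorphXn f).
  by rewrite /cm_a /cm_b polyCN !polyC_natr (rmorphN f) !rmorph_nat mulNr.
apply: (iso_degree ht1).
rewrite coordsD coordsN /= /pt_add (negPf nx) /= /third /slope (negPf nx).
rewrite opprK flam key; reflexivity.
Qed.

Lemma has_multiplier_intr (P : point C) mu (n : int) : at_infinity f_frac P ->
  has_multiplier f_frac P mu -> has_multiplier f_frac (P *~ n) (mu *~ n).
Proof.
move=> hP hm.
have nat_case j : has_multiplier f_frac (P *+ j) (mu *+ j).
  elim: j => [|j IH]; first by [].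
  rewrite !mulrS; apply: has_multiplierD => //.
  by have hPj : P *+ j \in polar by apply: rpredMn.
case: n => j; first exact: nat_case.
by rewrite NegzE !mulrNz; apply: has_multiplierN; exact: nat_case.
Qed.

(** The point that corresponds to multiplication by [m + n t]. *)
Definition lattice_pt (m n : int) : point C := Q *~ m + U *~ n.

Lemma lattice_at_infinity m n : at_infinity f_frac (lattice_pt m n).
Proof.
have hQ : Q \in polar by exact: gen_at_infinity.
have hU : U \in polar by exact: iso_at_infinity.
by have := rpredD (rpredMz m hQ) (rpredMz n hU).
Qed.

(** A quadratic form in two variables is known from the three values at [Q], [U]
    and [U - Q], namely 1, 3 and 3. *)
Lemma lattice_degree m n :
  (degree f_frac (lattice_pt m n))%:Z = m ^+ 2 + m * n + 3 * n ^+ 2.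
Proof.
have hQ : Q \in polar by exact: gen_at_infinity.
have hU : U \in polar by exact: iso_at_infinity.
have par := @degree_parallelogram _ _ _ f_inj f_frac _ _ _ two_neq0 (lam_neq0 cm_a cm_b) cm_disc_neq0.
have dU : degree f_frac U = 3%N by apply: (iso_degree ht).
have dQU : degree f_frac (Q + U) = 5%N.
  have := par U Q hU hQ; rewrite [U + Q]addrC dU gen_degree degree_iso_sub => e.
  exact: (@addIn 3%N _ 5%N e).
have parZ : {in polar &, forall P R : point C,
    (degree f_frac (P + R))%:Z + (degree f_frac (P - R))%:Z =
      2 * ((degree f_frac P)%:Z + (degree f_frac R)%:Z)}.
  by move=> P R hP hR; have e := par P R hP hR; rewrite -!PoszD e -PoszM.
rewrite (quadratic_lattice parZ) // dU gen_degree dQU; ring.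
Qed.

Lemma lattice_multiplier m n :
  has_multiplier f_frac (lattice_pt m n) (m%:~R + t *~ n).
Proof.
apply: has_multiplierD; try by [].
- exact: (rpredMz m (gen_at_infinity : Q \in polar)).
- exact: (rpredMz n (iso_at_infinity ht : U \in polar)).
- exact: (has_multiplier_intr m gen_at_infinity gen_multiplier).
- exact: (has_multiplier_intr n (iso_at_infinity ht) (iso_multiplier ht)).
Qed.

(** The point [P] attached to [m + n t] has degree [p] and multiplier 0, so it is
    the Frobenius point up to a sign [s]. The degree of [P + Q] is the norm of
    [m + 1 + n t], which is [p + 1 + 2 m + n], and also [1 + s H] in [K]. *)
Theorem cm_hasse_sqr (m n : int) :
  m ^+ 2 + m * n + 3 * n ^+ 2 = p%:Z -> m%:~R + t *~ n = 0 ->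
  hasse p h cm_a cm_b ^+ 2 = (2 * m + n)%:~R ^+ 2.
Proof.
move=> norm_p mul0.
have hP := lattice_at_infinity m n.
have dP : degree f_frac (lattice_pt m n) = p.
  by have := lattice_degree m n; rewrite norm_p => -[].
have mP := lattice_multiplier m n; rewrite mul0 in mP.
have insep := inseparable_point charK p_odd cm_ap cm_bp cm_a_neq0 cm_b_neq0 three_neq0 hP dP mP.
have [s s2 es] : exists2 s : K, s ^+ 2 = 1 &
    coords (lattice_pt m n) = Some (f 'X^p, f (s%:P * lam ^+ h)).
  case: insep => ->; [exists 1 | exists (-1)]; rewrite ?expr1n ?sqrrN ?expr1n //.
    by rewrite polyC1 mul1r (rmorphXn f h lam).
  by rewrite polyCN polyC1 mulN1r (rmorphN f) (rmorphXn f h lam).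
have := degree_frobenius_add f_frac charK p_odd cm_ap cm_bp s2 es (erefl : coords Q = _).
have -> : lattice_pt m n + Q = lattice_pt (m + 1) n.
  by rewrite /lattice_pt mulrzDr mulr1z addrAC.
have := lattice_degree (m + 1) n.
have -> : (m + 1) ^+ 2 + (m + 1) * n + 3 * n ^+ 2 = p%:Z + 1 + (2 * m + n).
  by rewrite -norm_p; ring.
move=> dZ; have -> : (degree f_frac (lattice_pt (m + 1) n))%:R = 1 + (2 * m + n)%:~R :> K.
  by rewrite pmulrn dZ !intrD -pmulrn (pcharf0 charK) add0r.
move/addrI => ->; by rewrite exprMn s2 mul1r.
Qed.
End Lattice.

End ComplexMultiplication.

(** * Vanishing of the Hasse invariant *)

(** The power [q^h] expanded according to the coefficients of [P^h], when [q] is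
    [B^d P(A / B^2)]. *)
Lemma homogenize (K L : fieldType) (f : {rmorphism {poly K} -> L})
    (P q A B : {poly K}) (d n h : nat) : injective f ->
  B != 0 -> (size (P ^+ h)%R <= n.+1)%N -> (d * h = 2 * n)%N ->
  f q = f B ^+ d * (map_poly (f \o polyC) P).[f A / f B ^+ 2] ->
  q ^+ h = \sum_(j < n.+1) ((P ^+ h)`_j)%:P * (A ^+ j * B ^+ (2 * (n - j))).
Proof.
move=> f_inj B0 sP ed hq.
have fB : f B != 0 by rewrite f_eq0.
apply: f_inj.
rewrite (rmorphXn f) hq exprMn -exprM ed -horner_exp -(rmorphXn (map_poly (f \o polyC))).
rewrite (@horner_coef_wide _ n.+1) ?size_map_poly //. rewrite mulr_sumr rmorph_sum.
apply: eq_bigr => j _; rewrite coef_map (rmorphM f) (rmorphM f _ (B ^+ _)) !(rmorphXn f) /=.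
have -> : f B ^+ (2 * n) = f B ^+ (2 * j) * f B ^+ (2 * (n - j)).
  by rewrite -exprD -mulnDr subnKC // -ltnS.
rewrite expr_div_n -exprM; move: (f B) (f A) (f _%:P) fB => u v w fB.
by field; rewrite expf_neq0.
Qed.

Section Inert.
Variables (K : closedFieldType) (p h : nat).
Hypothesis charK : p \in [pchar K].
Hypothesis p_odd : p = h.*2.+1.
Hypotheses (p2 : p != 2%N) (p3 : p != 3%N) (p7 : p != 7%N) (p11 : p != 11%N).
Variable t : K.
Hypothesis ht : t ^+ 2 = t - 3%:R.

Variables (L : fieldType) (f : {rmorphism {poly K} -> L}).
Hypothesis f_inj : injective f.

Local Notation lam := (lam (cm_a K) (cm_b K)).
Let A : {poly K} := isoA t.
Let B : {poly K} := isoB t.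
Let C : {poly K} := isoC t.
Let k : {poly K} := iso_ker t%:P 'X.

(** The invariant differential is multiplied by [t]. *)
Lemma iso_deriv : A^`() * B - 2%:R * t%:P * A = t%:P * C.
Proof.
rewrite /A /B /C isoAE isoBE isoCE -mul_polyC.
move: (12%:R - _) (264%:R - _) (616%:R + _) => r v w.
by rewrite !(derivD, derivN, derivM, deriv_exp, derivX, derivC) /=; ring.
Qed.

Let t_neq0 : t != 0 := cm_root_neq0 charK p3 ht.
Let B_neq0 : B != 0 := isoB_neq0 charK p3 ht.

Let kE : k = 'X - (12%:R - 2%:R * t)%:P.
Proof. by rewrite /k /iso_ker polyCB polyCM !polyC_natr. Qed.

Let BE : B = t%:P * k. Proof. by []. Qed.

Let h_gt0 : (0 < h)%N.
Proof. by have := prime_gt1 (pcharf_prime charK); rewrite p_odd; case: h. Qed.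

Lemma iso_expand :
  lam ^+ h * C ^+ p = \sum_(j < (3 * h).+1)
    ((lam ^+ h)`_j)%:P * (A ^+ j * C * B ^+ (2 * (3 * h - j))).
Proof.
have ht' : t%:P ^+ 2 = t%:P - 3%:R :> {poly K}.
  by rewrite -polyC_exp ht polyCB polyC_natr.
pose q := lam * C ^+ 2.
have hq : f q = f B ^+ 6 * (map_poly (f \o polyC) lam).[f A / f B ^+ 2].
  have fB : f B != 0 by rewrite f_eq0.
  have -> : q = A ^+ 3 + (cm_a K)%:P * A * B ^+ 4 + (cm_b K)%:P * B ^+ 6.
    rewrite /q /lam /cm_a /cm_b polyCN !polyC_natr !mulNr.
    exact/esym/(isogeny 'X ht').
  rewrite /lam (rmorphD _ _ (cm_b K)%:P) (rmorphD _ 'X^3) (rmorphM _ (cm_a K)%:P) /=.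
  rewrite map_polyXn map_polyX !map_polyC /=.
  rewrite (hornerD _ (f _)%:P) (hornerD 'X^3) hornerXn (hornerM (f _)%:P) hornerX !hornerC.
  rewrite (rmorphD f _ ((cm_b K)%:P * _)) (rmorphD f (A ^+ 3)) (rmorphM f (cm_b K)%:P).
  rewrite (rmorphM f _ (B ^+ 4)) (rmorphM f (cm_a K)%:P) !(rmorphXn f).
  by field.
have -> : lam ^+ h * C ^+ p = q ^+ h * C.
  by rewrite /q exprMn p_odd exprSr -mul2n exprM mulrA.
rewrite (homogenize f_inj B_neq0 (n := 3 * h) (d := 6) _ _ hq); first last.
- lia.
- by rewrite size_lam_exp.
rewrite mulr_suml; apply: eq_bigr => j _; ring.
Qed.

Lemma deriv_coef_top (P : {poly K}) n : (P^`())`_(p * n.+1).-1 = 0.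
Proof.
have p0 : (0 < p)%N by rewrite p_odd.
rewrite coef_deriv prednK ?muln_gt0 ?p0 // -mulr_natr natrM (pcharf0 charK).
by rewrite mul0r mulr0.
Qed.

(** Up to the factor [(j + 1) t], which is nonzero unless [j = p - 1], this
    polynomial is the derivative of [A^(j+1) B^(3p-2(j+1))], and derivatives have
    no monomials of degree [-1] modulo [p]. *)
Lemma iso_term_coef j : (j <= 3 * h)%N -> j != p.-1 ->
  (A ^+ j * C * B ^+ (2 * (3 * h - j)))`_(p * 4).-1 = 0.
Proof.
move=> hj nj.
have e : (A ^+ j.+1 * B ^+ (3 * p - 2 * j.+1))^`() =
    (j.+1%:R * t) *: (A ^+ j * C * B ^+ (2 * (3 * h - j))).
  have -> : (3 * p - 2 * j.+1 = (2 * (3 * h - j)).+1)%N by rewrite p_odd; lia.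
  rewrite derivM !deriv_exp /=.
  transitivity (A ^+ j * B ^+ (2 * (3 * h - j)) * (j.+1%:R * (A^`() * B) +
      (2 * (3 * h - j)).+1%:R * A * B^`())); first by rewrite !exprSr; ring.
  have -> : B^`() = t%:P by rewrite /B isoBE derivZ derivXsubC alg_polyC.
  have -> : (2 * (3 * h - j)).+1%:R = - (2%:R * j.+1%:R) :> {poly K}.
    apply/eqP; rewrite -addr_eq0 -natrM -natrD.
    have -> : ((2 * (3 * h - j)).+1 + 2 * j.+1 = p * 3)%N by rewrite p_odd; lia.
    by rewrite -polyC_natr natrM (pcharf0 charK) mul0r polyC0.
  rewrite -mul_polyC polyCM polyC_natr; apply/eqP; rewrite -subr_eq0; apply/eqP.
  transitivity (A ^+ j * B ^+ (2 * (3 * h - j)) * j.+1%:R *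
     ((A^`() * B - 2%:R * t%:P * A) - t%:P * C)); first by ring.
  by rewrite iso_deriv subrr mulr0.
have := deriv_coef_top (A ^+ j.+1 * B ^+ (3 * p - 2 * j.+1)) 3.
rewrite e coefZ => /eqP; rewrite !mulf_eq0 (negPf t_neq0) orbF => /orP[|/eqP //].
rewrite (natf_eq0 charK) => /dvdnP[[|[|q]] eq] //.
  by case/eqP: nj; rewrite -[j]/(j.+1.-1) eq mul1n.
by exfalso; move: eq hj; rewrite p_odd; nia.
Qed.

Let A_monic : A \is monic.
Proof.
have sA : size A = 4%N by apply: size_isoA.
rewrite monicE /lead_coef sA /= /A isoAE.
move: (12%:R - _) (264%:R - _) (616%:R + _) => r v w.
rewrite (_ : _ - w%:P = 'X^3 + ((- (2%:R * r))%:P * 'X^2 + ((r ^+ 2 + v)%:P * 'X - (v * r + w)%:P))).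
  by rewrite !(coefD, coefCM, coefXn, coefX, coefN, coefC) /= !mulr0 oppr0 !addr0.
rewrite polyCN (polyCM 2%:R) (polyCD (r ^+ 2)) (polyCD (v * r)) (polyCM v).
by rewrite polyC_exp polyC_natr; ring.
Qed.

Let C_expand : exists c2 c1 c0,
  C = 'X^3 + (c2%:P * 'X^2 + (c1%:P * 'X + c0%:P)).
Proof.
rewrite /C isoCE; move: (12%:R - _) (264%:R - _) (616%:R + _) => r v w.
exists (- (3%:R * r)), (3%:R * r ^+ 2 - v), (- r ^+ 3 + v * r + 2%:R * w).
rewrite polyCN (polyCM 3%:R r) (polyCB (3%:R * _)) (polyCM 3%:R) (polyCD (_ + _)).
rewrite (polyCD (- _)) (polyCM v) polyCN (polyCM 2%:R) !polyC_exp !polyC_natr.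
ring.
Qed.

(** Compare coefficients of degree [4 p - 1] in [iso_expand]. On the left, [C^p]
    involves only powers of [x^p] and is monic of degree [3 p], so the
    coefficient is that of degree [p - 1] in [lam^h]. On the right only
    [j = p - 1] contributes, with leading coefficient [t^(p-1)]. *)
Lemma inert_hasse : hasse p h (cm_a K) (cm_b K) = hasse p h (cm_a K) (cm_b K) * t ^+ p.-1.
Proof.
have charP : p \in [pchar {poly K}] by rewrite pchar_poly.
have p0 : (0 < p)%N by rewrite p_odd.
transitivity (lam ^+ h * C ^+ p)`_(p * 4).-1.
  have [c2 [c1 [c0 ->]]] := C_expand.
  rewrite !(exprDp _ _ charP) ![(_%:P * _) ^+ p]exprMn -!polyC_exp -!exprM !mulrDr !coefD.
  have sl : size (lam ^+ h) = (3 * h).+1 by rewrite size_lam_exp.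
  have top c n : (n < 3)%N -> (lam ^+ h * (c%:P * 'X^(n * p)))`_(p * 4).-1 = 0.
    move=> hn; rewrite mulrCA coefCM coefMXn.
    case: ifP => [_|_]; first by rewrite mulr0.
    rewrite nth_default ?mulr0 // sl.
    by move: hn h_gt0; rewrite p_odd; nia.
  have := top (c2 ^+ p) 2%N isT; have := top (c1 ^+ p) 1%N isT; have := top (c0 ^+ p) 0%N isT.
  rewrite mul1n mul0n expr0 mulr1 => -> -> ->; rewrite !addr0 coefMXn.
  by rewrite /hasse ifF; [congr (_`_ _)|apply/negbTE]; rewrite p_odd; lia.
rewrite iso_expand coef_sum.
have hp : (p.-1 < (3 * h).+1)%N by rewrite p_odd /=; lia.
rewrite (bigD1 (Ordinal hp)) //= big1 => [|j nj]; last first.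
  by rewrite coefCM iso_term_coef ?mulr0 // -ltnS.
rewrite addr0 coefCM; congr (_ * _).
have -> : (2 * (3 * h - p.-1) = p.-1)%N by rewrite p_odd /=; lia.
rewrite BE exprMn -polyC_exp mulrCA coefCM.
have [C_monic sC] : C \is monic /\ size C = 4%N.
  have [c2 [c1 [c0 eC]]] := C_expand.
  have sC : size C = 4%N.
    rewrite eC size_polyDl size_polyXn // ltnS.
    apply: leq_trans (size_polyD _ _) _; rewrite geq_max size_scale_poly ?size_polyXn //=.
    apply: leq_trans (size_polyD _ _) _; rewrite geq_max size_scale_poly ?size_polyX //=.
    exact: leq_trans (size_polyC_leq1 _) _.
  split=> //; rewrite monicE /lead_coef sC eC.
  by rewrite !(coefD, coefCM, coefXn, coefX, coefC) /= !mulr0 !addr0.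
have k_monic : k \is monic by rewrite kE monicXsubC.
have m : A ^+ p.-1 * C * k ^+ p.-1 \is monic by rewrite !monicMl ?monic_exp.
rewrite (_ : (p * 4).-1 = (size (A ^+ p.-1 * C * k ^+ p.-1)).-1); last first.
  have sA : size A = 4%N by apply: size_isoA.
  have sk : size k = 2%N by rewrite kE size_XsubC.
  have nz (P : {poly K}) : P \is monic -> P != 0 by exact: monic_neq0.
  rewrite !size_mul ?mulf_neq0 ?expf_neq0 ?nz // !size_exp_poly ?nz // sA sk sC p_odd /=.
  by lia.
by rewrite -lead_coefE (monicP m) mulr1.
Qed.

End Inert.

(** * Clausen's identity *)

Lemma central_bin_rec k :
  (k%:Z + 1) * 'C(2 * k.+1, k.+1)%:Z = 2 * (2 * k%:Z + 1) * 'C(2 * k, k)%:Z.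
Proof.
have e1 : ((2 * k.+1) * 'C((2 * k).+1, k) = k.+1 * 'C(2 * k.+1, k.+1))%N.
  by rewrite (_ : 2 * k.+1 = (2 * k).+2)%N; [exact: mul_bin_diag|lia].
have e2 : ((2 * k).+1 * 'C(2 * k, k) = k.+1 * 'C((2 * k).+1, k.+1))%N.
  exact: mul_bin_diag.
have e3 : 'C((2 * k).+1, k) = 'C((2 * k).+1, k.+1).
  by rewrite -bin_sub; [congr ('C(_, _))|]; lia.
by move: e1 e2; rewrite e3; nia.
Qed.

Section Clausen.
Variable n : nat.
Let c : int := n%:Z * (n%:Z + 1).

(** Coefficients of the shifted Legendre polynomial. *)
Definition leg_coef k : int := (-1) ^+ k * ('C(n, k) * 'C(n + k, k))%:Z.

Lemma leg_coef_rec k :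
  (k%:Z + 1) ^+ 2 * leg_coef k.+1 = (k%:Z * (k%:Z + 1) - c) * leg_coef k.
Proof.
have e1 : (k%:Z + 1) * 'C(n, k.+1)%:Z = (n%:Z - k%:Z) * 'C(n, k)%:Z.
  have := mul_bin_left n k; have [le|lt] := leqP k n.
    by move/(congr1 Posz); rewrite !PoszM -subzn // -[k.+1%:Z]/((1 + k)%N%:Z) PoszD addrC.
  by move=> _; rewrite (bin_small lt) (bin_small (leqW lt)) !mulr0.
have e2 : (k%:Z + 1) * 'C(n + k.+1, k.+1)%:Z = (n%:Z + k%:Z + 1) * 'C(n + k, k)%:Z.
  have e : ((n + k).+1 * 'C(n + k, k) = k.+1 * 'C((n + k).+1, k.+1))%N := mul_bin_diag _ _.
  rewrite addnS; move/(congr1 Posz): e.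
  rewrite !PoszM -[k.+1%:Z]/((1 + k)%N%:Z) -[(n + k).+1%:Z]/((1 + (n + k))%N%:Z).
  by rewrite !PoszD [1 + k%:Z]addrC => <-; ring.
rewrite /leg_coef [(-1) ^+ k.+1]exprS !PoszM /c.
move: ((-1) ^+ k) => a.
transitivity (- a * ((k%:Z + 1) * 'C(n, k.+1)%:Z) * ((k%:Z + 1) * 'C(n + k.+1, k.+1)%:Z)).
  by ring.
by rewrite e1 e2; ring.
Qed.

Lemma leg_coef_large k : (n < k)%N -> leg_coef k = 0.
Proof. by move=> lt; rewrite /leg_coef bin_small // mul0n mulr0. Qed.

Variable N : nat.
Hypothesis nN : (n < N)%N.

Definition leg_poly : {poly int} := \poly_(k < N) leg_coef k.
Definition leg_sqr : {poly int} := \poly_(k < N) (leg_coef k * 'C(2 * k, k)%:Z).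

Let u : {poly int} := 'X - 'X^2.

Lemma coef_leg k : leg_poly`_k = leg_coef k.
Proof.
by rewrite coef_poly; case: ltnP => // le; rewrite leg_coef_large // (leq_trans nN).
Qed.

Lemma coef_leg_sqr k : leg_sqr`_k = leg_coef k * 'C(2 * k, k)%:Z.
Proof.
rewrite coef_poly; case: ltnP => // le.
by rewrite leg_coef_large ?mul0r // (leq_trans nN).
Qed.

Lemma coefXM_deriv (q : {poly int}) k : ('X * q^`())`_k = k%:Z * q`_k.
Proof.
rewrite coefXM; case: k => [|k] /=; first by rewrite mul0r.
by rewrite coef_deriv -mulr_natl natz.
Qed.

Lemma leg_ode : (u * leg_poly^`())^`() = - (c%:P * leg_poly).
Proof.
apply/polyP => k; rewrite coef_deriv coefN coefCM coef_leg.
have -> : u * leg_poly^`() = 'X * leg_poly^`() - 'X * ('X * leg_poly^`()) by rewrite /u; ring.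
rewrite coefB coefXM_deriv coefXM /= coefXM_deriv !coef_leg.
have := leg_coef_rec k; rewrite -[_ *+ k.+1]mulr_natl natz -(addn1 k) PoszD => e.
have -> : (k%:Z + 1) * ((k%:Z + 1) * leg_coef (k + 1) - k%:Z * leg_coef k) =
   (k%:Z + 1) ^+ 2 * leg_coef (k + 1) - (k%:Z + 1) * k%:Z * leg_coef k by ring.
by rewrite e; ring.
Qed.

Let derivC_nat m : (m%:R : {poly int})^`() = 0.
Proof. by rewrite -polyC_natr derivC. Qed.

Let du : u^`() = 1 - 2%:R * 'X.
Proof. by rewrite /u derivB derivX derivXn /= expr1 -mulr_natl. Qed.

(** The operator of order three, the symmetric square of Legendre's operator, that
    annihilates the products of two solutions of Legendre's equation. *)
Definition sym_square (w : {poly int}) :=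
  (u * (u * w^`())^`())^`() + 4%:R * c%:P * u * w^`() + 2%:R * c%:P * u^`() * w.

Lemma sym_square_sqr : sym_square (leg_poly ^+ 2) = 0.
Proof.
rewrite /sym_square; set y := leg_poly; pose z := u * y^`().
have dz : z^`() = - (c%:P * y) by exact: leg_ode.
have dw : (y ^+ 2)^`() = 2%:R * y * y^`() by rewrite expr2 derivM; ring.
have -> : u * (y ^+ 2)^`() = 2%:R * y * z by rewrite dw /z; ring.
rewrite {}dw; have ez : u * y^`() = z by []; clearbody z.
have -> : u * (2%:R * y * z)^`() = 2%:R * z ^+ 2 - 2%:R * c%:P * u * y ^+ 2.
  rewrite !derivM dz derivC_nat.
  by transitivity (2%:R * (u * y^`()) * z - 2%:R * c%:P * u * y ^+ 2); [|rewrite ez]; ring.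
have -> : 4%:R * c%:P * u * (2%:R * y * y^`()) = 8%:R * c%:P * y * (u * y^`()) by ring.
rewrite ez derivB !derivM dz derivC !derivC_nat.
transitivity (4%:R * c%:P * y * (z - u * y^`())); first by ring.
by rewrite ez subrr mulr0.
Qed.

Lemma sym_square_comp (G : {poly int}) (s := 'X * G^`()) :
  sym_square (G \Po u) = u^`() *
    ((('X * (s^`() - 4%:R * ('X * s^`()) - 2%:R * s))^`()
      + 4%:R * c%:P * s + 2%:R * c%:P * G) \Po u).
Proof.
pose J := 'X * (s^`() - 4%:R * ('X * s^`()) - 2%:R * s).
have num_comp k : k%:R \Po u = k%:R :> {poly int} by rewrite rmorph_nat.
have e1 : u * (G \Po u)^`() = (s \Po u) * u^`().
  by rewrite deriv_comp /s comp_polyM comp_polyX mulrA.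
clearbody s.
have e2 : u * (u * (G \Po u)^`())^`() = J \Po u.
  rewrite e1 derivM deriv_comp /J comp_polyM !comp_polyB !comp_polyM !num_comp !comp_polyX.
  have ddu : u^`()^`() = - 2%:R.
    by rewrite du derivB (derivC_nat 1) derivM derivC_nat derivX; ring.
  move: (s^`() \Po u) (s \Po u) => s1 s0.
  rewrite ddu du /u; ring.
rewrite /sym_square e2 deriv_comp -/J.
rewrite -mulrA e1 !comp_polyD !comp_polyM !num_comp comp_polyC.
ring.
Qed.

Lemma leg_sqr_ode (G := leg_sqr) (s := 'X * G^`()) :
  ('X * (s^`() - 4%:R * ('X * s^`()) - 2%:R * s))^`()
      + 4%:R * c%:P * s + 2%:R * c%:P * G = 0.
Proof.
apply/polyP => k; rewrite coef0.
have nat_coef (m : nat) (q : {poly int}) j : (m%:R * q)`_j = m%:R * q`_j.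
  by rewrite -polyC_natr coefCM.
have cc (m : nat) (q : {poly int}) j : (m%:R * c%:P * q)`_j = m%:R * c * q`_j.
  by rewrite -polyC_natr -polyCM coefCM.
rewrite !coefD coef_deriv coefXM /= !(coefB, cc, nat_coef) !coefXM_deriv.
rewrite coef_deriv !coefXM_deriv -[(_ - _) *+ k.+1]mulr_natl.
rewrite -[(_ * _) *+ k.+1]mulr_natl !natz /G !coef_leg_sqr.
have e1 := leg_coef_rec k; have e2 := central_bin_rec k.
rewrite -[k.+1%:Z]/((1 + k)%N%:Z) PoszD [1%:Z + _]addrC.
transitivity (((k%:Z + 1) ^+ 2 * leg_coef k.+1) * ((k%:Z + 1) * 'C(2 * k.+1, k.+1)%:Z)
   + (- ((k%:Z + 1) * (4 * k%:Z ^+ 2 + 2 * k%:Z)) + 4 * c * k%:Z + 2 * c) *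
     (leg_coef k * 'C(2 * k, k)%:Z)); first by ring.
by rewrite e1 e2; ring.
Qed.

(** On a lowest monomial [x^m] with [m > 0] the operator acts with the nonzero
    coefficient [m^3]. *)
Lemma sym_square_inj (w : {poly int}) : sym_square w = 0 -> w`_0 = 0 -> w = 0.
Proof.
move=> hw w0; apply/polyP => m; rewrite coef0.
suff : forall j, (j <= m)%N -> w`_j = 0 by exact.
elim: m => [|m IH] j; first by rewrite leqn0 => /eqP ->.
rewrite leq_eqVlt => /orP[/eqP ->|]; last by rewrite ltnS; exact: IH.
have [r er] : exists r : {poly int}, w = 'X^(m.+1) * r.
  exists (drop_poly m.+1 w); rewrite -[LHS](poly_take_drop m.+1) mulrC.
  rewrite (_ : take_poly m.+1 w = 0) ?add0r //.
  apply/polyP => i; rewrite coef_take_poly coef0; case: ifP => // hi; exact: IH.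
have dX (q : {poly int}) : ('X^(m.+1) * q)^`() = 'X^m * (m.+1%:R * q + 'X * q^`()) :> {poly int}.
  by rewrite derivM derivXn /= -mulr_natl exprS; ring.
pose q1 := m.+1%:R * r + 'X * r^`().
pose q2 := m.+1%:R * ((1 - 'X) * q1) + 'X * ((1 - 'X) * q1)^`().
pose q3 := m.+1%:R * ((1 - 'X) * q2) + 'X * ((1 - 'X) * q2)^`().
have : 'X^m * (q3 + 'X * (4%:R * c%:P * (1 - 'X) * q1 + 2%:R * c%:P * u^`() * r)) = 0.
  rewrite -hw /sym_square er !dX -/q1.
  have -> : u * ('X^m * q1) = 'X^(m.+1) * ((1 - 'X) * q1) by rewrite /u [_ ^+ m.+1]exprS; ring.
  rewrite dX -/q2.
  have -> : u * ('X^m * q2) = 'X^(m.+1) * ((1 - 'X) * q2) by rewrite /u [_ ^+ m.+1]exprS; ring.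
  by rewrite dX -/q3 [_ ^+ m.+1]exprS /u; ring.
move/eqP; rewrite mulf_eq0 expf_eq0 polyX_eq0 andbF /= => /eqP e.
have step (q q' : {poly int}) : (m.+1%:R * q + 'X * q').[0] = m.+1%:R * q.[0].
  by rewrite -polyC_natr hornerD !hornerM hornerC hornerX mul0r addr0.
have step1 (q : {poly int}) : ((1 - 'X) * q).[0] = q.[0].
  by rewrite hornerM hornerD hornerN hornerX oppr0 addr0 -polyC1 hornerC mul1r.
have := congr1 (fun q : {poly int} => q.[0]) e.
rewrite /q3 /q2 /q1 hornerD [('X * _).[0]]hornerM hornerX mul0r addr0 horner0.
do 3!rewrite step ?step1.
have M0 : m.+1%:R != 0 :> int by rewrite pnatr_eq0.
move/eqP; rewrite !mulf_eq0 (negPf M0) /= => /eqP r0.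
by rewrite er coefXnM ltnn subnn -horner_coef0.
Qed.

(** Both sides are annihilated by [sym_square] and have constant term 1. *)
Theorem clausen : leg_poly ^+ 2 = leg_sqr \Po u.
Proof.
apply/eqP; rewrite -subr_eq0; apply/eqP/sym_square_inj.
  have lin w1 w2 : sym_square (w1 - w2) = sym_square w1 - sym_square w2.
    by rewrite /sym_square !(derivB, mulrBr); ring.
  by rewrite lin sym_square_sqr sym_square_comp leg_sqr_ode comp_poly0 mulr0 subrr.
rewrite coefB expr2 coef0M -[(_ \Po _)`_0]horner_coef0 horner_comp.
have -> : u.[0] = 0 by rewrite /u hornerD hornerN hornerXn hornerX expr0n subr0.
rewrite horner_coef0.
by rewrite coef_leg coef_leg_sqr /leg_coef expr0 muln0 !bin0 subrr.
Qed.

End Clausen.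

(** * Clausen's identity truncated modulo the square of a prime *)

Section TruncatedClausen.
Variable p : nat.
Hypothesis p_gt0 : (0 < p)%N.

Section Def.
Variable A : comNzRingType.
(** This is [(p-1)!^2] times [C(a, k) C(a+k, k) (-1)^k]; the factor replaces the
    division by [k!^2] for [k < p], so that the expression makes sense in any
    commutative ring. *)
Definition wcoef (a : A) k : A :=
  ((p.-1) ^_ (p.-1 - k))%:R ^+ 2 * \prod_(i < k) ((a - i%:R) * (-1 - a - i%:R)).
Definition wpoly (a : A) : {poly A} := \sum_(k < p) wcoef a k *: 'X^k.
Definition wsqr (a u : A) : A :=
  ((p.-1)`!)%:R ^+ 2 * \sum_(k < p) wcoef a k * ('C(2 * k, k))%:R * u ^+ k.
End Def.

(** The failure of Clausen's identity for the sums truncated at [k < p]. *)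
Definition defect (A : comNzRingType) (a : A) : {poly A} :=
  wsqr a%:P ('X - 'X^2) - wpoly a ^+ 2.

Lemma wcoef_morph (A B : comNzRingType) (g : {rmorphism A -> B}) a k :
  g (wcoef a k) = wcoef (g a) k.
Proof.
rewrite /wcoef (rmorphM g) (rmorphXn g) rmorph_nat (rmorph_prod g); congr (_ * _).
by apply: eq_bigr => i _; rewrite (rmorphM g) !rmorphB rmorphN1 rmorph_nat.
Qed.

Lemma wsqr_morph (A B : comNzRingType) (g : {rmorphism A -> B}) a u :
  g (wsqr a u) = wsqr (g a) (g u).
Proof.
rewrite /wsqr (rmorphM g) (rmorphXn g) rmorph_nat (rmorph_sum g); congr (_ * _).
apply: eq_bigr => i _.
by rewrite (rmorphM g _ (u ^+ i)) (rmorphM g _ _%:R) wcoef_morph rmorph_nat (rmorphXn g).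
Qed.

Lemma wpoly_morph (A B : comNzRingType) (g : {rmorphism A -> B}) a :
  map_poly g (wpoly a) = wpoly (g a).
Proof.
rewrite /wpoly rmorph_sum; apply: eq_bigr => i _ /=.
by rewrite map_polyZ map_polyXn /= wcoef_morph.
Qed.

Lemma defect_morph (A B : comNzRingType) (g : {rmorphism A -> B}) a :
  map_poly g (defect a) = defect (g a).
Proof.
rewrite /defect rmorphB rmorphXn /= wpoly_morph (wsqr_morph (map_poly g)) /=.
by rewrite map_polyC rmorphB /= map_polyX map_polyXn.
Qed.

Lemma wcoef_sym (A : comNzRingType) (a : A) k : wcoef (-1 - a) k = wcoef a k.
Proof.
rewrite /wcoef; congr (_ * _); apply: eq_bigr => i _; ring.
Qed.

Lemma defect_sym (A : comNzRingType) (a : A) : defect (-1 - a) = defect a.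
Proof.
rewrite /defect /wsqr /wpoly; congr (_ * _ - _ ^+ 2).
  apply: eq_bigr => k _; congr (_ * _ * _).
  by rewrite polyCB polyCN polyC1 wcoef_sym.
by apply: eq_bigr => k _; rewrite wcoef_sym.
Qed.

Lemma prod_ffact n k : \prod_(i < k) (n%:Z - i%:Z) = (n ^_ k)%:Z.
Proof.
elim: k => [|k IH]; first by rewrite big_ord0 ffactn0.
rewrite big_ord_recr /= IH ffactnSr PoszM.
have [le|lt] := leqP k n; first by rewrite subzn.
by rewrite ffact_small // !mul0r.
Qed.

Lemma prod_rising n k : \prod_(i < k) (-1 - n%:Z - i%:Z) = (-1) ^+ k * ((n + k) ^_ k)%:Z.
Proof.
elim: k => [|k IH]; first by rewrite big_ord0 ffactn0 expr0.
rewrite big_ord_recr /= IH addnS ffactSS PoszM [(-1) ^+ k.+1]exprS.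
by rewrite -[(n + k).+1]addn1 !PoszD; ring.
Qed.

Lemma wcoef_nat n k : (n < p)%N -> (k < p)%N ->
  wcoef n%:Z k = (p.-1)`!%:Z ^+ 2 * leg_coef n k.
Proof.
move=> hn hk; rewrite /wcoef.
rewrite (eq_bigr (fun i : 'I_k => (n%:Z - i%:Z) * (-1 - n%:Z - i%:Z))); last first.
  by move=> i _; rewrite natz.
rewrite big_split /= prod_ffact prod_rising -(bin_ffact n k) -(bin_ffact (n + k) k) /leg_coef natz.
have e : ((p.-1) ^_ (p.-1 - k) * k`! = (p.-1)`!)%N.
  have hk' : (k <= p.-1)%N by rewrite -ltnS prednK.
  by rewrite -(@ffact_fact p.-1 (p.-1 - k)) ?leq_subr // subKn.
by rewrite -e !PoszM; ring.
Qed.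

Lemma defect_nat n : (n < p)%N -> defect n%:Z = 0.
Proof.
move=> hn; set F : {poly int} := ((p.-1)`!)%:R.
have FE : F = ((p.-1)`!%:Z)%:P by rewrite /F -polyC_natr natz.
have e1 : wpoly n%:Z = F ^+ 2 * leg_poly n p.
  rewrite /wpoly /leg_poly poly_def mulr_sumr; apply: eq_bigr => k _.
  by rewrite wcoef_nat // FE -polyC_exp mul_polyC scalerA.
have e2 : wsqr (n%:Z)%:P ('X - 'X^2) = F ^+ 4 * (leg_sqr n p \Po ('X - 'X^2)).
  rewrite /wsqr -/F /leg_sqr poly_def rmorph_sum /= !mulr_sumr.
  apply: eq_bigr => k _; rewrite -wcoef_morph wcoef_nat // comp_polyZ.
  rewrite rmorphXn /= comp_polyX -!mul_polyC !polyCM polyC_exp -FE.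
  by rewrite -[('C(_, _)%:Z)]natz polyC_natr; ring.
by rewrite /defect e1 e2 -clausen //; ring.
Qed.

(** As a polynomial in [a], the defect vanishes at [n] by [clausen] and at
    [n - p = -1 - (p - 1 - n)] by symmetry; both differences [a - n] and
    [a - n + p] are multiples of [p]. *)
Lemma defect_dvd (a : int) n m : (n < p)%N -> (p%:Z %| a - n%:Z)%Z ->
  (p%:Z ^+ 2 %| (defect a)`_m)%Z.
Proof.
move=> hn ha.
pose E : {poly int} := (defect ('X : {poly int}))`_m.
have EE (b : int) : E.[b] = (defect b)`_m.
  have -> : defect b = map_poly (horner_eval b) (defect ('X : {poly int})).
    by rewrite defect_morph /= /horner_eval hornerX.
  by rewrite coef_map.
(* Divide successively by the two linear factors in [a]. *)
have [q eq] : exists q, E = q * ('X - (n%:Z)%:P).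
  by apply/factor_theorem; rewrite /root EE defect_nat // coef0.
have [r er] : exists r, q = r * ('X - (n%:Z - p%:Z)%:P).
  apply/factor_theorem; rewrite /root.
  have : E.[n%:Z - p%:Z] == 0.
    have -> : n%:Z - p%:Z = -1 - (p.-1 - n)%:Z.
      by clear -hn; lia.
    rewrite EE defect_sym defect_nat ?coef0 //.
    by rewrite (leq_ltn_trans (leq_subr _ _)) ?prednK.
  rewrite eq !hornerE mulf_eq0 => /orP[] //.
  by rewrite addrAC subrr sub0r oppr_eq0 eqz_nat (gtn_eqF p_gt0).
rewrite -EE eq er !hornerE expr2; apply: dvdz_mul; last by [].
apply: dvdz_mull; have -> : a - (n%:Z - p%:Z) = (a - n%:Z) + p%:Z by ring.
by rewrite rpredD.
Qed.

End TruncatedClausen.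

(** * Divisibility by the square of a prime *)

Section Square.
Variables (p : nat) (K : fieldType).
Hypothesis charK : p \in [pchar K].
Let p_gt0 : (0 < p)%N := prime_gt0 (pcharf_prime charK).

Lemma intf_eq0 (z : int) : (z%:~R == 0 :> K) = (p%:Z %| z)%Z.
Proof.
rewrite dvdzE absz_nat; case: z => n; first by rewrite -pmulrn -(dvdn_pcharf charK).
by rewrite NegzE mulrNz oppr_eq0 -pmulrn -(dvdn_pcharf charK) abszN absz_nat.
Qed.

(** The ideal of the two points where [X - X^2] takes the value [u]. *)
Definition quad (u : int) : {poly int} := 'X^2 - 'X + u%:P.

Let quad_division u (P : {poly int}) :
  exists Q r0 r1, P = quad u * Q + (r0%:P + r1%:P * 'X).
Proof.
elim/poly_ind: P => [|P c [Q [r0 [r1 ->]]]].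
  by exists 0, 0, 0; rewrite !mulr0 !polyC0 mul0r !addr0.
exists (Q * 'X + r1%:P), (c - r1 * u), (r0 + r1).
by rewrite /quad polyCB polyCM polyCD; ring.
Qed.

Let size_quad u : size (quad u) = 3%N.
Proof.
rewrite /quad -addrA size_polyDl size_polyXn // ltnS.
apply: leq_trans (size_polyD _ _) _; rewrite size_polyN size_polyX geq_max /=.
exact: leq_trans (size_polyC_leq1 _) _.
Qed.

Let quad_remainder u (Q : {poly int}) (c0 c1 : int) :
  quad u * Q = c0%:P + c1%:P * 'X -> c0 = 0.
Proof.
move=> e; have [Q0|nQ] := eqVneq Q 0.
  have := congr1 (coefp 0) e.
  by rewrite /= Q0 mulr0 coef0 coefD coefC coefCM coefX mulr0 addr0.
have q0 : quad u != 0 by rewrite -size_poly_gt0 size_quad.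
have : (size (quad u * Q)%R <= 2)%N.
  rewrite e; apply: leq_trans (size_polyD _ _) _; rewrite geq_max.
  rewrite (leq_trans (size_polyC_leq1 _)) //= mul_polyC.
  by apply: leq_trans (size_scale_leq _ _) _; rewrite size_polyX.
rewrite size_mul // size_quad.
have : (0 < size Q)%N by rewrite size_poly_gt0.
by case: (size Q).
Qed.

Lemma wsqr_quad (a u : int) : exists Q,
  wsqr p a%:P ('X - 'X^2) = (wsqr p a u)%:P + quad u * Q.
Proof.
have eu : 'X - 'X^2 = u%:P - quad u by rewrite /quad; ring.
have step k : exists Q, ('X - 'X^2) ^+ k = u%:P ^+ k + quad u * Q.
  exists (- \sum_(i < k) ('X - 'X^2) ^+ (k.-1 - i) * u%:P ^+ i).
  have := subrXX ('X - 'X^2) u%:P k; rewrite {2}eu addrAC subrr sub0r.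
  by move/(canRL (subrK _)) ->; rewrite mulNr mulrN addrC.
pose c k : int := wcoef p a k * ('C(2 * k, k))%:R.
suff [Q hQ] : exists Q, \sum_(k < p) (c k)%:P * ('X - 'X^2) ^+ k =
    (\sum_(k < p) c k * u ^+ k)%:P + quad u * Q.
  exists (((p.-1)`!)%:R ^+ 2 * Q); rewrite /wsqr.
  rewrite (eq_bigr (fun k : 'I_p => (c k)%:P * ('X - 'X^2) ^+ k)); last first.
    by move=> k _; rewrite /c polyCM polyC_natr (wcoef_morph p polyC).
  by rewrite hQ polyCM polyC_exp polyC_natr; ring.
elim: (p) => [|N [Q IH]]; first by exists 0; rewrite !big_ord0 mulr0 addr0 polyC0.
have [Q' e'] := step N; exists (Q + (c N)%:P * Q').
by rewrite !big_ord_recr /= IH e' polyCD (polyCM (c N)) polyC_exp; ring.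
Qed.

(** Modulo [quad u], [wpoly] is a polynomial [r] of degree at most one. Modulo [p]
    it vanishes at two distinct points, so [p] divides [r] and [p^2] divides
    [r^2]; by [defect_dvd], [r^2] is congruent to the constant [wsqr p a u]
    modulo [p^2] and [quad u]. *)
Theorem wsqr_dvd (a u : int) (n : nat) (xi1 xi2 : K) : (n < p)%N ->
  (p%:Z %| a - n%:Z)%Z -> xi1 != xi2 -> xi1 + xi2 = 1 -> xi1 * xi2 = u%:~R ->
  (wpoly p a%:~R).[xi1] = 0 -> (wpoly p a%:~R).[xi2] = 0 ->
  (p%:Z ^+ 2 %| wsqr p a u)%Z.
Proof.
move=> hn ha nx s1 s2 z1 z2.
have [Q [r0 [r1 eP]]] := quad_division u (wpoly p a).
have root (xi : K) : xi ^+ 2 - xi + u%:~R = 0 -> (wpoly p a%:~R).[xi] = 0 ->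
    r0%:~R + r1%:~R * xi = 0.
  move=> hq hz.
  pose ev (P : {poly int}) : K := (map_poly intr P).[xi].
  have evD P R : ev (P + R) = ev P + ev R by rewrite /ev rmorphD hornerD.
  have evN P : ev (- P) = - ev P by rewrite /ev rmorphN hornerN.
  have evM P R : ev (P * R) = ev P * ev R by rewrite /ev rmorphM hornerM.
  have evX : ev 'X = xi by rewrite /ev map_polyX hornerX.
  have evC c : ev c%:P = c%:~R by rewrite /ev map_polyC hornerC.
  have := congr1 ev eP; rewrite {1}/ev wpoly_morph hz /quad.
  by rewrite !(evD, evN, evM, evX, evC) hq mul0r add0r => <-.
have q1 : xi1 ^+ 2 - xi1 + u%:~R = 0 by rewrite -s2 -[X in _ - X + _]mulr1 -s1; ring.
have q2 : xi2 ^+ 2 - xi2 + u%:~R = 0 by rewrite -s2 -[X in _ - X + _]mulr1 -s1; ring.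
have {}q1 := root _ q1 z1; have {}q2 := root _ q2 z2.
have r10 : r1%:~R = 0 :> K.
  have nx' : xi1 - xi2 != 0 by rewrite subr_eq0.
  apply: (mulIf nx'); rewrite mul0r.
  transitivity ((r0%:~R + r1%:~R * xi1) - (r0%:~R + r1%:~R * xi2)); first by ring.
  by rewrite q1 q2 subrr.
have r00 : r0%:~R = 0 :> K by move: q1; rewrite r10 mul0r addr0.
have [t1 e1] : exists t, r1 = t * p%:Z by apply/dvdzP; rewrite -intf_eq0 r10.
have [t0 e0] : exists t, r0 = t * p%:Z by apply/dvdzP; rewrite -intf_eq0 r00.
have [Psi eD] : exists Psi, defect p a = (p%:Z ^+ 2)%:P * Psi.
  exists (map_poly (fun z => (z %/ p%:Z ^+ 2)%Z) (defect p a)).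
  apply/polyP => m; rewrite coefCM coef_map_id0 ?div0z // mulrC divzK //.
  exact: defect_dvd hn ha.
have [Q' [v0 [v1 ePsi]]] := quad_division u Psi.
have [Q'' eW] := wsqr_quad a u.
have key : quad u * (Q'' - Q * (quad u * Q + 2%:R * (r0%:P + r1%:P * 'X)) - (r1 ^+ 2)%:P - (p%:Z ^+ 2)%:P * Q') =
    (p%:Z ^+ 2 * v0 - wsqr p a u + r0 ^+ 2 - r1 ^+ 2 * u)%:P
     + (p%:Z ^+ 2 * v1 + 2%:R * r0 * r1 + r1 ^+ 2)%:P * 'X.
  move: eD; rewrite /defect eW eP ePsi => /eqP; rewrite -subr_eq0 => /eqP eD.
  apply/eqP; rewrite -subr_eq0 -eD; apply/eqP.
  move: (wsqr p a u) (p%:Z ^+ 2) => W P2.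
  rewrite /quad !(polyCD, polyCB, polyCM, polyC_exp, polyC_natr).
  ring.
have := quad_remainder key; rewrite e0 e1 => /eqP.
have -> : p%:Z ^+ 2 * v0 - wsqr p a u + (t0 * p%:Z) ^+ 2 - (t1 * p%:Z) ^+ 2 * u =
   p%:Z ^+ 2 * (v0 + t0 ^+ 2 - t1 ^+ 2 * u) - wsqr p a u by ring.
by rewrite subr_eq0 => /eqP <-; exact: dvdz_mulr.
Qed.

End Square.

(** * Binomial sums as coefficients of a power of a cubic *)

Definition sextic k := ('C(3 * k, k) * 'C(6 * k, 3 * k))%N.

Lemma sextic_fact k :
  (sextic k * (k`! * (2 * k)`! * (3 * k)`!) = (6 * k)`!)%N.
Proof.
have e1 : ('C(3 * k, k) * (k`! * (2 * k)`!) = (3 * k)`!)%N.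
  have le : (k <= 3 * k)%N by lia.
  by rewrite -(bin_fact le) (_ : 3 * k - k = 2 * k)%N //; lia.
have e2 : ('C(6 * k, 3 * k) * ((3 * k)`! * (3 * k)`!) = (6 * k)`!)%N.
  have le : (3 * k <= 6 * k)%N by lia.
  by rewrite -(bin_fact le) (_ : 6 * k - 3 * k = 3 * k)%N //; lia.
rewrite -e2 -{3}e1 /sextic; ring.
Qed.

Lemma fact6_rec k : ((6 * k)`! * k`! =
  12 ^ k * (\prod_(i < k) ((6 * i + 1) * (6 * i + 5))) * ((2 * k)`! * (3 * k)`!))%N.
Proof.
elim: k => [|k IH]; first by rewrite big_ord0.
rewrite big_ord_recr /= expnS.
have -> : (6 * k.+1 = (6 * k).+4.+2)%N by lia.
have -> : (3 * k.+1 = (3 * k).+3)%N by lia.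
have -> : (2 * k.+1 = (2 * k).+2)%N by lia.
rewrite !factS.
transitivity ((6 * k).+4.+2 * (6 * k).+4.+1 * (6 * k).+4 * (6 * k).+3 * (6 * k).+2 * (6 * k).+1 * k.+1 *
   ((6 * k)`! * k`!))%N; first by ring.
by rewrite IH; ring.
Qed.

Lemma sextic_prod k : (k`! ^ 2 * sextic k =
  12 ^ k * \prod_(i < k) ((6 * i + 1) * (6 * i + 5)))%N.
Proof.
have pos : (0 < (2 * k)`! * (3 * k)`!)%N by rewrite muln_gt0 !fact_gt0.
apply/eqP; rewrite -(eqn_pmul2r pos) -fact6_rec -sextic_fact; apply/eqP; ring.
Qed.

Section Ring.
Variables (A : comNzRingType) (p : nat) (a : A).
Hypothesis p_gt0 : (0 < p)%N.
Hypothesis ha : 6%:R * a = -1.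

(** For [a = -1/6] one has [36 (a - i) (-1 - a - i) = (6 i + 1) (6 i + 5)]. *)
Lemma wcoef_sextic k : (k < p)%N ->
  432%:R ^+ k * wcoef p a k = (p.-1)`!%:R ^+ 2 * (sextic k)%:R.
Proof.
move=> hk; rewrite /wcoef.
have e : ((p.-1) ^_ (p.-1 - k) * k`! = (p.-1)`!)%N.
  have hk' : (k <= p.-1)%N by rewrite -ltnS prednK.
  by rewrite -(@ffact_fact p.-1 (p.-1 - k)) ?leq_subr // subKn.
have e36 : 36%:R ^+ k * \prod_(i < k) ((a - i%:R) * (-1 - a - i%:R)) =
   (\prod_(i < k) ((6 * i + 1) * (6 * i + 5)))%:R.
  have -> : 36%:R ^+ k = \prod_(i < k) (36%:R : A) by rewrite prodr_const card_ord.
  rewrite natr_prod -big_split /=; apply: eq_bigr => i _.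
  rewrite natrM (natrD _ (6 * i) 1) (natrD _ (6 * i) 5) !(natrM _ 6 i).
  transitivity ((6%:R * a - 6%:R * i%:R) * (- 6%:R - 6%:R * a - 6%:R * i%:R)); first by ring.
  by rewrite ha; ring.
rewrite (_ : 432%:R = 12%:R * 36%:R :> A) ?exprMn; last by rewrite -natrM.
transitivity ((p.-1 ^_ (p.-1 - k))%:R ^+ 2 * (12%:R ^+ k * (36%:R ^+ k *
   \prod_(i < k) ((a - i%:R) * (-1 - a - i%:R)))) : A); first by ring.
rewrite e36 -(natrX A 12) -(natrM A (12 ^ k)) -sextic_prod -e.
by rewrite (natrM A (k`! ^ 2)) (natrX A k`!) (natrM A (_ ^_ _)); ring.
Qed.

Definition sextic_sum (s : A) : A := \sum_(k < p) (sextic k)%:R * s ^+ k.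

Lemma wpoly_sextic s : (wpoly p a).[432%:R * s] = (p.-1)`!%:R ^+ 2 * sextic_sum s.
Proof.
rewrite /wpoly /sextic_sum horner_sum mulr_sumr; apply: eq_bigr => k _.
rewrite hornerZ hornerXn exprMn mulrA -wcoef_sextic //; ring.
Qed.

(** The sum of [C(2k,k) sextic k / D^k], multiplied by [D^(p-1)] to be free of
    denominators. *)
Definition scaled_sum (D : A) : A :=
  \sum_(k < p) ('C(2 * k, k) * sextic k)%:R * D ^+ (p.-1 - k).

Lemma wsqr_sextic D e : D * e = 1 ->
  D ^+ p.-1 * wsqr p a (432%:R * e) = (p.-1)`!%:R ^+ 4 * scaled_sum D.
Proof.
move=> hDe; rewrite /wsqr /scaled_sum mulrCA !mulr_sumr; apply: eq_bigr => k _.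
have hk' : (k <= p.-1)%N by rewrite -ltnS prednK.
have eD : D ^+ p.-1 = D ^+ (p.-1 - k) * D ^+ k by rewrite -exprD subnK.
rewrite eD exprMn natrM.
transitivity ((p.-1)`!%:R ^+ 2 * (432%:R ^+ k * wcoef p a k) * 'C(2 * k, k)%:R *
   D ^+ (p.-1 - k) * (D * e) ^+ k : A); first by rewrite exprMn; ring.
by rewrite hDe expr1n wcoef_sextic //; ring.
Qed.
End Ring.

Lemma coef_affine_exp (K : comNzRingType) (u v : K) n j :
  ((u%:P * 'X + v%:P) ^+ n)`_j = u ^+ j * v ^+ (n - j) *+ 'C(n, j).
Proof.
rewrite addrC exprDn coef_sum.
transitivity (\sum_(i < n.+1) (v ^+ (n - i) * u ^+ i *+ 'C(n, i)) * (j == i :> nat)%:R).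
  apply: eq_bigr => i _; rewrite coefMn exprMn -!polyC_exp mulrA -polyCM coefCM coefXn.
  by rewrite mulrnAl.
have [le|lt] := leqP j n; last first.
  rewrite bin_small // mulr0n big1 // => i _.
  by rewrite (gtn_eqF (leq_ltn_trans _ lt)) ?mulr0 // -ltnS.
have hj : (j < n.+1)%N by rewrite ltnS.
rewrite (bigD1 (Ordinal hj)) //= eqxx mulr1 big1 ?addr0 ?[v ^+ _ * _]mulrC // => i ni.
by rewrite -val_eqE /= eq_sym in ni; rewrite (negPf ni) mulr0.
Qed.

Lemma ffactn_add n k m : (n ^_ (k + m) = n ^_ k * (n - k) ^_ m)%N.
Proof.
elim: m => [|m IH]; first by rewrite addn0 ffactn0 muln1.
by rewrite addnS !ffactnSr IH subnDA mulnA.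
Qed.

Section Hasse.
Variables (K : fieldType) (p h : nat).
Hypothesis charK : p \in [pchar K].
Hypothesis p_odd : p = h.*2.+1.
Hypotheses (p3 : p != 3%N).
Let p_prime : prime p := pcharf_prime charK.

(** In [K] the integer [h] is [-1/2]. *)
Let fact_ffact n : (2 * n)`!%:R = (- 4%:R) ^+ n * n`!%:R * (h ^_ n)%:R :> K.
Proof.
elim: n => [|n IH]; first by rewrite muln0 fact0 ffactn0 expr0 !mulr1.
rewrite (_ : 2 * n.+1 = (2 * n).+2)%N; last by lia.
rewrite !factS ffactnSr !natrM [(- 4%:R) ^+ n.+1]exprS IH.
have [le|lt] := leqP n h; last by rewrite ffact_small // !(mul0r, mulr0).
rewrite natrB //.
have e : (h.*2.+1)%:R = 0 :> K by rewrite -p_odd (pcharf0 charK).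
have {}e : 2%:R * h%:R = -1 :> K.
  by apply/eqP; rewrite -addr_eq0 -natrM natr1 mul2n; apply/eqP.
have e1 : (2 * n).+1%:R = 1 + 2%:R * n%:R :> K by rewrite -natrM nat1r.
have e2 : n.+1%:R = 1 + n%:R :> K by rewrite nat1r.
have e3 : (2 * n).+2%:R = 2%:R * (1 + n%:R) :> K.
  by rewrite -e2 -natrM mulnS.
rewrite e1 e2 e3.
move: (n`!%:R : K) ((- 4%:R) ^+ n) ((h ^_ n)%:R : K) => F Q G.
transitivity ((2%:R + 2%:R * n%:R) * (- (2%:R * h%:R) + 2%:R * n%:R) * (Q * F * G)); last by ring.
by rewrite e; ring.
Qed.

(** One of the factors [6 i + 1], [6 i + 5] of [sextic_prod] is equal to [p] for
    [i = p / 6], which is less than [k]. *)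
Lemma sextic_vanish k : (k < p)%N -> (h < 3 * k)%N -> (sextic k)%:R = 0 :> K.
Proof.
move=> hk h3.
have p2 : p != 2%N by rewrite p_odd; case: (h) => // -[|].
have p_gt3 : (3 < p)%N.
  by have := prime_gt1 p_prime; case: (p) p2 p3 => [|[|[|[|]]]].
pose i := (p %/ 6)%N.
have hi : p = (6 * i + 1)%N \/ p = (6 * i + 5)%N.
  have e := divn_eq p 6; rewrite mulnC -/i in e.
  have : (p %% 6 < 6)%N by rewrite ltn_mod.
  have n2 : ~~ (2 %| p)%N by rewrite dvdn_prime2 // eq_sym.
  have n3 : ~~ (3 %| p)%N by rewrite dvdn_prime2 // eq_sym.
  case: (p %% 6)%N e => [|[|[|[|[|[|]]]]]] // e _; [|by left| | | |by right].
  - by case/negP: n2; rewrite e; apply/dvdnP; exists (3 * i)%N; lia.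
  - by case/negP: n2; rewrite e; apply/dvdnP; exists (3 * i + 1)%N; lia.
  - by case/negP: n3; rewrite e; apply/dvdnP; exists (2 * i + 1)%N; lia.
  - by case/negP: n2; rewrite e; apply/dvdnP; exists (3 * i + 2)%N; lia.
have ik : (i < k)%N by case: hi => hi; move: p_odd h3; rewrite hi; lia.
have kf : (k`!%:R : K) ^+ 2 != 0 by rewrite expf_neq0 ?(factf_neq0 charK).
apply: (mulfI kf); rewrite mulr0 -natrX -natrM sextic_prod.
apply/eqP; rewrite (natf_eq0 charK) (bigD1 (Ordinal ik)) //=.
apply: dvdn_mull; apply: dvdn_mulr; rewrite /=.
by case: hi => e; rewrite -e; [apply: dvdn_mulr | apply: dvdn_mull].
Qed.

Let sextic_small k : (3 * k <= h)%N ->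
  (sextic k)%:R = (- 64%:R) ^+ k * ('C(h, k) * 'C(h - k, 2 * k))%:R :> K.
Proof.
move=> hk.
have hp : (h < p)%N by rewrite p_odd; lia.
have e : ('C(h, k) * 'C(h - k, 2 * k) * (k`! * (2 * k)`!) = h ^_ (3 * k))%N.
  rewrite mulnACA !bin_ffact -ffactn_add; congr (_ ^_ _); lia.
have nz : ((k`! * (2 * k)`! * (3 * k)`!)%:R : K) != 0.
  by rewrite !natrM !mulf_neq0 ?(factf_neq0 charK) //; lia.
apply: (mulIf nz); rewrite -natrM sextic_fact.
rewrite (_ : 6 * k = 2 * (3 * k))%N ?fact_ffact; last by lia.
rewrite -e exprM (_ : (- 4%:R) ^+ 3 = - 64%:R :> K); last by ring.
move: (_ ^+ k) => Q; ring.
Qed.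

Variable s : K.
Let q : K := 4%:R^-1.
(** A form of the curve in which the Hasse invariant has the coefficients
    [sextic]. *)
Definition hasse_cubic : {poly K} := 'X^3 + q%:P * 'X^2 - s%:P.

Lemma coef_hasse_cubic : (hasse_cubic ^+ h)`_(2 * h) =
  \sum_(l < h.+1) q ^+ (h - 3 * l) * ('C(h, l) * 'C(h - l, 2 * l))%:R * (- s) ^+ l.
Proof.
have -> : hasse_cubic = (1%:P * 'X + q%:P) * 'X^2 + (- s)%:P.
  by rewrite /hasse_cubic polyCN polyC1; ring.
rewrite exprDn coef_sum; apply: eq_bigr => l _.
have hl : (l <= h)%N by rewrite -ltnS.
rewrite coefMn exprMn -polyC_exp coefMC -exprM coefMXn ltnNge (_ : 2 * (h - l) <= 2 * h)%N; last by lia.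
rewrite /= coef_affine_exp (_ : 2 * h - 2 * (h - l) = 2 * l)%N; last by lia.
rewrite expr1n mul1r (_ : h - l - 2 * l = h - 3 * l)%N; last by lia.
by rewrite -(mulr_natr _ 'C(h - l, 2 * l)) -(mulr_natr _ 'C(h, l)) natrM; ring.
Qed.

Lemma hasse_cubic_sextic : 4%:R ^+ h * (hasse_cubic ^+ h)`_(2 * h) = sextic_sum p s.
Proof.
have two : (2%:R : K) != 0.
  rewrite (natf_eq0 charK) dvdn_prime2 //; apply/negP => /eqP e.
  by move: p_odd; rewrite e; case: (h) => // -[|].
have four : (4%:R : K) != 0 by rewrite (_ : 4 = 2 * 2)%N // natrM mulf_neq0.
rewrite coef_hasse_cubic mulr_sumr /sextic_sum.
have hp : (h.+1 <= p)%N by rewrite p_odd; lia.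
rewrite -(big_mkord xpredT (fun k => (sextic k)%:R * s ^+ k)).
rewrite (@big_cat_nat _ _ _ h.+1) //= [X in _ + X]big1_seq ?addr0; last first.
  move=> k /andP[_]; rewrite mem_index_iota => /andP[k1 k2].
  by rewrite sextic_vanish ?mul0r //; lia.
rewrite big_mkord; apply: eq_bigr => l _.
have [le|lt] := leqP (3 * l) h; last first.
  rewrite sextic_vanish //; last by apply: leq_trans hp.
  rewrite mul0r (_ : 'C(h - l, 2 * l) = 0%N).
    by rewrite muln0 mulr0n mulr0 mul0r mulr0.
  by rewrite bin_small //; move: (ltn_ord l) lt; lia.
rewrite sextic_small // -{1}(subnK le) exprD.
move: (('C(h, l) * 'C(h - l, 2 * l))%:R : K) => c.
have -> : (- 64%:R) ^+ l = 4%:R ^+ (3 * l) * (-1) ^+ l :> K.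
  by rewrite exprM -exprMn; congr (_ ^+ _); ring.
have -> : (- s) ^+ l = (-1) ^+ l * s ^+ l by rewrite -exprMn mulN1r.
have e : 4%:R ^+ (h - 3 * l) * q ^+ (h - 3 * l) = 1 by rewrite -exprMn divff // expr1n.
transitivity ((4%:R ^+ (h - 3 * l) * q ^+ (h - 3 * l)) * (4%:R ^+ (3 * l) * (-1) ^+ l * c * s ^+ l)).
  by ring.
by rewrite e; ring.
Qed.
End Hasse.

(** * The Hasse invariant as a binomial sum *)

Section Reciprocity.
Variables (K : closedFieldType) (p h : nat).
Hypothesis charK : p \in [pchar K].
Hypothesis p_odd : p = h.*2.+1.
Let p_prime : prime p := pcharf_prime charK.

Lemma bin_pred_vanish i : (p <= i)%N -> (i < (2 * p).-1)%N -> ('C(i, p.-1)%:R : K) = 0.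
Proof.
move=> pi i2; apply/eqP; rewrite (natf_eq0 charK).
have p0 := prime_gt0 p_prime.
have le : (p.-1 <= i)%N by lia.
have /esym e := bin_fact le.
have hd : (p %| i`!)%N by rewrite dvdn_fact // p0.
have nd n : (n < p)%N -> (p %| n`!)%N = false.
  by move=> hn; apply/negbTE; rewrite -(natf_eq0 charK) (factf_neq0 charK).
move: hd; rewrite e !Euclid_dvdM // !nd ?orbF //; lia.
Qed.

(** The binomial coefficients [C(i, p-1)] vanish in [K] for [p <= i < 2 p - 1], so
    the coefficient of degree [p - 1] transforms as if it were the leading one. *)
Lemma coef_affine (g : {poly K}) (u v : K) : (size g <= (2 * p).-1)%N ->
  (g \Po (u%:P * 'X + v%:P))`_(p.-1) = u ^+ p.-1 * g`_(p.-1).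
Proof.
move=> sg; rewrite comp_polyE coef_sum.
have p0 := prime_gt0 p_prime.
transitivity (\sum_(i < size g) g`_i * u ^+ p.-1 * (i == p.-1 :> nat)%:R).
  apply: eq_bigr => i _; rewrite coefZ coef_affine_exp -mulrA; congr (_ * _).
  have [lt|gt|->] := ltngtP i p.-1.
  - by rewrite bin_small // mulr0n mulr0.
  - rewrite -mulr_natr bin_pred_vanish ?mulr0 //; first by lia.
    exact: leq_trans sg.
  - by rewrite binn subnn expr0.
have [le|lt] := leqP (size g) p.-1.
  rewrite nth_default // mulr0 big1 // => i _.
  by rewrite ltn_eqF ?mulr0 //; apply: leq_trans (ltn_ord i) le.
rewrite (bigD1 (Ordinal lt)) //= eqxx mulr1 big1 ?addr0 1?mulrC // => i ni.
by rewrite -val_eqE /= in ni; rewrite (negPf ni) mulr0.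
Qed.

Lemma fermat_int (z : int) : (z%:~R : K) ^+ p = z%:~R.
Proof.
by rewrite -(pFrobenius_autE charK) rmorph_int.
Qed.

Lemma fermat_pred (c : K) : c ^+ p = c -> c != 0 -> c ^+ p.-1 = 1.
Proof.
move=> cp c0; apply: (mulIf c0); rewrite mul1r -exprSr prednK //.
exact: prime_gt0.
Qed.

(** The substitution [x -> 12 d x + d] turns [lam] into [1728 d^3] times
    [x^3 + x^2/4 - s]; the value [d^2 = 88] removes the term of degree one. *)
Lemma hasse_sextic (d s : K) : p != 3%N -> d != 0 -> d ^+ 2 = 88%:R ->
    1728%:R * d ^+ 3 * s = 2%:R * d ^+ 3 - 1694%:R ->
  hasse p h (cm_a K) (cm_b K) = (12%:R * d) ^+ h * sextic_sum p s.
Proof.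
move=> p3 d0 d2 es.
have two : (2%:R : K) != 0.
  rewrite (natf_eq0 charK) dvdn_prime2 //; apply/negP => /eqP e.
  by move: p_odd; rewrite e; case: (h) => // -[|].
have three : (3%:R : K) != 0 by rewrite (natf_eq0 charK) dvdn_prime2.
have four : (4%:R : K) != 0 by rewrite (_ : 4 = 2 * 2)%N // natrM mulf_neq0.
have twelve : (12%:R : K) != 0 by rewrite (_ : 12 = 4 * 3)%N // natrM mulf_neq0.
have pE : p.-1 = (2 * h)%N by rewrite p_odd mul2n.
have four_h : (4%:R : K) ^+ h = 1.
  rewrite (_ : 4 = 2 ^ 2)%N // natrX -exprM -pE fermat_pred //.
  exact: (fermat_int 2).
(* With [d^2 = 88] the linear terms [36 d^3] and [12 * 264 d] cancel. *)
have sub : lam (cm_a K) (cm_b K) \Po ((12%:R * d)%:P * 'X + d%:P) =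
   ((12%:R * d) ^+ 3)%:P * hasse_cubic s.
  rewrite /lam /cm_a /cm_b /hasse_cubic !comp_polyD comp_Xn_poly (comp_polyM _%:P) !comp_polyC comp_polyX [in RHS]mulrBr [in RHS]mulrDr.

  rewrite -(polyCM _ s) (mulrA _ (4%:R^-1)%:P) -(polyCM _ 4%:R^-1).
  have -> : (12%:R * d) ^+ 3 * s = 2%:R * d ^+ 3 - 1694%:R :> K by rewrite -es; ring.
  have -> : (12%:R * d) ^+ 3 * 4%:R^-1 = 432%:R * 88%:R * d :> K.
    by rewrite -d2 exprMn; field.
  have -> : 2%:R * d ^+ 3 = 2%:R * 88%:R * d by rewrite -d2; ring.
  have -> : (12%:R * d) ^+ 3 = 1728%:R * 88%:R * d by rewrite -d2; ring.
  have hd : d%:P ^+ 2 = 88%:R :> {poly K} by rewrite -polyC_exp d2 polyC_natr.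
  rewrite polyCN polyCB !(polyCM _ d) !polyCM !polyC_natr.
  by ring: hd.
have u0 : 12%:R * d != 0 by rewrite mulf_neq0.
have := @coef_affine (lam (cm_a K) (cm_b K) ^+ h) (12%:R * d) d.
rewrite (rmorphXn (comp_poly _)) /= sub exprMn -!polyC_exp coefCM => /(_ _).
rewrite -/(hasse _ _ _ _).
have -> : (size (lam (cm_a K) (cm_b K) ^+ h) <= (2 * p).-1)%N.
  by rewrite size_lam_exp p_odd; clear; lia.
move=> /(_ isT) e.
rewrite -(hasse_cubic_sextic charK p_odd p3) four_h mul1r.
apply: (mulfI (expf_neq0 p.-1 u0)); rewrite -e mulrA pE -exprD -exprM.
by congr (_ ^+ _ * _); clear; lia.
Qed.
End Reciprocity.

(** * Quadratic residues modulo 11 and Frobenius *)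

Lemma legendre11_eq1 (p : nat) : legendre p%:Z 11 = 1 -> (p %% 11 \in [:: 1; 3; 4; 5; 9])%N.
Proof.
rewrite /legendre; case: ifP => // nd; case: ifP => // /existsP[[x xlt] /=].
rewrite -(rmorphXn Posz) !modz_nat eqz_nat => /eqP e _.
rewrite -e; move: nd; rewrite dvdzE /= /dvdn -e => {e}.
by do 11?[case: x xlt => // x xlt].
Qed.

Lemma legendre11_eqN1 (p : nat) : legendre p%:Z 11 = -1 -> (p %% 11 \in [:: 2; 6; 7; 8; 10])%N.
Proof.
rewrite /legendre; case: ifP => // nd; case: ifP => // /existsP ne _.
have no (x : nat) : (x < 11)%N -> (x ^ 2 %% 11 != p %% 11)%N.
  move=> xlt; apply/eqP => e; apply: ne; exists (Ordinal xlt).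
  by rewrite /= -(rmorphXn Posz) !modz_nat eqz_nat e.
move: nd; rewrite dvdzE /= /dvdn.
have : (p %% 11 < 11)%N by rewrite ltn_mod.
move: (no 1%N isT) (no 5%N isT) (no 2%N isT) (no 4%N isT) (no 3%N isT).
by case: (p %% 11)%N => [|[|[|[|[|[|[|[|[|[|[|]]]]]]]]]]].
Qed.

Section Period.
Variables (K : closedFieldType) (p : nat).
Hypothesis charK : p \in [pchar K].

Lemma period_exists : exists2 z : K, z ^+ 11 = 1 &
  z ^+ 10 = - (z ^+ 9 + z ^+ 8 + z ^+ 7 + z ^+ 6 + z ^+ 5 + z ^+ 4 + z ^+ 3 + z ^+ 2 + z + 1).
Proof.
have : size (\poly_(i < 11) (1 : K)) != 1%N.
  by rewrite size_poly_eq ?oner_eq0.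
move/closed_rootP => [z]; rewrite /root horner_poly => /eqP.
rewrite !big_ord_recr big_ord0 /= !mul1r add0r => e.
have e' : z ^+ 10 = - (z ^+ 9 + z ^+ 8 + z ^+ 7 + z ^+ 6 + z ^+ 5 + z ^+ 4 + z ^+ 3 + z ^+ 2 + z + 1).
  by apply/eqP; rewrite -addr_eq0 -e; apply/eqP; ring.
exists z => //; ring: e'.
Qed.

(** The residues modulo 11 are 1, 3, 4, 5, 9, so that [t] is minus a Gauss period.
    Frobenius multiplies exponents of the root of unity by [p]; it fixes [t] or
    exchanges it with [1 - t]. *)
Lemma root_frobenius : exists t : K, [/\ t ^+ 2 = t - 3%:R,
  legendre p%:Z 11 = 1 -> t ^+ p = t & legendre p%:Z 11 = -1 -> t ^+ p = 1 - t].
Proof.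
have [z z11 z10] := period_exists.
have zp : z ^+ p = z ^+ (p %% 11).
  by rewrite {1}(divn_eq p 11) exprD mulnC exprM z11 expr1n mul1r.
have tp (x y u v w : K) : (- (x + y + u + v + w)) ^+ p =
    - (x ^+ p + y ^+ p + u ^+ p + v ^+ p + w ^+ p).
  by rewrite -!(pFrobenius_autE charK) rmorphN !rmorphD.
exists (- (z + z ^+ 3 + z ^+ 4 + z ^+ 5 + z ^+ 9)).
rewrite tp -!exprM ![(_ * p)%N]mulnC !exprM zp; split.
- by ring: z10.
- move/legendre11_eq1; rewrite !inE.
  by do ![case/orP => [/eqP->|]] => [||||/eqP->]; ring: z10.
- move/legendre11_eqN1; rewrite !inE.
  by do ![case/orP => [/eqP->|]] => [||||/eqP->]; ring: z10.
Qed.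
End Period.

(** * Representations by the form of discriminant -11 *)

(** Gauss reduction: translate so that [- a <= b < a], then exchange [a] and [c]
    as long as [c < a]. A form that cannot be reduced further satisfies
    [3 a^2 <= 11], which leaves only the principal form. *)
Lemma class_number_one (a b c : int) : 0 < a -> b ^+ 2 + 11 = 4 * a * c ->
  exists r s u v : int, [/\ a = r ^+ 2 + r * s + 3 * s ^+ 2,
    b = 2 * r * u + (r * v + s * u) + 6 * s * v & c = u ^+ 2 + u * v + 3 * v ^+ 2].
Proof.
have [N] := ubnP `|a|%N; elim: N => // N IH in a b c * => aN a0 disc.
pose k := ((b + a) %/ (2 * a))%Z; pose b' := b - 2 * a * k.
pose c' := c - b * k + a * k ^+ 2.
have [b'1 b'2] : - a <= b' /\ b' < a.
  have e := divz_eq (b + a) (2 * a).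
  have a2 : 2 * a != 0 by rewrite mulf_neq0 // gt_eqF.
  have g0 := modz_ge0 (b + a) a2; have := ltz_mod (b + a) a2.
  have e' : ((b + a) %% (2 * a))%Z = b' + a by apply: (addrI (k * (2 * a))); rewrite -[LHS]e /b'; ring.
  rewrite e' in g0 *; rewrite ger0_norm; last by rewrite mulr_ge0 // ltW.
  clear -a0 g0; lia.
have disc' : b' ^+ 2 + 11 = 4 * a * c'.
  rewrite (_ : 4 * a * c' = 4 * a * c - 4 * a * b * k + 4 * a ^+ 2 * k ^+ 2).
    by rewrite -disc /b'; ring.
  by rewrite /c'; ring.
have eb : b = b' + 2 * a * k by rewrite /b'; ring.
have ec : c = c' + b' * k + a * k ^+ 2 by rewrite /c' /b'; ring.
clearbody k b' c'.
suff [r [s [u [v [ra rb rc]]]]] : exists r s u v : int,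
    [/\ a = r ^+ 2 + r * s + 3 * s ^+ 2,
    b' = 2 * r * u + (r * v + s * u) + 6 * s * v & c' = u ^+ 2 + u * v + 3 * v ^+ 2].
  exists r, s, (u + k * r), (v + k * s).
  by split; [exact: ra | rewrite eb rb ra; ring | rewrite ec rc rb ra; ring].
clear eb ec disc.
have [lt|le] := ltP c' a.
  have c0 : 0 < c'.
    have : 0 < 4 * a * c' by rewrite -disc' ltr_wpDl // sqr_ge0.
    by rewrite pmulr_rgt0 // mulr_gt0.
  have [||r [s [u [v [rc rb ra]]]]] := IH c' b' a _ c0.
  - by clear -lt c0 aN; lia.
  - by rewrite disc'; ring.
  by exists u, v, r, s; split; [exact: ra | rewrite rb; ring | exact: rc].
have ea : a = 1.
  have h1 : 4 * a * a <= 4 * a * c' by rewrite ler_wpM2l // mulr_ge0 // ltW.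
  have h2 : b' ^+ 2 <= a ^+ 2.
    have : 0 <= (a - b') * (a + b') by apply: mulr_ge0; clear -b'1 b'2; lia.
    by rewrite -(subr_ge0 (b' ^+ 2)) (_ : (a - b') * (a + b') = a ^+ 2 - b' ^+ 2); last by ring.
  clear -h1 h2 disc' a0; nia.
subst a; have eb : b' = -1.
  case: (b' =P 0) => [e|]; last by clear -b'1 b'2; lia.
  by move: disc'; rewrite e; clear; lia.
have ec : c' = 3 by move: disc'; rewrite eb; clear; lia.
by exists 1, 0, (-1), 1; rewrite eb ec; split.
Qed.

(** A root of [c^2 - c + 3] modulo [p] gives a form of discriminant -11 with first
    coefficient [p]. *)
Lemma norm_form_exists (p : nat) (c : int) : prime p -> (p%:Z %| c ^+ 2 - c + 3)%Z ->
  exists x y : int, 4 * p%:Z = x ^+ 2 + 11 * y ^+ 2.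
Proof.
move=> pp /dvdzP[q eq].
have [||r [s [u [v [ra _ _]]]]] := @class_number_one p%:Z (2 * c - 1) q.
- by rewrite ltz_nat prime_gt0.
- by rewrite -(mulrA 4) [p%:Z * q]mulrC -eq; ring.
by exists (2 * r + s), s; rewrite ra; ring.
Qed.

Lemma norm_form_param (p : nat) (x y : int) : 4 * p%:Z = x ^+ 2 + 11 * y ^+ 2 ->
  exists m n : int, m ^+ 2 + m * n + 3 * n ^+ 2 = p%:Z /\ x = 2 * m + n.
Proof.
move=> e.
have [m em] : exists m, x = 2 * m + y.
  have : (2 %| x - y)%Z.
    have : (2 %| (x - y) * (x - y))%Z.
      apply/dvdzP; exists (2 * p%:Z - 5 * y ^+ 2 - x * y).
      transitivity (x ^+ 2 + 11 * y ^+ 2 - 10 * y ^+ 2 - 2 * x * y); first by ring.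
      by rewrite -e; ring.
    by rewrite !dvdzE abszM Euclid_dvdM // orbb.
  by case/dvdzP => m hm; exists m; rewrite mulrC -hm; ring.
exists m, y; split=> //.
have four : (4 : int) != 0 by [].
by apply: (mulfI four); rewrite e em; ring.
Qed.

(** * Residue rings and Euler's criterion *)

Lemma closed_field_char (p : nat) : prime p ->
  exists K : closedFieldType, p \in [pchar K].
Proof.
move=> pp; have [K [g _]] := countable_algebraic_closure 'F_p.
by exists K; apply: (rmorph_pchar g); rewrite pchar_Fp.
Qed.

Lemma Zp_int_eq0 (m : nat) (z : int) : (1 < m)%N ->
  (z%:~R == 0 :> 'Z_m) = (m%:Z %| z)%Z.
Proof.
move=> m1; have nat_eq0 (n : nat) : (n%:R == 0 :> 'Z_m) = (m %| n)%N.
  by rewrite -val_eqE /= val_Zp_nat.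
case: z => n; first by rewrite -pmulrn nat_eq0.
by rewrite NegzE rmorphN oppr_eq0 dvdzE abszN /= -pmulrn nat_eq0.
Qed.

Lemma inverse_mod (z : int) (m : nat) : coprimez z m%:Z ->
  exists e : int, (m%:Z %| z * e - 1)%Z.
Proof.
move=> /coprimezP[[u v] /= e]; exists u.
by apply/dvdzP; exists (- v); rewrite -e; ring.
Qed.

Section Char.
Variables (K : closedFieldType) (p h : nat).
Hypothesis charK : p \in [pchar K].
Hypothesis p_odd : p = h.*2.+1.
Let p_prime : prime p := pcharf_prime charK.

Lemma sqrt_exists (c : K) : exists r : K, r ^+ 2 = c.
Proof.
have : size ('X^2 - c%:P) != 1%N by rewrite size_XnsubC.
by case/closed_rootP => r; rewrite /root !hornerE subr_eq0 => /eqP; exists r.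
Qed.

(** Euler's criterion. *)
Lemma legendre_exp (a : int) : ((legendre a p)%:~R : K) = a%:~R ^+ h.
Proof.
have p0 := prime_gt0 p_prime.
have h0 : (0 < h)%N by have := prime_gt1 p_prime; rewrite p_odd; case: (h).
have pE : p.-1 = (2 * h)%N by rewrite p_odd; lia.
rewrite /legendre -(intf_eq0 charK); case: eqP => [->|/eqP a0].
  by rewrite expr0n gtn_eqF.
case: ifP => [/existsP[x /eqP/eqP]|ne].
  rewrite eqz_mod_dvd -(intf_eq0 charK) rmorphB rmorphXn /= subr_eq0 => /eqP e.
  rewrite -e -exprM -pE fermat_pred //; first exact: (fermat_int charK).
  by apply/eqP => x0; move: a0; rewrite -e x0 expr0n eqxx.
have [r er] := sqrt_exists a%:~R.
have : (a%:~R ^+ h) ^+ 2 = 1 :> K.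
  by rewrite -exprM mulnC -pE fermat_pred // (fermat_int charK).
move/eqP; rewrite sqrf_eq1 => /orP[] /eqP e; last by rewrite e mulrN1z.
suff : false by [].
rewrite -ne; apply/existsP.
have : r \in prime_field K p.
  rewrite (mem_prime_field charK) -[X in _ ^+ X](prednK p0) exprS pE exprM er e.
  by rewrite mulr1.
case/mapP => i; rewrite mem_iota add0n => /andP[_ ilt] ri.
exists (Ordinal ilt); rewrite /= eqz_mod_dvd -(intf_eq0 charK).
by rewrite rmorphB rmorphXn /= -er ri subrr.
Qed.
End Char.

(** * The sum in terms of the Hasse invariant *)

Lemma scaled_sum_morph (p : nat) (A B : comNzRingType) (g : {rmorphism A -> B}) D :
  g (scaled_sum p D) = scaled_sum p (g D).
Proof.
rewrite rmorph_sum; apply: eq_bigr => k _.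
by rewrite (rmorphM g) rmorph_nat (rmorphXn g).
Qed.

Section Core.
Variables (K : closedFieldType) (p h : nat).
Hypothesis charK : p \in [pchar K].
Hypothesis p_odd : p = h.*2.+1.
Hypotheses (p2 : p != 2%N) (p3 : p != 3%N) (p7 : p != 7%N) (p11 : p != 11%N).
Let p_prime : prime p := pcharf_prime charK.

Let small_neq0 : [/\ (2%:R : K) != 0, (3%:R : K) != 0, (7%:R : K) != 0 & (11%:R : K) != 0].
Proof. by split; rewrite (natf_eq0 charK) dvdn_prime2. Qed.

(** For the two square roots [d] of 88, the numbers [432 * sx d] are the two
    solutions [X] of [X - X^2 = 432 / (-32)^3]; see [sx_sum] and [sx_mul]. *)
Let sx (d : K) : K := (2%:R * d ^+ 3 - 1694%:R) / (1728%:R * d ^+ 3).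

Let n1728 : (1728%:R : K) != 0.
Proof.
have [two three _ _] := small_neq0.
by rewrite (_ : 1728 = 2 ^ 6 * 3 ^ 3)%N // natrM !natrX mulf_neq0 ?expf_neq0.
Qed.

Let hasse_sx (d : K) : d != 0 -> d ^+ 2 = 88%:R ->
  hasse p h (cm_a K) (cm_b K) = (12%:R * d) ^+ h * sextic_sum p (sx d).
Proof.
move=> d0 d2; apply: hasse_sextic => //; rewrite /sx mulrC divfK //.
by rewrite mulf_neq0 ?expf_neq0.
Qed.

Let sqrt88 : exists2 d : K, d != 0 & d ^+ 2 = 88%:R.
Proof.
have [two three _ eleven] := small_neq0.
have [d d2] := sqrt_exists (88%:R : K); exists d => //.
apply/eqP => d0; move: d2 (mulf_neq0 (expf_neq0 3 two) eleven).
by rewrite d0 expr0n /= -natrX -natrM => <-; rewrite eqxx.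
Qed.

Let sx_sum (d : K) : d != 0 -> 432%:R * sx d + 432%:R * sx (- d) = 1.
Proof.
move=> d0; have [two three _ _] := small_neq0; rewrite /sx; field.
by rewrite d0 oppr_eq0 d0 n1728.
Qed.

Let sx_mul (d e : K) : d != 0 -> d ^+ 2 = 88%:R -> (- 32%:R) ^+ 3 * e = 1 ->
  432%:R * sx d * (432%:R * sx (- d)) = 432%:R * e.
Proof.
move=> d0 d2 he; have [two three _ _] := small_neq0.
have n32 : (32%:R : K) != 0 by rewrite (_ : 32 = 2 ^ 5)%N // natrX expf_neq0.
have n32' : (- 32%:R : K) ^+ 3 != 0 by rewrite expf_neq0 ?oppr_eq0.
have -> : e = ((- 32%:R) ^+ 3)^-1 by apply: (mulfI n32'); rewrite divff.
have xiE (r : K) : r != 0 ->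
    432%:R * sx r = (r ^+ 3 - 7%:R * 11%:R ^+ 2) / (2%:R * r ^+ 3).
  by move=> r0; rewrite /sx; field; rewrite r0 two n1728.
rewrite !xiE ?oppr_eq0 //.
have d2' : d ^+ 2 = 8%:R * 11%:R by rewrite d2 -natrM.
have eleven0 : (11%:R : K) != 0 by have [] := small_neq0.
have c539 : 49%:R * 11%:R = 539%:R :> K by rewrite -natrM.
move: (11%:R : K) eleven0 d2' c539 => c c0 d2' c539.
transitivity ((512%:R - 49%:R * c) / 2048%:R : K).
  have two11 : (2048%:R : K) != 0 by rewrite (_ : 2048 = 2 ^ 11)%N // natrX expf_neq0.
  by field: d2'; rewrite d0 two oppr_eq0 d0 two11.
have -> : 2048%:R = 2%:R * 32%:R ^+ 2 :> K by rewrite -natrX -natrM.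
have k0 : (16%:R : K) != 0 by rewrite (_ : 16 = 2 ^ 4)%N // natrX expf_neq0.
rewrite c539 (_ : 32%:R = 2%:R * 16%:R :> K); last by rewrite -natrM.
rewrite (_ : 432%:R = 27%:R * 16%:R :> K); last by rewrite -natrM.
rewrite (_ : 512%:R - 539%:R = - 27%:R :> K); last by ring.
move: (16%:R : K) k0 => k k0.
have four : (4%:R : K) != 0 by rewrite (_ : 4 = 2 * 2)%N // natrM mulf_neq0.
by field; rewrite oppr_eq0 mulf_neq0 // two k0 four.
Qed.

Let sx_neq (d : K) : d != 0 -> 432%:R * sx d != 432%:R * sx (- d).
Proof.
move=> d0; have [two three seven eleven] := small_neq0.
rewrite -subr_eq0.
have -> : 432%:R * sx d - 432%:R * sx (- d) = - (7%:R * 11%:R ^+ 2 / d ^+ 3).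
  by rewrite /sx; field; rewrite d0 oppr_eq0 d0 n1728.
by rewrite oppr_eq0 !mulf_neq0 ?invr_neq0 ?expf_neq0.
Qed.

Variables (a e : int).
Hypothesis ha : (p%:Z ^+ 2 %| 6 * a + 1)%Z.
Hypothesis he : (p%:Z ^+ 2 %| (- 32) ^+ 3 * e - 1)%Z.

Let dvd_K (z : int) : (p%:Z ^+ 2 %| z)%Z -> z%:~R = 0 :> K.
Proof.
by move=> d; apply/eqP; rewrite (intf_eq0 charK); apply: dvdz_trans d; apply: dvdz_mulr.
Qed.

Let haK : 6%:R * a%:~R = -1 :> K.
Proof.
have := dvd_K ha; rewrite rmorphD rmorphM /= => /eqP; rewrite addr_eq0 => /eqP.
by [].
Qed.

Let heK : (- 32%:R) ^+ 3 * e%:~R = 1 :> K.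
Proof.
have := dvd_K he; rewrite rmorphB rmorphM /= => /eqP; rewrite subr_eq0 => /eqP.
by rewrite rmorphXn rmorphN.
Qed.

Let wpoly_sx (d : K) :
  (wpoly p (a%:~R : K)).[432%:R * sx d] = (p.-1)`!%:R ^+ 2 * sextic_sum p (sx d).
Proof. by rewrite wpoly_sextic ?prime_gt0. Qed.

Let residue : exists2 n, (n < p)%N & (p%:Z %| a - n%:Z)%Z.
Proof.
have p0 : p%:Z != 0 by rewrite eqz_nat gtn_eqF // prime_gt0.
exists `|(a %% p%:Z)%Z|%N.
  rewrite -ltz_nat gez0_abs ?modz_ge0 //.
  by apply: ltz_pmod; rewrite ltz_nat prime_gt0.
rewrite gez0_abs ?modz_ge0 //; apply/dvdzP; exists (a %/ p%:Z)%Z.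
by rewrite {1}(divz_eq a p%:Z) addrK.
Qed.

Let fact_neq0 : ((p.-1)`!%:R : K) != 0.
Proof. by rewrite (factf_neq0 charK) // prednK ?prime_gt0. Qed.

(** [defect] is zero in [K] and is evaluated at [X = 432 * sx d]. *)
Lemma scaled_sum_sqr (d : K) : d != 0 -> d ^+ 2 = 88%:R ->
  scaled_sum p ((- 32%:R) ^+ 3 : K) = sextic_sum p (sx d) ^+ 2.
Proof.
move=> d0 d2; have p0 := prime_gt0 p_prime.
have [n np an] := residue.
have aK : a%:~R = n%:R :> K.
  by apply/eqP; rewrite -subr_eq0 pmulrn -rmorphB /= (intf_eq0 charK).
have : defect p (a%:~R : K) = 0.
  rewrite aK pmulrn -(defect_morph p (intmul 1 : {rmorphism int -> K})).
  by rewrite defect_nat // map_poly0.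
move/(congr1 (fun P => P.[432%:R * sx d])); rewrite horner0 /defect hornerD hornerN horner_exp.
have := wsqr_morph p (horner_eval (432%:R * sx d)) (a%:~R%:P) ('X - 'X^2).
rewrite /= /horner_eval hornerC => ->; rewrite hornerD hornerN hornerX hornerXn wpoly_sx.
have -> : 432%:R * sx d - (432%:R * sx d) ^+ 2 = 432%:R * e%:~R.
  rewrite -(sx_mul d0 d2 heK); move: (sx_sum d0).
  move: (432%:R * sx d) (432%:R * sx (- d)) => x y xy.
  by rewrite (_ : y = 1 - x); [ring | rewrite -xy addrAC subrr add0r].
move/eqP; rewrite subr_eq0 => /eqP eq1.
have := wsqr_sextic p0 haK heK.
rewrite eq1 (exprMn 2) => eq2.
have D1 : ((- 32%:R) ^+ 3 : K) ^+ p.-1 = 1.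
  have [two _ _ _] := small_neq0.
  rewrite fermat_pred //; first by have := fermat_int charK ((- 32) ^+ 3); rewrite rmorphXn rmorphN.
  by rewrite expf_neq0 // oppr_eq0 (_ : 32 = 2 ^ 5)%N // natrX expf_neq0.
rewrite D1 mul1r in eq2; apply: (mulfI (expf_neq0 4 fact_neq0)).
by rewrite -eq2 -exprM.
Qed.

(** By Fermat's little theorem [(12^2 * 88)^h = (22 * 24^2)^h = 22^h]. *)
Lemma scaled_sum_hasse :
  22%:R ^+ h * scaled_sum p ((- 32%:R) ^+ 3 : K) = hasse p h (cm_a K) (cm_b K) ^+ 2.
Proof.
have [d d0 d2] := sqrt88; have [two three _ _] := small_neq0.
rewrite (hasse_sx d0 d2) (exprMn 2) -(exprM _ h 2) mulnC (exprM _ 2 h) (exprMn 2) d2.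
rewrite (scaled_sum_sqr d0 d2); congr (_ * _).
have -> : 12%:R ^+ 2 * 88%:R = 22%:R * 24%:R ^+ 2 :> K by rewrite -!natrX -!natrM.
rewrite (exprMn h 22%:R) -(exprM _ 2 h) (_ : 2 * h = p.-1)%N; last by rewrite p_odd mul2n.
rewrite fermat_pred ?mulr1 //; first exact: (fermat_int charK 24).
by rewrite (_ : 24 = 2 ^ 3 * 3)%N // natrM natrX mulf_neq0 ?expf_neq0.
Qed.

(** The equality of [wsqr] and [scaled_sum] up to units involves [1/6] and
    [1/(-32)^3], so it is transported to the ring of integers modulo [p^2]. *)
Lemma supersingular_dvd : hasse p h (cm_a K) (cm_b K) = 0 ->
  (p%:Z ^+ 2 %| scaled_sum p ((- 32) ^+ 3 : int))%Z.
Proof.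
move=> H0; have p0 := prime_gt0 p_prime; have p1 := prime_gt1 p_prime.
have [two three _ _] := small_neq0.
have [d d0 d2] := sqrt88.
have sum0 (r : K) : r != 0 -> r ^+ 2 = 88%:R -> sextic_sum p (sx r) = 0.
  move=> r0 r2; move: H0; rewrite (hasse_sx r0 r2) => /eqP; rewrite mulf_eq0 => /orP[|/eqP //].
  rewrite expf_eq0 mulf_eq0 (negPf r0) orbF => /andP[_].
  by rewrite (_ : 12 = 2 ^ 2 * 3)%N // natrM natrX mulf_eq0 expf_eq0 (negPf two) (negPf three) andbF.
have [n np an] := residue.
have : (p%:Z ^+ 2 %| wsqr p a (432 * e))%Z.
  apply: (wsqr_dvd charK np an (sx_neq d0) (sx_sum d0)).
  - by rewrite (sx_mul d0 d2 heK) rmorphM.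
  - by rewrite wpoly_sx sum0 ?mulr0.
  - by rewrite wpoly_sx sum0 ?mulr0 ?oppr_eq0 // sqrrN.
have m1 : (1 < p ^ 2)%N by rewrite -{1}(exp1n 2) ltn_exp2r.
have eqA (z : int) : (p%:Z ^+ 2 %| z)%Z = (z%:~R == 0 :> 'Z_(p ^ 2)).
  by rewrite (Zp_int_eq0 _ m1) -(rmorphXn Posz).
rewrite eqA => /eqP w0.
have haA : 6%:R * a%:~R = -1 :> 'Z_(p ^ 2).
  by apply/eqP; rewrite -addr_eq0; move: ha; rewrite eqA rmorphD rmorphM.
have e3 : ((- 32) ^+ 3 : int)%:~R = (- 32%:R) ^+ 3 :> 'Z_(p ^ 2).
  by rewrite rmorphXn; congr (_ ^+ _); rewrite rmorphN.
have heA : (- 32%:R) ^+ 3 * e%:~R = 1 :> 'Z_(p ^ 2).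
  apply/eqP; rewrite -subr_eq0 -e3.
  by move: he; rewrite eqA intrB intrM.
have := wsqr_sextic p0 haA heA.
pose g : {rmorphism int -> 'Z_(p ^ 2)} := intmul 1.
have ew : wsqr p (a%:~R : 'Z_(p ^ 2)) (432%:R * e%:~R) = 0.
  have -> : 432%:R * e%:~R = (432 * e)%:~R :> 'Z_(p ^ 2).
    by rewrite intrM; congr (_ * _); rewrite rmorph_nat.
  by rewrite -[LHS](wsqr_morph p g a (432 * e)).
rewrite ew mulr0 => /esym/eqP.
have -> : (p.-1)`!%:R ^+ 4 * scaled_sum p ((- 32%:R) ^+ 3) =
   ((p.-1)`!%:Z ^+ 4 * scaled_sum p ((- 32) ^+ 3))%:~R :> 'Z_(p ^ 2).
  rewrite intrM; congr (_ * _); first by rewrite rmorphXn /= -pmulrn.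
  by rewrite -e3 -(scaled_sum_morph p g).
have cop : coprimez (p%:Z ^+ 2) ((p.-1)`!%:Z ^+ 4).
  apply: coprimezXl; apply: coprimezXr; rewrite coprimezE !absz_nat.
  rewrite prime_coprime; last exact: p_prime.
  by rewrite -(natf_eq0 charK) fact_neq0.
by rewrite -eqA (Gauss_dvdzr _ cop).
Qed.

End Core.

(** * Congruences between rationals *)

Lemma sum_binom236E (p : nat) : (0 < p)%N ->
  sum_binom236 p = (scaled_sum p ((- 32) ^+ 3 : int))%:~R / (((- 32) ^+ 3) ^+ p.-1 : int)%:~R.
Proof.
move=> p0; have D0 : (- 32%:R : rat) != 0 by [].
have eD : ((- 32) ^+ 3 : int)%:~R = (- 32%:R) ^+ 3 :> rat.
  by rewrite rmorphXn; congr (_ ^+ _); rewrite rmorphN.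
rewrite /sum_binom236 big_mkord rmorph_sum mulr_suml; apply: eq_bigr => k _.
have kp : (k <= p.-1)%N by rewrite -ltnS prednK.
rewrite exprM; move: ((- 32) ^+ 3 : int) ((- 32%:R) ^+ 3 : rat) (expf_neq0 3 D0) eD.
move=> D E E0 eD; rewrite [in RHS]rmorphM [in RHS]rmorph_nat !(rmorphXn (intmul 1)) /= eD.
rewrite -mulnA -mulrA; congr (_ * _).
have -> : E ^+ p.-1 = E ^+ (p.-1 - k) * E ^+ k by rewrite -exprD subnK.
by rewrite invfM mulrA divff ?mul1r; [|exact: expf_neq0].
Qed.

Lemma p_integral_div (p : nat) (z d : int) : coprimez p%:Z d ->
  p_integral p (z%:~R / d%:~R).
Proof.
move=> cop; have [->|d0] := eqVneq d 0.
  by rewrite mulr0z invr0 mulr0 /p_integral coprimen1.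
set q := _ / _; have dn : (denq q %| d)%Z.
  rewrite -(@Gauss_dvdzr _ (numq q)); last by rewrite coprimez_sym coprimezE coprime_num_den.
  apply/dvdzP; exists z; apply/eqP; rewrite -(eqr_int rat) !rmorphM /=.
  by rewrite numqE mulrAC /q divfK // intr_eq0.
by rewrite /p_integral; apply: coprime_dvdr cop; rewrite -dvdzE.
Qed.

Lemma eqmod_pint_div (p m : nat) (z d b : int) : d != 0 -> coprimez p%:Z d ->
  (m%:Z %| z - b * d)%Z -> eqmod_pint p m (z%:~R / d%:~R) b%:~R.
Proof.
move=> d0 cop /dvdzP[c ec].
split; first exact: p_integral_div.
  by rewrite -[b%:~R]divr1; apply: (@p_integral_div p b 1); rewrite coprimezE coprimen1.
exists (c%:~R / d%:~R); first exact: p_integral_div.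
have d0' : d%:~R != 0 :> rat by rewrite intr_eq0.
apply: (mulIf d0'); rewrite mulrBl mulrA !divfK //.
by rewrite -intrM -rmorphB /= ec intrM mulrC -pmulrn.
Qed.

(** * The inert and split cases *)

Lemma coprime_denom (p : nat) : prime p -> p != 2%N -> coprimez p%:Z ((- 32) ^+ 3 ^+ p.-1).
Proof.
move=> pp p2; apply: coprimezXr; apply: coprimezXr.
rewrite coprimezE absz_nat abszN (_ : `|32|%N = 2 ^ 5)%N // coprimeXr //.
by rewrite prime_coprime // dvdn_prime2.
Qed.

(** Modulo 7 the two points [X] of the general argument coincide, so the
    terms are computed. *)
Lemma scaled_sum_seven : (7 ^ 2 %| scaled_sum 7 ((- 32) ^+ 3 : int))%Z.
Proof.
rewrite -(@Zp_int_eq0 49) //.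
rewrite [_%:~R](scaled_sum_morph 7 (intmul 1 : {rmorphism int -> 'Z_49})) /=.
have -> : ((- 32) ^+ 3 : int)%:~R = 13%:R :> 'Z_49.
  rewrite rmorphXn /= rmorphN /=; exact/val_inj.
have s7 k : (1 < k < 7)%N -> (7 %| sextic k)%N.
  move=> /andP[k1 k7]; have charF : 7 \in [pchar 'F_7] by rewrite pchar_Fp.
  by rewrite -(natf_eq0 charF) (@sextic_vanish _ 7 3) //; lia.
have z49 k : (3 < k < 7)%N -> ('C(2 * k, k) * sextic k)%:R = 0 :> 'Z_49.
  move=> /andP[k3 k7]; apply/eqP; rewrite pmulrn Zp_int_eq0 //.
  rewrite dvdzE !absz_nat (_ : 49 = 7 * 7)%N // dvdn_mul ?s7 ?(ltn_trans _ k3) //.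
  by move: k k3 k7 => [|[|[|[|[|[|[|]]]]]]].
have e2 : (sextic 2 = 36 * 385)%N by [].
have e3 : (sextic 3 = 48 * 385 * 221)%N.
  have := sextic_prod 3; move: (sextic 3) => S.
  rewrite !big_ord_recr big_ord0 (_ : 3`! = 6)%N; last by [].
  by cbn -[muln expn addn]; lia.
pose c k : 'Z_49 := ('C(2 * k, k) * sextic k)%:R.
have -> : scaled_sum 7 (13%:R : 'Z_49) = \sum_(k < 7) c k * 13%:R ^+ (6 - k) by [].
have c0 : c 0%N = 1%:R by [].
have c1 : c 1%N = 120%:R by [].
have c2 : c 2%N = 6%:R * (36%:R * 385%:R) by rewrite /c e2 !natrM.
have c3 : c 3%N = 20%:R * (48%:R * 385%:R * 221%:R) by rewrite /c e3 !natrM.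
have c4 : c 4%N = 0 by exact: z49.
have c5 : c 5%N = 0 by exact: z49.
have c6 : c 6%N = 0 by exact: z49.
move: c c0 c1 c2 c3 c4 c5 c6 => c c0 c1 c2 c3 c4 c5 c6.
rewrite !big_ord_recr big_ord0 /= c0 c1 c2 c3 c4 c5 c6.
by apply/eqP/val_inj.
Qed.

Lemma scaled_sum_three (K : fieldType) : 3 \in [pchar K] ->
  scaled_sum 3 ((- 32%:R) ^+ 3 : K) = 1.
Proof.
move=> charK; pose c k : K := ('C(2 * k, k) * sextic k)%:R.
have -> : scaled_sum 3 ((- 32%:R) ^+ 3 : K) = \sum_(k < 3) c k * (- 32%:R) ^+ 3 ^+ (2 - k).
  by [].
have c0 : c 0%N = 1 by [].
have c1 : c 1%N = 0 by apply/eqP; rewrite (natf_eq0 charK).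
have c2 : c 2%N = 0 by apply/eqP; rewrite (natf_eq0 charK) dvdn_mulr.
move: c c0 c1 c2 => c c0 c1 c2.
rewrite !big_ord_recr big_ord0 /= c0 c1 c2 !mul0r !addr0 add0r mul1r.
have -> : 32%:R = -1 :> K.
  by apply/eqP; rewrite -addr_eq0 natr1 (natf_eq0 charK).
by rewrite opprK !expr1n.
Qed.

Section Main.
Variables (p h : nat) (K : closedFieldType).
Hypothesis charK : p \in [pchar K].
Hypothesis p_odd : p = h.*2.+1.
Hypotheses (p2 : p != 2%N) (p11 : p != 11%N).
Let p_prime : prime p := pcharf_prime charK.

(** Integers that represent [-1/6] and [1/(-32)^3] modulo [p^2]. *)
Lemma clausen_parameters : p != 3%N -> exists a e : int,
  (p%:Z ^+ 2 %| 6 * a + 1)%Z /\ (p%:Z ^+ 2 %| (- 32) ^+ 3 * e - 1)%Z.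
Proof.
move=> p3; have c6 : coprimez (-6) (p ^ 2)%N%:Z.
  rewrite coprimezE absz_nat abszN coprimeXr // coprime_sym prime_coprime //.
  by rewrite (_ : `|6|%N = 2 * 3)%N // Euclid_dvdM // !dvdn_prime2 // (negPf p2).
have c32 : coprimez ((- 32) ^+ 3) (p ^ 2)%N%:Z.
  rewrite coprimez_sym [X in coprimez X](rmorphXn Posz 2 p).
  apply: coprimezXl; apply: coprimezXr.
  rewrite coprimezE absz_nat abszN (_ : `|32|%N = 2 ^ 5)%N // coprimeXr //.
  by rewrite prime_coprime // dvdn_prime2.
have [a ha] := inverse_mod c6; have [e he] := inverse_mod c32.
exists a, e; rewrite -(rmorphXn Posz 2 p) /=; split=> //.
by rewrite -rpredN (_ : - (6 * a + 1) = - 6 * a - 1); last by ring.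
Qed.

(** Here [t^p = 1 - t]. If the Hasse invariant were nonzero, [inert_hasse] would
    give [t^p = t], hence [2 t = 1] and [11 = 0]. *)
Lemma inert_case : legendre p%:Z 11 = -1 ->
  (p%:Z ^+ 2 %| scaled_sum p ((- 32) ^+ 3 : int))%Z.
Proof.
move=> leg; have [->|p7] := eqVneq p 7%N; first exact: scaled_sum_seven.
have p3 : p != 3%N.
  by apply/eqP => e; have := legendre11_eqN1 leg; rewrite e.
have [a [e [ha he]]] := clausen_parameters p3.
apply: (supersingular_dvd charK p_odd p2 p3 p7 p11 ha he).
have [t [ht _ /(_ leg) tp]] := root_frobenius charK.
apply/eqP/negPn/negP => H0.
have := inert_hasse charK p_odd p2 p3 p7 p11 ht (@tofrac_inj _).
rewrite -[X in X = _]mulr1 => /(mulfI H0) t1.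
have tt : 1 - t = t by rewrite -tp -(prednK (prime_gt0 p_prime)) exprS -t1 mulr1.
have : (11%:R : K) = 0.
  transitivity (4%:R * (t ^+ 2 - t + 3%:R) - (2%:R * t - 1) ^+ 2); last first.
    rewrite ht; have -> : 2%:R * t - 1 = t - (1 - t) by ring.
    rewrite tt subrr; ring.
  ring.

by move/eqP; rewrite (natf_eq0 charK) dvdn_prime2 // (negPf p11).
Qed.

Lemma split_frobenius : legendre p%:Z 11 = 1 ->
  exists2 t : K, t ^+ 2 = t - 3%:R & t ^+ p = t.
Proof.
by move=> leg; have [t [ht /(_ leg) tp _]] := root_frobenius charK; exists t.
Qed.

Lemma split_norm_form : legendre p%:Z 11 = 1 ->
  exists x y : int, 4 * p%:Z = x ^+ 2 + 11 * y ^+ 2.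
Proof.
move=> leg; have [t ht tp] := split_frobenius leg.
have : t \in prime_field K p by rewrite (mem_prime_field charK) tp.
case/mapP => i _ ti; apply: (@norm_form_exists p i%:Z p_prime).
rewrite -(intf_eq0 charK) rmorphD rmorphB rmorphXn /= -pmulrn -ti ht.
by apply/eqP; ring.
Qed.

(** The product [(m + n t) (m + n (1 - t))] is the norm [p], so one of the two
    factors is zero in [K] and [cm_hasse_sqr] applies to the corresponding root. *)
Lemma split_case (x y : int) : legendre p%:Z 11 = 1 -> 4 * p%:Z = x ^+ 2 + 11 * y ^+ 2 ->
  (p%:Z %| scaled_sum p ((- 32) ^+ 3 : int)
     - legendre (-2) p * x ^+ 2 * (- 32) ^+ 3 ^+ p.-1)%Z.
Proof.
move=> leg exy; have [t ht tp] := split_frobenius leg.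
have two : (2%:R : K) != 0 by rewrite (natf_eq0 charK) dvdn_prime2.
have eD : ((- 32) ^+ 3 : int)%:~R = (- 32%:R) ^+ 3 :> K.
  by rewrite rmorphXn; congr (_ ^+ _); rewrite rmorphN.
have D1 : (((- 32) ^+ 3 : int)%:~R : K) ^+ p.-1 = 1.
  rewrite fermat_pred //; first exact: fermat_int.
  by rewrite eD expf_neq0 // oppr_eq0 (_ : 32 = 2 ^ 5)%N // natrX expf_neq0.
rewrite -(intf_eq0 charK) intrB subr_eq0 intrM intrM.
rewrite [(_ ^+ p.-1)%:~R](rmorphXn (intmul 1) p.-1) /= D1 mulr1 (legendre_exp charK p_odd).
rewrite [X in X == _](scaled_sum_morph p (intmul 1 : {rmorphism int -> K})) /= eD.
have [p3|p3] := eqVneq p 3%N.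
  have h1 : h = 1%N by move: p_odd; rewrite p3; clear; lia.
  have x2 : x ^+ 2 = 1.
    rewrite p3 in exy.
    have [y1 y2] : -1 <= y /\ y <= 1 by split; clear -exy; nia.
    have [x1 x3] : -3 <= x /\ x <= 3 by split; clear -exy; nia.
    clear -exy y1 y2 x1 x3; nia.
  have char3 : 3%N \in [pchar K] by rewrite -{1}p3.
  rewrite x2 mulr1 h1 expr1 p3 (scaled_sum_three char3).
  by rewrite eq_sym rmorphN eqr_oppLR -addr_eq0 natr1 (natf_eq0 char3).
have p7 : p != 7%N.
  by apply/eqP => e; have := legendre11_eq1 leg; rewrite e.
have [a [e [ha he]]] := clausen_parameters p3.
have [m [n [norm_p ->]]] := norm_form_param exy.
have root1 (r : K) : r ^+ 2 = r - 3%:R -> m%:~R + r *~ n = 0 ->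
    hasse p h (cm_a K) (cm_b K) ^+ 2 = (2 * m + n)%:~R ^+ 2.
  by move=> hr; exact: (cm_hasse_sqr (@tofrac_inj _) (@tofrac_frac K) charK p_odd p2 p3 p7 p11 hr norm_p).
(* The other root of the same equation. *)
have ht' : (1 - t) ^+ 2 = (1 - t) - 3%:R by ring: ht.
have hsq : hasse p h (cm_a K) (cm_b K) ^+ 2 = (2 * m + n)%:~R ^+ 2.
  have : (m%:~R + t *~ n) * (m%:~R + (1 - t) *~ n) = 0.
    transitivity ((m ^+ 2 + m * n + 3 * n ^+ 2)%:~R : K).
      by rewrite -[t *~ n]mulrzr -[(1 - t) *~ n]mulrzr; ring: ht.
    by rewrite norm_p -pmulrn (pcharf0 charK).
  by move/eqP; rewrite mulf_eq0 => /orP[] /eqP; exact: root1.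
rewrite [((2 * m + n) ^+ 2)%:~R]rmorphXn /= -hsq.
rewrite -(scaled_sum_hasse charK p_odd p2 p3 p7 p11 ha he) mulrA.
(* [-11 = (2 t - 1)^2] is a square in the prime field. *)
have e22 : (22%:R : K) ^+ h = (-2)%:~R ^+ h.
  have -> : 22%:R = (-2)%:~R * (2%:R * t - 1) ^+ 2 :> K.
    by rewrite rmorphN /=; ring: ht.
  rewrite (exprMn h) -(exprM _ 2 h) (_ : 2 * h = p.-1)%N; last by rewrite p_odd mul2n.
  rewrite fermat_pred ?mulr1 //.
    rewrite -(pFrobenius_autE charK) rmorphB (rmorphM _ 2%:R) rmorph_nat rmorph1.
    by rewrite /= pFrobenius_autE tp.
  apply/eqP => t0; have : (11%:R : K) = 0.
    by transitivity (- (2%:R * t - 1) ^+ 2); [ring: ht | rewrite t0 expr0n oppr0].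
  by move/eqP; rewrite (natf_eq0 charK) dvdn_prime2 // (negPf p11).
rewrite e22 -expr2 -exprM mulnC (_ : 2 * h = p.-1)%N; last by rewrite p_odd mul2n.
rewrite fermat_pred ?mul1r //; first exact: fermat_int.
by rewrite rmorphN oppr_eq0.
Qed.
End Main.

Theorem theorem4p3 (p : nat) (p_prime : prime p)
    (p_neq2 : p <> 2%N) (p_neq11 : p <> 11%N) :
  (legendre p%:Z 11 = -1 -> eqmod_pint p (p ^ 2) (sum_binom236 p) 0) /\
  (legendre p%:Z 11 = 1 ->
     (exists x y : int, 4 * p%:Z = x ^+ 2 + 11 * y ^+ 2) /\
     (forall x y : int, 4 * p%:Z = x ^+ 2 + 11 * y ^+ 2 ->
        eqmod_pint p p (sum_binom236 p)
          ((legendre (-2) p)%:~R * x%:~R ^+ 2))).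
Proof.
move/eqP: p_neq2 => p2; move/eqP: p_neq11 => p11.
have [K charK] := closed_field_char p_prime.
have p_odd : p = (p./2).*2.+1.
  by rewrite -add1n -{1}(odd_double_half p); case/even_prime: p_prime p2 => -> // ->.
have D0 : ((- 32) ^+ 3 ^+ p.-1 : int) != 0 by rewrite !expf_neq0.
have cop := coprime_denom p_prime p2.
rewrite sum_binom236E ?prime_gt0 //; split=> leg.
  apply: (@eqmod_pint_div p (p ^ 2) _ _ 0) => //.
  rewrite mul0r subr0 -[(p ^ 2)%N%:Z](rmorphXn Posz 2 p).
  exact: (inert_case charK p_odd p2 p11 leg).
split; first exact: (split_norm_form charK leg).
move=> x y exy; rewrite -(rmorphXn (intmul 1) 2) -intrM.
apply: eqmod_pint_div => //.
exact: (split_case charK p_odd p2 p11 leg exy).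
Qed.
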